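(* Let $\mathbb k$ be a field. Then the category $\mathbf{dgVect}_{\mathbb k}$ of differential $\mathbb Z$-graded vector spaces over $\mathbb k$ is a symmetric closed monoidal category that satisfies all of the Properties (P1)–(P10), (P5a) listed in the context and their duals. Moreover, all monomorphisms and epimorphisms in $\mathbf{dgVect}_{\mathbb k}$ are extremal and (i) the functor $(-)^*$ maps monomorphisms to epimorphisms; (ii) $\alpha_V$, $\theta_{U,V}$ and $\left(\theta^{\mathrm{inv}}_{U,V}\right)^\flat$ are monomorphisms for any dg-vector spaces $U,V$; (iii) $\varkappa_A$ is a monomorphism for every unital associative dg-algebra $A$ (i.e. every monoid in $\mathbf{dgVect}_{\mathbb k}$).
   Context: The category. Objects of $\mathbf{dgVect}_{\mathbb k}$ are families $(V_n)_{n\in\mathbb Z}$ of $\mathbb k$-vector spaces with linear differentials $d\colon V_n\to V_{n-1}$, $d^2=0$; morphisms are degree-$0$ graded linear maps commuting with $d$. The monoidal product is $(U\otimes V)_n=\bigoplus_{k}U_k\otimes V_{n-k}$ with $d(u\otimes v)=du\otimes v+(-1)^ku\otimes dv$ for $u\in U_k$; the unit is $\mathbb k$ in degree $0$; the symmetry is $c(u\otimes v)=(-1)^{km}v\otimes u$ for $u\in U_k$, $v\in V_m$. General notions in a pre-rigid braided monoidal category $(\mathcal C,\otimes,\mathbf 1,c)$ (each $A$ has $A^*$ and $\mathrm{ev}_A\colon A^*\otimes A\to\mathbf 1$ inducing bijections $\mathcal C(B,A^* )\cong\mathcal C(B\otimes A,\mathbf 1)$, $f\mapsto \mathrm{ev}_A(f\otimes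 \mathrm{id}_A)$; a closed category, i.e. one in which each $(-)\otimes A$ has a right adjoint $[A,-]$, is pre-rigid with $A^*=[A,\mathbf 1]$). For $f\colon A\to B$, $f^*$ is given by $\mathrm{ev}_A(f^*\otimes \mathrm{id}_A)=\mathrm{ev}_B(\mathrm{id}_{B^*}\otimes f)$. $\theta_{A,B},\theta^{\mathrm{inv}}_{A,B}\colon A^*\otimes B^*\to(A\otimes B)^*$ are given by $\mathrm{ev}_{A\otimes B}(\theta_{A,B}\otimes \mathrm{id})=(\mathrm{ev}_A\otimes \mathrm{ev}_B)(\mathrm{id}_{A^*}\otimes c^{-1}_{A,B^*}\otimes \mathrm{id}_B)$ and $\mathrm{ev}_{A\otimes B}(\theta^{\mathrm{inv}}_{A,B}\otimes \mathrm{id})=(\mathrm{ev}_A\otimes \mathrm{ev}_B)(\mathrm{id}_{A^*}\otimes c_{B^*,A}\otimes \mathrm{id}_B)$; $\iota\colon\mathbf 1\to\mathbf 1^*$ by: $\mathrm{ev}_{\mathbf 1}(\iota\otimes \mathrm{id})$ is the canonical isomorphism. For $g\colon B\to A^*$, $g^\flat\colon A\to B^*$ is given by $\mathrm{ev}_B(g^\flat\otimes \mathrm{id}_B)c_{B,A}=\mathrm{ev}_A(g\otimes \mathrm{id}_A)$; $\alpha_A:=(\mathrm{id}_{A^*})^\flat\colon A\to A^{**}$. For a comonoid $C$, $C^*$ is a monoid with multiplication $\Delta^*\theta_{C,C}$ and unit $\varepsilon^*\iota$. The finite dual $(-)^\circ\colon\mathsf{Mon}(\mathcal C)\to\mathsf{Comon}(\mathcal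 C)$ is the contravariant functor with a natural bijection $\mathsf{Mon}(\mathcal C)(A,C^* )\cong\mathsf{Comon}(\mathcal C)(C,A^\circ)$ (it exists in the category considered here); if $\eta_A\colon A\to A^{\circ*}$ corresponds to $\mathrm{id}_{A^\circ}$, then $\varkappa_A\colon A^\circ\to A^*$ is defined by $\mathrm{ev}_A(\varkappa_A\otimes \mathrm{id}_A)=\mathrm{ev}_{A^\circ}(\eta_A\otimes \mathrm{id}_{A^\circ})c_{A^\circ,A}$. Properties of a monoidal category $\mathcal C$: (P1) all small limits exist; (P2) finite and countable colimits exist; (P3) $\mathcal C$ is (Epi, ExtrMono)-structured (every morphism is an epimorphism followed by an extremal monomorphism, and the unique diagonalization property holds for these classes); (P4) $\mathcal C$ is wellpowered; (P5) for every monomorphism $f$ and object $M$, $f\otimes \mathrm{id}_M$ and $\mathrm{id}_M\otimes f$ are monomorphisms; (P5a) for every extremal monomorphism $f$, $f\otimes f$ is an extremal monomorphism; (P6) each $M\otimes(-)$ preserves limits (intersections) of extremal subobjects; (P7) each $M\otimes(-)$ preserves preimages, i.e. pullbacks of a monomorphism along an arbitrary morphism; (P8) for any nonempty small set $\Lambda$ and objects $M$, $A_\lambda$, the canonical morphism $M\otimes\prod_\lambda A_\lambda\to\prod_\lambda(M\otimes A_\lambda)$ is a monomorphism; (P9) each $M\otimes(-)$ preserves equalizers; (P10) the forgetful functor $\mathsf{Mon}(\mathcal C)\to\mathcal C$ has a left adjoint. The dual of a property is the same property for $\mathcal C^{\mathrm{op}}$ with the same monoidal product. *)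

(* Defs.v *)
From HB Require Import structures.
From mathcomp Require Import all_boot all_algebra.
From mathcomp Require Import boolp.

Set Implicit Arguments.
Unset Strict Implicit.
Unset Printing Implicit Defensive.

Import GRing.Theory.
Local Open Scope ring_scope.

(* The universe containing the carriers of vector spaces: "small" index sets
   and shapes of (co)limits range over it. *)
Notation small := Type@{GRing.Lmodule.axioms_.u0}.

Record is_category (Ob : Type) (Ar : Ob -> Ob -> Type) := IsCategory {
  cat_id : forall A, Ar A A;
  cat_comp : forall A B D, Ar B D -> Ar A B -> Ar A D;
  cat_compA : forall A B D E (h : Ar D E) (g : Ar B D) (f : Ar A B),
    cat_comp h (cat_comp g f) = cat_comp (cat_comp h g) f;
  cat_comp1m : forall A B (f : Ar A B), cat_comp (cat_id B) f = f;
  cat_compm1 : forall A B (f : Ar A B), cat_comp f (cat_id A) = f }.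

Record category := Category {
  obj :> Type;
  mor : obj -> obj -> Type;
  cat_str : is_category mor }.

Record small_category := SmallCategory {
  small_obj : small;
  small_hom : small_obj -> small_obj -> small;
  small_str : is_category small_hom }.

Coercion small_cat (J : small_category) : category := Category (small_str J).

Definition idm (C : category) (A : C) : mor A A := cat_id (cat_str C) A.
Definition compm (C : category) (A B D : C) (g : mor B D) (f : mor A B) :
  mor A D := cat_comp (cat_str C) g f.

Notation "g \oc f" := (compm g f) (at level 40, left associativity).

Section CategoryTheory.
Variable C : category.
Implicit Types A B D : C.

Lemma compmA A B D E (h : mor D E) (g : mor B D) (f : mor A B) :
  h \oc (g \oc f) = h \oc g \oc f.
Proof. exact: cat_compA. Qed.

Lemma comp1m A B (f : mor A B) : idm B \oc f = f.
Proof. exact: cat_comp1m. Qed.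

Lemma compm1 A B (f : mor A B) : f \oc idm A = f.
Proof. exact: cat_compm1. Qed.

Definition op_str : is_category (fun A B : C => mor B A) :=
  @IsCategory C (fun A B => mor B A) (@idm C)
    (fun A B D (g : mor D B) (f : mor B A) => f \oc g)
    (fun A B D E h g f => esym (compmA f g h))
    (fun A B f => compm1 f) (fun A B f => comp1m f).

Definition op : category := Category op_str.

Definition mono A B (f : mor A B) :=
  forall T (g h : mor T A), f \oc g = f \oc h -> g = h.

Definition epi A B (f : mor A B) :=
  forall T (g h : mor B T), g \oc f = h \oc f -> g = h.

Definition iso A B (f : mor A B) :=
  exists g : mor B A, g \oc f = idm A /\ f \oc g = idm B.

Definition extremal_mono A B (m : mor A B) :=
  mono m /\
  forall D (e : mor A D) (f : mor D B), m = f \oc e -> epi e -> iso e.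

Definition extremal_epi A B (e : mor A B) :=
  epi e /\
  forall D (f : mor A D) (m : mor D B), e = m \oc f -> mono m -> iso m.

Definition is_product (L : Type) (X : L -> C) P (p : forall l, mor P (X l)) :=
  forall T (q : forall l, mor T (X l)),
    exists! u : mor T P, forall l, p l \oc u = q l.

Definition is_equalizer A B (f g : mor A B) E (e : mor E A) :=
  f \oc e = g \oc e /\
  forall T (t : mor T A), f \oc t = g \oc t ->
    exists! u : mor T E, e \oc u = t.

Definition is_pullback A B D (f : mor A D) (g : mor B D)
    P (p : mor P A) (q : mor P B) :=
  f \oc p = g \oc q /\
  forall T (s : mor T A) (t : mor T B), f \oc s = g \oc t ->
    exists! u : mor T P, p \oc u = s /\ q \oc u = t.

(* [d] is the intersection of the family [m], i.e. the limit of the diagram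
   consisting of all the [m i]; for an empty family this means [d] is iso. *)
Definition is_intersection A (L : Type) (S : L -> C)
    (m : forall i, mor (S i) A) D (d : mor D A) (p : forall i, mor D (S i)) :=
  (forall i, m i \oc p i = d) /\
  forall T (t : mor T A) (q : forall i, mor T (S i)),
    (forall i, m i \oc q i = t) ->
    exists! u : mor T D, d \oc u = t /\ forall i, p i \oc u = q i.

End CategoryTheory.

Record functor (C D : category) := Functor {
  fobj :> C -> D;
  fmap : forall A B, mor A B -> mor (fobj A) (fobj B);
  fmap1 : forall A, fmap (idm A) = idm (fobj A);
  fmapM : forall A B E (g : mor B E) (f : mor A B),
    fmap (g \oc f) = fmap g \oc fmap f }.

Arguments fmap {C D} _ [A B] _.

Record adjunction (C D : category) (F : functor C D) (G : functor D C) :=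
  Adjunction {
  adj_phi : forall X Y, mor (F X) Y -> mor X (G Y);
  adj_psi : forall X Y, mor X (G Y) -> mor (F X) Y;
  adj_phiK : forall X Y (f : mor (F X) Y), adj_psi (adj_phi f) = f;
  adj_psiK : forall X Y (g : mor X (G Y)), adj_phi (adj_psi g) = g;
  adj_nat : forall X X' Y Y' (f : mor X' X) (g : mor Y Y') (h : mor (F X) Y),
    adj_phi (g \oc h \oc fmap F f) = fmap G g \oc adj_phi h \oc f }.

Arguments adj_phi {C D F G} _ [X Y] _.
Arguments adj_psi {C D F G} _ [X Y] _.

Record right_adjoint (C D : category) (F : functor C D) := RightAdjoint {
  radj :> functor D C;
  radj_adj : adjunction F radj }.

Definition has_left_adjoint (C D : category) (G : functor D C) :=
  exists F : functor C D, inhabited (adjunction F G).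

Section Limits.
Variables (J C : category) (D : functor J C).

Definition is_limit (L : C) (p : forall j, mor L (D j)) :=
  (forall i j (u : mor i j), fmap D u \oc p i = p j) /\
  forall (T : C) (q : forall j, mor T (D j)),
    (forall i j (u : mor i j), fmap D u \oc q i = q j) ->
    exists! h : mor T L, forall j, p j \oc h = q j.

Definition is_colimit (L : C) (p : forall j, mor (D j) L) :=
  (forall i j (u : mor i j), p j \oc fmap D u = p i) /\
  forall (T : C) (q : forall j, mor (D j) T),
    (forall i j (u : mor i j), q j \oc fmap D u = q i) ->
    exists! h : mor L T, forall j, h \oc p j = q j.

End Limits.

(* At most countably many arrows (hence objects); finite shapes included. *)
Definition countable_shape (J : small_category) :=
  exists code : {i : J & {j : J & mor i j}} -> nat, injective code.

Record is_monoidal (C : category) (T : C -> C -> C) (I : C) := IsMonoidal {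
  mon_tens : forall A A' B B' : C,
    mor A A' -> mor B B' -> mor (T A B) (T A' B');
  mon_assoc : forall A B D : C, mor (T (T A B) D) (T A (T B D));
  mon_associ : forall A B D : C, mor (T A (T B D)) (T (T A B) D);
  mon_lunit : forall A : C, mor (T I A) A;
  mon_luniti : forall A : C, mor A (T I A);
  mon_runit : forall A : C, mor (T A I) A;
  mon_runiti : forall A : C, mor A (T A I);
  mon_tens1 : forall A B, mon_tens (idm A) (idm B) = idm (T A B);
  mon_tensM : forall A A' A'' B B' B'' (f' : mor A' A'') (f : mor A A')
      (g' : mor B' B'') (g : mor B B'),
    mon_tens (f' \oc f) (g' \oc g) = mon_tens f' g' \oc mon_tens f g;
  mon_assocK : forall A B D, mon_associ A B D \oc mon_assoc A B D = idm _;
  mon_associK : forall A B D, mon_assoc A B D \oc mon_associ A B D = idm _;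
  mon_lunitK : forall A, mon_luniti A \oc mon_lunit A = idm _;
  mon_lunitiK : forall A, mon_lunit A \oc mon_luniti A = idm _;
  mon_runitK : forall A, mon_runiti A \oc mon_runit A = idm _;
  mon_runitiK : forall A, mon_runit A \oc mon_runiti A = idm _;
  mon_assoc_nat : forall A A' B B' D D' (f : mor A A') (g : mor B B')
      (h : mor D D'),
    mon_assoc A' B' D' \oc mon_tens (mon_tens f g) h
      = mon_tens f (mon_tens g h) \oc mon_assoc A B D;
  mon_lunit_nat : forall A A' (f : mor A A'),
    mon_lunit A' \oc mon_tens (idm I) f = f \oc mon_lunit A;
  mon_runit_nat : forall A A' (f : mor A A'),
    mon_runit A' \oc mon_tens f (idm I) = f \oc mon_runit A;
  mon_pentagon : forall A B D E,
    mon_tens (idm A) (mon_assoc B D E) \oc mon_assoc A (T B D) E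
        \oc mon_tens (mon_assoc A B D) (idm E)
      = mon_assoc A B (T D E) \oc mon_assoc (T A B) D E;
  mon_triangle : forall A B,
    mon_tens (idm A) (mon_lunit B) \oc mon_assoc A I B
      = mon_tens (mon_runit A) (idm B) }.

Record monoidal := Monoidal {
  mon_cat :> category;
  tens : mon_cat -> mon_cat -> mon_cat;
  unit_ob : mon_cat;
  mon_str : is_monoidal tens unit_ob }.

Arguments unit_ob : clear implicits.

Notation "A \ox B" := (tens A B) (at level 40, left associativity).

Section MonoidalOps.
Variable M : monoidal.
Implicit Types A B D : M.

Definition tensm A A' B B' (f : mor A A') (g : mor B B') :
  mor (A \ox B) (A' \ox B') := mon_tens (mon_str M) f g.
Definition assoc A B D : mor (A \ox B \ox D) (A \ox (B \ox D)) :=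
  mon_assoc (mon_str M) A B D.
Definition associ A B D : mor (A \ox (B \ox D)) (A \ox B \ox D) :=
  mon_associ (mon_str M) A B D.
Definition lunit A : mor (unit_ob M \ox A) A := mon_lunit (mon_str M) A.
Definition luniti A : mor A (unit_ob M \ox A) := mon_luniti (mon_str M) A.
Definition runit A : mor (A \ox unit_ob M) A := mon_runit (mon_str M) A.
Definition runiti A : mor A (A \ox unit_ob M) := mon_runiti (mon_str M) A.

End MonoidalOps.

Notation "f \otm g" := (tensm f g) (at level 35).

Section MonoidalTheory.
Variable M : monoidal.
Implicit Types A B D E : M.

Lemma tensm1 A B : idm A \otm idm B = idm (A \ox B).
Proof. exact: mon_tens1. Qed.

Lemma tensmM A A' A'' B B' B'' (f' : mor A' A'') (f : mor A A')
    (g' : mor B' B'') (g : mor B B') :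
  (f' \oc f) \otm (g' \oc g) = (f' \otm g') \oc (f \otm g).
Proof. exact: mon_tensM. Qed.

Lemma associ_nat A A' B B' D D' (f : mor A A') (g : mor B B') (h : mor D D') :
  associ A' B' D' \oc (f \otm (g \otm h))
    = ((f \otm g) \otm h) \oc associ A B D.
Proof.
have := congr1 (fun x => associ A' B' D' \oc x \oc associ A B D)
  (mon_assoc_nat (mon_str M) f g h).
rewrite !compmA [associ _ _ _ \oc _]mon_assocK comp1m => ->.
by rewrite -compmA [_ \oc associ _ _ _]mon_associK compm1.
Qed.

Lemma luniti_nat A A' (f : mor A A') :
  (idm (unit_ob M) \otm f) \oc luniti A = luniti A' \oc f.
Proof.
have := congr1 (fun x => luniti A' \oc x \oc luniti A)
  (mon_lunit_nat (mon_str M) f).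
rewrite !compmA [luniti _ \oc _]mon_lunitK comp1m => ->.
by rewrite -compmA [_ \oc luniti _]mon_lunitiK compm1.
Qed.

Lemma runiti_nat A A' (f : mor A A') :
  (f \otm idm (unit_ob M)) \oc runiti A = runiti A' \oc f.
Proof.
have := congr1 (fun x => runiti A' \oc x \oc runiti A)
  (mon_runit_nat (mon_str M) f).
rewrite !compmA [runiti _ \oc _]mon_runitK comp1m => ->.
by rewrite -compmA [_ \oc runiti _]mon_runitiK compm1.
Qed.

Lemma tensm_inv A A' B B' (f : mor A A') (f' : mor A' A) (g : mor B B')
    (g' : mor B' B) : f' \oc f = idm A -> g' \oc g = idm B ->
  (f' \otm g') \oc (f \otm g) = idm _.
Proof. by move=> e1 e2; rewrite -tensmM e1 e2 tensm1. Qed.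

Lemma inv_uniq A B (f : mor A B) (g g' : mor B A) :
  g \oc f = idm A -> f \oc g' = idm B -> g = g'.
Proof. by move=> e1 e2; rewrite -[g]compm1 -e2 compmA e1 comp1m. Qed.

Lemma inv_comp A B D (f : mor A B) (f' : mor B A) (g : mor B D) (g' : mor D B) :
  f' \oc f = idm A -> g' \oc g = idm B -> (f' \oc g') \oc (g \oc f) = idm A.
Proof. by move=> e1 e2; rewrite compmA -(compmA f') e2 compm1. Qed.

Lemma pentagon_inv A B D E :
  (associ A B D \otm idm E) \oc (associ A (B \ox D) E
     \oc (idm A \otm associ B D E))
  = associ (A \ox B) D E \oc associ A B (D \ox E).
Proof.
apply: (@inv_uniq _ _ (assoc A B (D \ox E) \oc assoc (A \ox B) D E)).
- rewrite -[_ \oc assoc _ _ _]mon_pentagon.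
  apply: inv_comp.
  + by apply: tensm_inv; [exact: mon_assocK | exact: comp1m].
  + apply: inv_comp; first exact: mon_assocK.
    by apply: tensm_inv; [exact: comp1m | exact: mon_assocK].
- by apply: inv_comp; exact: mon_associK.
Qed.

Lemma triangle_inv A B :
  associ A (unit_ob M) B \oc (idm A \otm luniti B) = runiti A \otm idm B.
Proof.
apply: (@inv_uniq _ _ (runit A \otm idm B)).
- rewrite -[runit _ \otm _]mon_triangle.
  apply: inv_comp; first exact: mon_assocK.
  by apply: tensm_inv; [exact: comp1m | exact: mon_lunitK].
- by apply: tensm_inv; [exact: mon_runitiK | exact: comp1m].
Qed.

Definition op_mon_str : is_monoidal (C := op M) (@tens M) (unit_ob M) :=
  @IsMonoidal (op M) (@tens M) (unit_ob M)
    (fun A A' B B' (f : mor A' A) (g : mor B' B) => f \otm g)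
    (@associ M) (@assoc M) (@luniti M) (@lunit M) (@runiti M) (@runit M)
    tensm1 (fun A A' A'' B B' B'' f' f g' g => tensmM f f' g g')
    (mon_assocK (mon_str M)) (mon_associK (mon_str M))
    (mon_lunitK (mon_str M)) (mon_lunitiK (mon_str M))
    (mon_runitK (mon_str M)) (mon_runitiK (mon_str M))
    (fun A A' B B' D D' f g h => esym (associ_nat f g h))
    (fun A A' f => luniti_nat f) (fun A A' f => runiti_nat f)
    pentagon_inv triangle_inv.

Definition op_mon : monoidal := Monoidal op_mon_str.

Definition tensr A : functor M M :=
  @Functor M M (fun X => X \ox A) (fun X Y f => f \otm idm A)
    (fun X => tensm1 X A)
    (fun X Y Z g f =>
       etrans (congr1 (tensm (g \oc f)) (esym (comp1m (idm A))))
         (tensmM g f (idm A) (idm A))).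

End MonoidalTheory.

Record is_braided (M : monoidal) := IsBraided {
  braid : forall A B : M, mor (A \ox B) (B \ox A);
  braidi : forall A B : M, mor (B \ox A) (A \ox B);
  braidK : forall A B, braidi A B \oc braid A B = idm _;
  braidiK : forall A B, braid A B \oc braidi A B = idm _;
  braid_nat : forall (A A' B B' : M) (f : mor A A') (g : mor B B'),
    braid A' B' \oc (f \otm g) = (g \otm f) \oc braid A B;
  braid_hex1 : forall A B D : M,
    assoc B D A \oc braid A (B \ox D) \oc assoc A B D
      = (idm B \otm braid A D) \oc assoc B A D \oc (braid A B \otm idm D);
  braid_hex2 : forall A B D : M,
    associ D A B \oc braid (A \ox B) D \oc associ A B D
      = (braid A D \otm idm B) \oc associ A D B \oc (idm A \otm braid B D) }.

Definition symmetric_braiding (M : monoidal) (c : is_braided M) :=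
  forall A B : M, braid c B A \oc braid c A B = idm (A \ox B).

(* [cl A] is the internal hom functor [A, -]. *)
Definition closed_structure (M : monoidal) := forall A : M, right_adjoint (tensr A).

Record monoid_data (M : monoidal) := MonoidData {
  mcar :> M;
  mmul : mor (mcar \ox mcar) mcar;
  mone : mor (unit_ob M) mcar }.

Record monoid (M : monoidal) := Monoid {
  mdata :> monoid_data M;
  mmulA : mmul mdata \oc (mmul mdata \otm idm _)
    = mmul mdata \oc (idm _ \otm mmul mdata) \oc assoc _ _ _;
  mmul1m : mmul mdata \oc (mone mdata \otm idm _) = lunit mdata;
  mmulm1 : mmul mdata \oc (idm _ \otm mone mdata) = runit mdata }.

Record monoid_hom (M : monoidal) (A B : monoid_data M) := MonoidHom {
  mhom :> mor (mcar A) (mcar B);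
  mhomM : mhom \oc mmul A = mmul B \oc (mhom \otm mhom);
  mhom1 : mhom \oc mone A = mone B }.

Lemma monoid_hom_ext (M : monoidal) (A B : monoid_data M)
  (f g : monoid_hom A B) : mhom f = mhom g -> f = g.
Proof.
case: f g => [f fM f1] [g gM g1] /= e; case: _ / e in gM g1 *.
by rewrite (Prop_irrelevance fM gM) (Prop_irrelevance f1 g1).
Qed.

Section MonoidCategory.
Variable M : monoidal.

Lemma monoid_idM (A : monoid_data M) :
  idm (mcar A) \oc mmul A = mmul A \oc (idm (mcar A) \otm idm (mcar A)).
Proof. by rewrite tensm1 comp1m compm1. Qed.

Lemma monoid_compM (A B D : monoid_data M) (g : monoid_hom B D)
    (f : monoid_hom A B) :
  mhom g \oc mhom f \oc mmul A
    = mmul D \oc ((mhom g \oc mhom f) \otm (mhom g \oc mhom f)).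
Proof. by rewrite tensmM -compmA mhomM compmA mhomM compmA. Qed.

Lemma monoid_comp1 (A B D : monoid_data M) (g : monoid_hom B D)
    (f : monoid_hom A B) : mhom g \oc mhom f \oc mone A = mone D.
Proof. by rewrite -compmA !mhom1. Qed.

Definition monoid_id (A : monoid_data M) : monoid_hom A A :=
  MonoidHom (monoid_idM A) (comp1m (mone A)).

Definition monoid_comp (A B D : monoid_data M) (g : monoid_hom B D)
    (f : monoid_hom A B) : monoid_hom A D :=
  MonoidHom (monoid_compM g f) (monoid_comp1 g f).

Definition Mon_str : is_category (fun A B : monoid M => monoid_hom A B) :=
  @IsCategory (monoid M) (fun A B => monoid_hom A B) (fun A => monoid_id A)
    (fun A B D g f => monoid_comp g f)
    (fun A B D E h g f =>
       @monoid_hom_ext M A E (monoid_comp h (monoid_comp g f))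
         (monoid_comp (monoid_comp h g) f) (compmA (mhom h) (mhom g) (mhom f)))
    (fun A B f =>
       @monoid_hom_ext M A B (monoid_comp (monoid_id B) f) f (comp1m (mhom f)))
    (fun A B f =>
       @monoid_hom_ext M A B (monoid_comp f (monoid_id A)) f (compm1 (mhom f))).

Definition Mon : category := Category Mon_str.

Definition Mon_forget : functor Mon M :=
  @Functor Mon M (fun A => mcar A) (fun A B f => mhom f)
    (fun A => erefl) (fun A B D g f => erefl).

End MonoidCategory.

(* A comonoid of [M] is a monoid of the opposite category. *)
Section Comonoids.
Variable M : monoidal.

Definition Comon : category := op (Mon (op_mon M)).

Definition ccar (D : Comon) : M := mcar (mdata D).
Definition comul (D : Comon) : mor (ccar D) (ccar D \ox ccar D) :=
  mmul (mdata D).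
Definition counit (D : Comon) : mor (ccar D) (unit_ob M) := mone (mdata D).
Definition comhom (D E : Comon) (f : mor D E) : mor (ccar D) (ccar E) := mhom f.

End Comonoids.

Record prerigid (M : monoidal) := Prerigid {
  pr_dual : M -> M;
  ev : forall A : M, mor (pr_dual A \ox A) (unit_ob M);
  pr_curry : forall A B : M, mor (B \ox A) (unit_ob M) -> mor B (pr_dual A);
  curryK : forall (A B : M) (f : mor (B \ox A) (unit_ob M)),
    ev A \oc (pr_curry f \otm idm A) = f;
  uncurryK : forall (A B : M) (f : mor B (pr_dual A)),
    pr_curry (ev A \oc (f \otm idm A)) = f }.

Arguments pr_curry {M} _ [A B] _.

Section ClosedPrerigid.
Variables (M : monoidal) (cl : closed_structure M).

Definition closed_ev (A : M) : mor (cl A (unit_ob M) \ox A) (unit_ob M) :=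
  adj_psi (radj_adj (cl A)) (idm (cl A (unit_ob M))).

Lemma closed_evE (A B : M) (f : mor B (cl A (unit_ob M))) :
  closed_ev A \oc (f \otm idm A) = adj_psi (radj_adj (cl A)) f.
Proof.
have := @adj_nat _ _ _ _ (radj_adj (cl A)) _ _ _ _ f (idm _) (closed_ev A).
rewrite adj_psiK fmap1 !comp1m => e; rewrite -[in RHS]e.
by apply: esym; exact: (@adj_phiK _ _ _ _ (radj_adj (cl A))).
Qed.

Definition closed_prerigid : prerigid M :=
  @Prerigid M (fun A => cl A (unit_ob M)) closed_ev
    (fun A B f => adj_phi (radj_adj (cl A)) f)
    (fun A B f => etrans (closed_evE _)
                    (adj_phiK (radj_adj (cl A)) (f : mor (tensr A B) _)))
    (fun A B f => etrans (congr1 _ (closed_evE f))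
                    (adj_psiK (radj_adj (cl A)) f)).

End ClosedPrerigid.

Section Duality.
Variables (M : monoidal) (c : is_braided M) (pr : prerigid M).
Implicit Types A B : M.
Local Notation star := (pr_dual pr).
Local Notation I := (unit_ob M).

Definition dualm A B (f : mor A B) : mor (star B) (star A) :=
  pr_curry pr (ev pr B \oc (idm (star B) \otm f)).

(* id_W \ox s \ox id_Z, with the associativity constraints made explicit *)
Definition middle (W X Y Z : M) (s : mor (X \ox Y) (Y \ox X)) :
    mor ((W \ox X) \ox (Y \ox Z)) ((W \ox Y) \ox (X \ox Z)) :=
  associ W Y (X \ox Z) \oc (idm W \otm assoc Y X Z)
    \oc (idm W \otm (s \otm idm Z))
    \oc (idm W \otm associ X Y Z) \oc assoc W X (Y \ox Z).

Definition ev2 A B : mor ((star A \ox A) \ox (star B \ox B)) I :=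
  lunit I \oc (ev pr A \otm ev pr B).

Definition theta A B : mor (star A \ox star B) (star (A \ox B)) :=
  pr_curry pr (ev2 A B \oc middle (star A) B (braidi c A (star B))).

Definition theta_inv A B : mor (star A \ox star B) (star (A \ox B)) :=
  pr_curry pr (ev2 A B \oc middle (star A) B (braid c (star B) A)).

Definition iotam : mor I (star I) := pr_curry pr (lunit I).

(* The unique [h] with ev_B (h \ox id_B) c_{B,A} = ev_A (g \ox id_A). *)
Definition flat A B (g : mor B (star A)) : mor A (star B) :=
  pr_curry pr (ev pr A \oc (g \otm idm A) \oc braidi c B A).

Definition alpha A : mor A (star (star A)) := flat (idm (star A)).

(* The monoid C^*.  Only its operations matter for Mon(A, C^* ), as morphisms are
   defined between [monoid_data]. *)
Definition dual_monoid (D : Comon M) : monoid_data M :=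
  MonoidData (dualm (comul D) \oc theta (ccar D) (ccar D))
             (dualm (counit D) \oc iotam).

(* [fd_bij] is the natural bijection in the direction
   Comon(D, A^o) -> Mon(A, D^* ). *)
Record finite_dual := FiniteDual {
  fd :> functor (op (Mon M)) (Comon M);
  fd_bij : forall (A : Mon M) (D : Comon M),
    mor D (fd A) -> monoid_hom A (dual_monoid D);
  fd_bijective : forall (A : Mon M) (D : Comon M), bijective (@fd_bij A D);
  fd_natl : forall (A A' : Mon M) (D : Comon M) (a : mor A' A)
      (h : mor D (fd A)),
    mhom (fd_bij (fmap fd (a : @mor (op (Mon M)) A A') \oc h))
      = mhom (fd_bij h) \oc mhom a;
  fd_natr : forall (A : Mon M) (D D' : Comon M) (g : mor D' D)
      (h : mor D (fd A)),
    mhom (fd_bij (h \oc g)) = dualm (comhom g) \oc mhom (fd_bij h) }.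

Definition fd_eta (F : finite_dual) (A : Mon M) :
    mor (mcar A) (star (ccar (F A))) := mhom (fd_bij (idm (F A))).

Definition kappa (F : finite_dual) (A : Mon M) :
    mor (ccar (F A)) (star (mcar A)) :=
  pr_curry pr (ev pr (ccar (F A)) \oc (fd_eta F A \otm idm (ccar (F A)))
              \oc braid c (ccar (F A)) (mcar A)).

End Duality.

Section Properties.
Variable M : monoidal.

Definition P1 := forall (J : small_category) (D : functor J M),
  exists (L : M) (p : forall j, mor L (D j)), is_limit p.

Definition P2 := forall (J : small_category) (D : functor J M),
  countable_shape J -> exists (L : M) (p : forall j, mor (D j) L), is_colimit p.

Definition P3 :=
  (forall (A B : M) (f : mor A B),
     exists (D : M) (e : mor A D) (m : mor D B),
       [/\ f = m \oc e, epi e & extremal_mono m]) /\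
  (forall (A B X Y : M) (e : mor A B) (m : mor X Y) (f : mor A X)
      (g : mor B Y), epi e -> extremal_mono m -> g \oc e = m \oc f ->
     exists! d : mor B X, d \oc e = f /\ m \oc d = g).

(* The subobjects of A are represented by a small family of monomorphisms. *)
Definition P4 := forall A : M,
  exists (L : small) (S : L -> M) (m : forall l, mor (S l) A),
    (forall l, mono (m l)) /\
    forall (B : M) (f : mor B A), mono f ->
      exists (l : L) (u : mor B (S l)), iso u /\ f = m l \oc u.

Definition P5 := forall (A B N : M) (f : mor A B), mono f ->
  mono (f \otm idm N) /\ mono (idm N \otm f).

Definition P5a := forall (A B : M) (f : mor A B),
  extremal_mono f -> extremal_mono (f \otm f).

Definition P6 := forall (N A : M) (L : small) (S : L -> M)
    (m : forall l, mor (S l) A) (D : M) (d : mor D A)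
    (p : forall l, mor D (S l)),
  (forall l, extremal_mono (m l)) -> is_intersection m d p ->
  is_intersection (fun l => idm N \otm m l) (idm N \otm d)
    (fun l => idm N \otm p l).

Definition P7 := forall (N A B D : M) (f : mor A D) (m : mor B D)
    (P : M) (p : mor P A) (q : mor P B),
  mono m -> is_pullback f m p q ->
  is_pullback (idm N \otm f) (idm N \otm m) (idm N \otm p) (idm N \otm q).

Definition P8 := forall (L : small) (N : M) (A : L -> M)
    (P : M) (p : forall l, mor P (A l))
    (Q : M) (q : forall l, mor Q (N \ox A l)) (can : mor (N \ox P) Q),
  inhabited L -> is_product p -> is_product q ->
  (forall l, q l \oc can = idm N \otm p l) -> mono can.

Definition P9 := forall (N A B : M) (f g : mor A B) (E : M) (e : mor E A),
  is_equalizer f g e ->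
  is_equalizer (idm N \otm f) (idm N \otm g) (idm N \otm e).

Definition P10 := has_left_adjoint (Mon_forget M).

Definition all_properties :=
  [/\ P1, P2, P3, P4 & P5] /\ [/\ P5a, P6, P7, P8 & P9] /\ P10.

End Properties.

Definition is_bilinear (k : fieldType) (U V W : lmodType k) (b : U -> V -> W) :=
  (forall v, linear (b^~ v)) /\ (forall u, linear (b u)).

Section TensorSpace.
Local Open Scope quotient_scope.
Variables (k : fieldType) (U V : lmodType k).

(* Elements of the tensor product are formal finite sums of pairs (u, v), two
   of them being identified when every bilinear map takes the same value on
   both, i.e. modulo the bilinearity relations. *)
Definition bsum (W : lmodType k) (b : U -> V -> W) (s : seq (U * V)) : W :=
  \sum_(p <- s) b p.1 p.2.

Definition tens_eq (s t : seq (U * V)) : bool :=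
  `[< forall (W : lmodType k) (b : U -> V -> W),
        is_bilinear b -> bsum b s = bsum b t >].

Lemma tens_eqP s t :
  reflect (forall (W : lmodType k) (b : U -> V -> W),
             is_bilinear b -> bsum b s = bsum b t) (tens_eq s t).
Proof. exact: asboolP. Qed.

Lemma tens_eq_equiv : equiv_class_of tens_eq.
Proof.
split.
- by move=> s; apply/tens_eqP.
- by move=> s t; apply/tens_eqP/tens_eqP => e W b bP; rewrite e.
- by move=> t s r /tens_eqP e1 /tens_eqP e2; apply/tens_eqP => W b bP;
    rewrite e1 // e2.
Qed.

Canonical tens_eq_equiv_rel := EquivRelPack tens_eq_equiv.

Definition tensor_space : Type := {eq_quot tens_eq}.
HB.instance Definition _ := Choice.on tensor_space.
HB.instance Definition _ := EqQuotient.on tensor_space.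

Definition tcls (s : seq (U * V)) : tensor_space := \pi_(tensor_space) s.
Definition trep (x : tensor_space) : seq (U * V) := repr x.

Lemma trepK x : tcls (trep x) = x.
Proof. exact: reprK. Qed.

Lemma tcls_eq s t :
  (forall (W : lmodType k) (b : U -> V -> W),
     is_bilinear b -> bsum b s = bsum b t) -> tcls s = tcls t.
Proof. by move=> e; apply/eqquotP/tens_eqP. Qed.

Lemma bsum_trep (W : lmodType k) (b : U -> V -> W) s :
  is_bilinear b -> bsum b (trep (tcls s)) = bsum b s.
Proof.
move=> bP; have /tens_eqP : tens_eq (trep (tcls s)) s.
  by apply/eqquotP; exact: reprK.
exact.
Qed.

Definition tzero := tcls [::].
Definition tadd x y := tcls (trep x ++ trep y).
Definition tscale (a : k) x := tcls [seq (a *: p.1, p.2) | p <- trep x].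
Definition topp x := tscale (-1) x.

Section Bsum.
Variables (W : lmodType k) (b : U -> V -> W) (bP : is_bilinear b).

Lemma bsum_cat s t : bsum b (s ++ t) = bsum b s + bsum b t.
Proof. exact: big_cat. Qed.

Lemma bilinearZl a u v : b (a *: u) v = a *: b u v.
Proof.
have b0 : b 0 v = 0.
  have := bP.1 v 1 0 0; rewrite /= scaler0 addr0 scale1r.
  by move/eqP; rewrite -subr_eq0 opprD addNKr oppr_eq0 => /eqP.
by have := bP.1 v a u 0; rewrite /= addr0 b0 addr0.
Qed.

Lemma bilinearDl u u' v : b (u + u') v = b u v + b u' v.
Proof. by have := bP.1 v 1 u u'; rewrite /= !scale1r. Qed.

Lemma bilinearDr u v v' : b u (v + v') = b u v + b u v'.
Proof. by have := bP.2 u 1 v v'; rewrite /= !scale1r. Qed.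

Lemma bilinearZr a u v : b u (a *: v) = a *: b u v.
Proof.
have b0 : b u 0 = 0.
  have := bilinearDr u 0 0; rewrite addr0.
  by move/eqP; rewrite -subr_eq0 opprD addNKr oppr_eq0 => /eqP.
by have := bP.2 u a v 0; rewrite /= addr0 b0 addr0.
Qed.

Lemma bsum_scale a s :
  bsum b [seq (a *: p.1, p.2) | p <- s] = a *: bsum b s.
Proof.
rewrite /bsum big_map scaler_sumr; apply: eq_bigr => p _ /=.
exact: bilinearZl.
Qed.

End Bsum.

Lemma bsum_add (W : lmodType k) (b : U -> V -> W) x y : is_bilinear b ->
  bsum b (trep (tadd x y)) = bsum b (trep x) + bsum b (trep y).
Proof. by move=> bP; rewrite bsum_trep // bsum_cat. Qed.

Lemma bsum_tscale (W : lmodType k) (b : U -> V -> W) a x : is_bilinear b ->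
  bsum b (trep (tscale a x)) = a *: bsum b (trep x).
Proof. by move=> bP; rewrite bsum_trep // bsum_scale. Qed.

Lemma bsum_tzero (W : lmodType k) (b : U -> V -> W) : is_bilinear b ->
  bsum b (trep tzero) = 0.
Proof. by move=> bP; rewrite bsum_trep // /bsum big_nil. Qed.

Lemma tensor_ext x y :
  (forall (W : lmodType k) (b : U -> V -> W),
     is_bilinear b -> bsum b (trep x) = bsum b (trep y)) -> x = y.
Proof. by move=> e; rewrite -[x]trepK -[y]trepK; exact: tcls_eq. Qed.

Definition bsum_simp := (bsum_add, bsum_tscale, bsum_tzero).

Lemma taddA : associative tadd.
Proof. by move=> x y z; apply: tensor_ext => W b bP; rewrite !bsum_simp // addrA. Qed.
Lemma taddC : commutative tadd.
Proof. by move=> x y; apply: tensor_ext => W b bP; rewrite !bsum_simp // addrC. Qed.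
Lemma tadd0 : left_id tzero tadd.
Proof. by move=> x; apply: tensor_ext => W b bP; rewrite !bsum_simp // add0r. Qed.
Lemma taddN : left_inverse tzero topp tadd.
Proof.
move=> x; apply: tensor_ext => W b bP.
by rewrite !bsum_simp // scaleN1r addNr.
Qed.

HB.instance Definition _ :=
  GRing.isZmodule.Build tensor_space taddA taddC tadd0 taddN.

Lemma tscaleA a b x : tscale a (tscale b x) = tscale (a * b) x.
Proof. by apply: tensor_ext => W c cP; rewrite !bsum_simp // scalerA. Qed.
Lemma tscale1 : left_id 1 tscale.
Proof. by move=> x; apply: tensor_ext => W c cP; rewrite !bsum_simp // scale1r. Qed.
Lemma tscaleDr : right_distributive tscale +%R.
Proof.
by move=> a x y; apply: tensor_ext => W c cP; rewrite !bsum_simp // scalerDr.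
Qed.
Lemma tscaleDl x : {morph tscale^~ x : a b / a + b}.
Proof.
by move=> a b; apply: tensor_ext => W c cP; rewrite !bsum_simp // scalerDl.
Qed.

HB.instance Definition _ := GRing.Zmodule_isLmodule.Build k tensor_space
  tscaleA tscale1 tscaleDr tscaleDl.

Definition tpure (u : U) (v : V) : tensor_space := tcls [:: (u, v)].

Definition tlift (W : lmodType k) (b : U -> V -> W) (x : tensor_space) : W :=
  bsum b (trep x).

Lemma tlift_pure (W : lmodType k) (b : U -> V -> W) u v :
  is_bilinear b -> tlift b (tpure u v) = b u v.
Proof. by move=> bP; rewrite /tlift bsum_trep // /bsum big_seq1. Qed.

Lemma bsum_lin (W : lmodType k) (b : U -> V -> W) a (x y : tensor_space) :
  is_bilinear b -> bsum b (trep (a *: x + y))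
    = a *: bsum b (trep x) + bsum b (trep y).
Proof.
by move=> bP; exact: etrans (bsum_add (tscale a x) y bP)
  (congr1 (fun w => w + _) (bsum_tscale a x bP)).
Qed.

Lemma bsum_pure (W : lmodType k) (b : U -> V -> W) u v : is_bilinear b ->
  bsum b (trep (tpure u v)) = b u v.
Proof. exact: tlift_pure. Qed.

Lemma tlift_linear (W : lmodType k) (b : U -> V -> W) :
  is_bilinear b -> linear (tlift b).
Proof. by move=> bP a x y; exact: bsum_lin. Qed.

Lemma tpure_bilinear : is_bilinear tpure.
Proof.
split=> [v a u u' | u a v v'] /=; apply: tensor_ext => W b bP;
  rewrite bsum_lin // !bsum_pure //.
- by rewrite (bilinearDl bP) (bilinearZl bP).
- by rewrite (bilinearDr bP) (bilinearZr bP).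
Qed.

Lemma tensor_gen (P : tensor_space -> Prop) :
  P 0 -> (forall u v, P (tpure u v)) -> (forall x y, P x -> P y -> P (x + y)) ->
  forall x, P x.
Proof.
move=> P0 P1 PD x; rewrite -[x]trepK; elim: (trep x) => [//|[u v] s IH].
suff -> : tcls ((u, v) :: s) = tpure u v + tcls s by apply: PD.
apply: tensor_ext => W b bP; rewrite bsum_add // !bsum_trep //.
by rewrite /bsum big_cons big_seq1.
Qed.

End TensorSpace.

Section DirectSum.
Variables (k : fieldType) (W : int -> lmodType k).

Record direct_sum := DirectSum {
  ds_val :> forall i, W i;
  ds_fin : exists s : seq int, forall i, i \notin s -> ds_val i = 0 }.

HB.instance Definition _ := gen_eqMixin direct_sum.
HB.instance Definition _ := gen_choiceMixin direct_sum.

Lemma ds_ext (x y : direct_sum) : (forall i, x i = y i) -> x = y.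
Proof.
case: x y => [x xP] [y yP] /= e.
have {}e : x = y by exact: functional_extensionality_dep.
by case: _ / e in yP *; rewrite (Prop_irrelevance xP yP).
Qed.

Lemma ds0_fin : exists s : seq int, forall i, i \notin s -> (0 : W i) = 0.
Proof. by exists [::]. Qed.
Definition ds0 : direct_sum := DirectSum ds0_fin.

Lemma dsD_fin (a : k) (x y : direct_sum) :
  exists s : seq int, forall i, i \notin s -> a *: x i + y i = 0.
Proof.
case: (ds_fin x) (ds_fin y) => [s sP] [t tP]; exists (s ++ t) => i.
by rewrite mem_cat negb_or => /andP[/sP -> /tP ->]; rewrite scaler0 addr0.
Qed.
Definition ds_comb a x y : direct_sum := DirectSum (dsD_fin a x y).

Definition dsD x y := ds_comb 1 x y.
Definition dsZ a x := ds_comb a x ds0.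
Definition dsN x := dsZ (-1) x.

Lemma dsDA : associative dsD.
Proof. by move=> x y z; apply: ds_ext => i /=; rewrite !scale1r addrA. Qed.
Lemma dsDC : commutative dsD.
Proof. by move=> x y; apply: ds_ext => i /=; rewrite !scale1r addrC. Qed.
Lemma dsD0 : left_id ds0 dsD.
Proof. by move=> x; apply: ds_ext => i /=; rewrite scale1r add0r. Qed.
Lemma dsDN : left_inverse ds0 dsN dsD.
Proof.
by move=> x; apply: ds_ext => i /=; rewrite scale1r addr0 scaleN1r addNr.
Qed.

HB.instance Definition _ := GRing.isZmodule.Build direct_sum dsDA dsDC dsD0 dsDN.

Lemma ds_addE (x y : direct_sum) i : (x + y) i = x i + y i.
Proof. by rewrite /= scale1r. Qed.

Lemma dsZA a b x : dsZ a (dsZ b x) = dsZ (a * b) x.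
Proof. by apply: ds_ext => i /=; rewrite !addr0 scalerA. Qed.
Lemma dsZ1 : left_id 1 dsZ.
Proof. by move=> x; apply: ds_ext => i /=; rewrite addr0 scale1r. Qed.
Lemma dsZDr : right_distributive dsZ +%R.
Proof.
by move=> a x y; apply: ds_ext => i; rewrite ds_addE /= !addr0 scale1r scalerDr.
Qed.
Lemma dsZDl x : {morph dsZ^~ x : a b / a + b}.
Proof.
by move=> a b; apply: ds_ext => i; rewrite ds_addE /= !addr0 scalerDl.
Qed.

HB.instance Definition _ :=
  GRing.Zmodule_isLmodule.Build k direct_sum dsZA dsZ1 dsZDr dsZDl.

Lemma ds_scaleE a (x : direct_sum) i : (a *: x) i = a *: x i.
Proof. by rewrite /= addr0. Qed.

Lemma ds_zeroE i : (0 : direct_sum) i = 0.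
Proof. by []. Qed.

Definition ds_fun i (w : W i) (j : int) : W j :=
  if i =P j is ReflectT e then ecast j (W j) e w else 0.

Lemma ds_funii i (w : W i) : ds_fun w i = w.
Proof. by rewrite /ds_fun; case: eqP => // e; rewrite eq_axiomK. Qed.

Lemma ds_fun_neq i (w : W i) j : i != j -> ds_fun w j = 0.
Proof. by rewrite /ds_fun; case: eqP. Qed.

Lemma ds_inj_fin i (w : W i) :
  exists s : seq int, forall j, j \notin s -> ds_fun w j = 0.
Proof.
by exists [:: i] => j; rewrite inE eq_sym => /ds_fun_neq ->.
Qed.

Definition ds_inj i (w : W i) : direct_sum := DirectSum (ds_inj_fin w).

Lemma ds_inj_linear i : linear (@ds_inj i).
Proof.
move=> a x y; apply: ds_ext => j; rewrite ds_addE ds_scaleE /=.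
have [e|ne] := eqVneq i j; first by subst j; rewrite !ds_funii.
by rewrite !ds_fun_neq // scaler0 addr0.
Qed.

HB.instance Definition _ i :=
  GRing.isLinear.Build k (W i) direct_sum *:%R (@ds_inj i) (@ds_inj_linear i).

Definition ds_supp (x : direct_sum) : seq int := undup (projT1 (cid (ds_fin x))).

Definition ds_lift (X : lmodType k) (h : forall i, W i -> X) (x : direct_sum) :
  X := \sum_(i <- ds_supp x) h i (x i).

Section Lift.
Variables (X : lmodType k) (h : forall i, W i -> X).
Hypothesis hP : forall i, linear (@h i).

Lemma ds_comp0 i : @h i 0 = 0.
Proof.
have := @hP i 1 0 0; rewrite scaler0 addr0 scale1r.
by move/eqP; rewrite -subr_eq0 opprD addNKr oppr_eq0 => /eqP.
Qed.

Lemma ds_liftE (x : direct_sum) s : uniq s ->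
  (forall i, i \notin s -> x i = 0) -> ds_lift (@h) x = \sum_(i <- s) @h i (x i).
Proof.
move=> us sP; rewrite /ds_lift.
have ut : uniq (ds_supp x) by exact: undup_uniq.
have tP : forall i, i \notin ds_supp x -> x i = 0.
  by move=> i; rewrite mem_undup; case: cid => /= t; apply.
move: (ds_supp x) ut tP => t ut tP.
have E r r' : uniq r -> uniq r' -> (forall i, i \notin r -> x i = 0) ->
    (forall i, i \notin r' -> x i = 0) ->
    \sum_(i <- r) @h i (x i) = \sum_(i <- r | i \in r') @h i (x i).
  move=> _ _ _ r'P; rewrite [LHS](bigID (mem r')) /= [X in _ + X]big1 ?addr0 //.
  by move=> i /r'P ->; exact: ds_comp0.
rewrite (E t s) // (E s t) // -big_filter -[RHS]big_filter.
apply/perm_big/uniq_perm; rewrite ?filter_uniq // => i.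
by rewrite !mem_filter andbC.
Qed.

Lemma ds_lift_linear : linear (ds_lift (@h)).
Proof.
move=> a x y.
case: (ds_fin x) (ds_fin y) => [s sP] [t tP].
pose r := undup (s ++ t).
have xr i : i \notin r -> x i = 0.
  by rewrite mem_undup mem_cat negb_or => /andP[/sP].
have yr i : i \notin r -> y i = 0.
  by rewrite mem_undup mem_cat negb_or => /andP[_ /tP].
rewrite !(@ds_liftE _ r) ?undup_uniq //.
  rewrite scaler_sumr -big_split; apply: eq_bigr => i _ /=.
  by rewrite [in LHS]scale1r addr0 hP.
by move=> i ir; rewrite ds_addE ds_scaleE xr // yr // scaler0 addr0.
Qed.

Lemma ds_lift_inj i (w : W i) : ds_lift (@h) (ds_inj w) = @h i w.
Proof.
rewrite (@ds_liftE _ [:: i]) // ?big_seq1 /= ?ds_funii // => j.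
by rewrite inE eq_sym => /ds_fun_neq ->.
Qed.

End Lift.

Lemma ds_gen (P : direct_sum -> Prop) :
  P 0 -> (forall i (w : W i), P (ds_inj w)) ->
  (forall x y, P x -> P y -> P (x + y)) -> forall x, P x.
Proof.
move=> P0 P1 PD x; have [s] := ds_fin x.
elim: s x => [|i s IH] x xP.
  by rewrite (_ : x = 0) //; apply: ds_ext => i; rewrite xP.
have -> : x = ds_inj (x i) + (x - ds_inj (x i)) by rewrite addrC subrK.
apply: PD => //; apply: IH => j js.
rewrite ds_addE -scaleN1r ds_scaleE /=.
have [e|ne] := eqVneq i j.
  by subst j; rewrite ds_funii scaleN1r subrr.
by rewrite ds_fun_neq // scaler0 addr0 xP // inE negb_or eq_sym ne.
Qed.

End DirectSum.

Record dgvect (k : fieldType) := DgVect {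
  dg_sp :> int -> lmodType k;
  dg_d : forall n, {linear dg_sp n -> dg_sp (n - 1)};
  dg_dd : forall n (x : dg_sp n), dg_d (n - 1) (dg_d n x) = 0 }.

Arguments dg_d {k} d n.

Record dg_hom (k : fieldType) (U V : dgvect k) := DgHom {
  dg_fun :> forall n, {linear U n -> V n};
  dg_comm : forall n (x : U n), dg_fun (n - 1) (dg_d U n x) = dg_d V n (dg_fun n x) }.

Section DgCategory.
Variable k : fieldType.
Implicit Types U V W : dgvect k.

Lemma linear_ext (A B : lmodType k) (f g : {linear A -> B}) :
  (forall x, f x = g x) -> f = g.
Proof.
move=> e; have {}e : (f : A -> B) = g by exact: functional_extensionality_dep.
case: f g e => [f [[f1] [f2]]] [g [[g1] [g2]]] /= e; case: _ / e in g1 g2 *.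
by rewrite (Prop_irrelevance f1 g1) (Prop_irrelevance f2 g2).
Qed.

Lemma dg_hom_ext U V (f g : dg_hom U V) : (forall n x, f n x = g n x) -> f = g.
Proof.
case: f g => [f fP] [g gP] /= e.
have {}e : f = g.
  by apply: functional_extensionality_dep => n; exact/linear_ext/e.
by case: _ / e in gP *; rewrite (Prop_irrelevance fP gP).
Qed.

Definition dg_id U : dg_hom U U :=
  @DgHom k U U (fun n => idfun) (fun n x => erefl).

Lemma dg_comp_comm U V W (g : dg_hom V W) (f : dg_hom U V) n (x : U n) :
  g (n - 1) (f (n - 1) (dg_d U n x)) = dg_d W n (g n (f n x)).
Proof. by rewrite !dg_comm. Qed.

Definition dg_comp U V W (g : dg_hom V W) (f : dg_hom U V) : dg_hom U W :=
  @DgHom k U W (fun n => g n \o f n) (dg_comp_comm g f).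

Definition dgVect_str : is_category (@dg_hom k) :=
  @IsCategory (dgvect k) (@dg_hom k) dg_id dg_comp
    (fun U V W X h g f => @dg_hom_ext U X (dg_comp h (dg_comp g f))
       (dg_comp (dg_comp h g) f) (fun n x => erefl))
    (fun U V f => @dg_hom_ext U V (dg_comp (dg_id V) f) f (fun n x => erefl))
    (fun U V f => @dg_hom_ext U V (dg_comp f (dg_id U)) f (fun n x => erefl)).

Definition dgVect : category := Category dgVect_str.

Definition dg_unit_sp (n : int) : lmodType k :=
  match n with Posz 0 => k^o | _ => 'rV[k]_0 end.

Lemma dg_unit_dd n (x : dg_unit_sp n) :
  (\0 : dg_unit_sp (n - 1) -> dg_unit_sp (n - 1 - 1))
    ((\0 : dg_unit_sp n -> dg_unit_sp (n - 1)) x) = 0.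
Proof. by []. Qed.

Definition dg_unit : dgvect k := @DgVect k dg_unit_sp (fun n => \0) dg_unit_dd.

Lemma ecast_linear (F : int -> lmodType k) i j (e : i = j) :
  linear (fun x : F i => ecast j (F j) e x).
Proof. by case: _ / e. Qed.

Section DgTensor.
Variables U V : dgvect k.

(* (U \ox V)_n is the direct sum of the U_i \ox V_(n - i). *)
Definition dg_tens_comp (n i : int) : lmodType k :=
  tensor_space (U i) (V (n - i)).

Definition dg_tens_sp (n : int) : lmodType k := direct_sum (dg_tens_comp n).

Lemma dg_pure_deg (i j n : int) : i + j = n -> j = n - i.
Proof. by move<-; rewrite addrC addKr. Qed.

(* u \ox v in degree n, for u of degree i and v of degree j with i + j = n *)
Definition dg_pure (i j n : int) (e : i + j = n) (u : U i) (v : V j) :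
    dg_tens_sp n :=
  @ds_inj k (dg_tens_comp n) i
    (tpure u (ecast j (V j) (dg_pure_deg e) v)).

Lemma dg_degl (i j n : int) : i + j = n -> (i - 1) + j = n - 1.
Proof. by move<-; rewrite addrAC. Qed.

Lemma dg_degr (i j n : int) : i + j = n -> i + (j - 1) = n - 1.
Proof. by move<-; rewrite addrA. Qed.

Lemma dg_deg_sub (n i : int) : i + (n - i) = n.
Proof. by rewrite addrC subrK. Qed.

Definition dg_tens_d_pure (i j n : int) (e : i + j = n) (u : U i) (v : V j) :
    dg_tens_sp (n - 1) :=
  dg_pure (dg_degl e) (dg_d U i u) v
  + (-1 : k) ^ i *: dg_pure (dg_degr e) u (dg_d V j v).

Definition dg_tens_dfun (n : int) : dg_tens_sp n -> dg_tens_sp (n - 1) :=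
  @ds_lift k (dg_tens_comp n) _
    (fun i => tlift (dg_tens_d_pure (dg_deg_sub n i))).

Lemma dg_pure_bilinear (i j n : int) (e : i + j = n) : is_bilinear (dg_pure e).
Proof.
split=> [v a u u' | u a v v']; rewrite /dg_pure.
- by rewrite (tpure_bilinear _ _).1 ds_inj_linear.
- by rewrite ecast_linear (tpure_bilinear _ _).2 ds_inj_linear.
Qed.

Lemma dg_tens_d_bilinear (i j n : int) (e : i + j = n) :
  is_bilinear (dg_tens_d_pure e).
Proof.
rewrite /dg_tens_d_pure; split=> [v a u u' | u a v v'] /=.
- rewrite linearP !(dg_pure_bilinear _).1 !scalerDr !scalerA.
  by rewrite (mulrC a) addrACA.
- rewrite linearP !(dg_pure_bilinear _).2 !scalerDr !scalerA.
  by rewrite (mulrC a) addrACA.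
Qed.

Lemma dg_pure0l (i j n : int) (e : i + j = n) v : dg_pure e 0 v = 0.
Proof.
have := (dg_pure_bilinear e).1 v (-1) 0 0.
by rewrite /= scaler0 addr0 scaleN1r addNr.
Qed.

Lemma dg_pure0r (i j n : int) (e : i + j = n) u : dg_pure e u 0 = 0.
Proof.
have := (dg_pure_bilinear e).2 u (-1) 0 0.
by rewrite /= scaler0 addr0 scaleN1r addNr.
Qed.

Lemma dg_tens_d_linear n : linear (@dg_tens_dfun n).
Proof.
by apply: ds_lift_linear => i; exact/tlift_linear/dg_tens_d_bilinear.
Qed.

HB.instance Definition _ n :=
  GRing.isLinear.Build k (dg_tens_sp n) (dg_tens_sp (n - 1)) *:%R
    (@dg_tens_dfun n) (@dg_tens_d_linear n).

Definition dg_tens_d n : {linear dg_tens_sp n -> dg_tens_sp (n - 1)} :=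
  @dg_tens_dfun n.

Lemma dg_tens_dE (i j n : int) (e : i + j = n) u v :
  dg_tens_d n (dg_pure e u v) = dg_tens_d_pure e u v.
Proof.
have lin l : linear (tlift (dg_tens_d_pure (dg_deg_sub n l))).
  exact/tlift_linear/dg_tens_d_bilinear.
rewrite /= /dg_tens_dfun /dg_pure (ds_lift_inj lin).
rewrite tlift_pure; last exact: dg_tens_d_bilinear.
have [e' E] : exists e', dg_pure_deg e = e' by exists (dg_pure_deg e).
rewrite E; move: (dg_deg_sub n i); case: _ / e' {E} => e2.
by rewrite (eq_irrelevance e2 e).
Qed.

Lemma dg_tens_gen n (P : dg_tens_sp n -> Prop) :
  P 0 -> (forall i j (e : i + j = n) u v, P (dg_pure e u v)) ->
  (forall x y, P x -> P y -> P (x + y)) -> forall x, P x.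
Proof.
move=> P0 P1 PD; apply: ds_gen => // i.
apply: tensor_gen => [|u v|x y Px Py].
- by rewrite linear0.
- have := P1 i (n - i) (dg_deg_sub n i) u v; rewrite /dg_pure.
  by rewrite eq_axiomK.
- by rewrite linearD; exact: PD.
Qed.

Lemma dg_tens_dd n (x : dg_tens_sp n) :
  dg_tens_d (n - 1) (dg_tens_d n x) = 0.
Proof.
elim/dg_tens_gen: x => [|i j e u v|x y Px Py].
- by rewrite !linear0.
- rewrite dg_tens_dE linearD linearZ !dg_tens_dE /dg_tens_d_pure !dg_dd.
  rewrite dg_pure0r dg_pure0l add0r scaler0 addr0.
  rewrite (eq_irrelevance (dg_degr (dg_degl e)) (dg_degl (dg_degr e))).
  rewrite -scalerDl expfzDr ?oppr_eq0 ?oner_neq0 //.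
  by rewrite -exprz_inv invrN1 expr1z mulrN1 addNr scale0r.
- by rewrite !linearD Px Py addr0.
Qed.

Definition dg_tens : dgvect k := DgVect dg_tens_dd.

End DgTensor.
End DgCategory.

Definition dg_ap (k : fieldType) (U V : dgvect k) (f : @mor (dgVect k) U V)
  (n : int) : U n -> V n := dg_fun f n.

(* The monoidal structure maps and the symmetry on elements u \ox v; as these
   span, the conditions determine all the maps. *)
Record dg_koszul (k : fieldType)
    (S : is_monoidal (C := dgVect k) (@dg_tens k) (dg_unit k))
    (c : is_braided (Monoidal S)) : Prop := {
  dg_tensE : forall (U U' V V' : dgVect k) (f : mor U U') (g : mor V V')
      (i j n : int) (e : i + j = n) (u : U i) (v : V j),
    dg_ap (mon_tens S f g) (dg_pure e u v) = dg_pure e (dg_ap f u) (dg_ap g v);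
  dg_assocE : forall (U V W : dgVect k) (i j l m p n : int)
      (eij : i + j = m) (eml : m + l = n) (ejl : j + l = p) (eip : i + p = n)
      (u : U i) (v : V j) (w : W l),
    dg_ap (mon_assoc S U V W) (dg_pure eml (dg_pure eij u v : dg_tens U V m) w)
      = dg_pure eip u (dg_pure ejl v w : dg_tens V W p);
  dg_lunitE : forall (V : dgVect k) (n : int) (e : 0 + n = n)
      (a : dg_unit k 0) (v : V n),
    dg_ap (mon_lunit S V) (dg_pure e a v) = (a : k) *: v;
  dg_runitE : forall (V : dgVect k) (n : int) (e : n + 0 = n)
      (a : dg_unit k 0) (v : V n),
    dg_ap (mon_runit S V) (dg_pure e v a) = (a : k) *: v;
  dg_braidE : forall (U V : dgVect k) (i j n : int)
      (e : i + j = n) (e' : j + i = n) (u : U i) (v : V j),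
    dg_ap (braid c U V) (dg_pure e u v) = (-1 : k) ^ (i * j) *: dg_pure e' v u }.

(* Main.v *)
From HB Require Import structures.
Require Import Defs.
From mathcomp Require Import all_boot all_algebra.
From mathcomp Require Import boolp.
From mathcomp Require classical_sets.
From mathcomp Require Import ring.

(** Over a field everything rests on one fact: a linear functional on a subspace
    extends to the whole space (linear_extension, by Zorn's lemma), so that
    functionals separate vectors from subspaces (separation).

    In dgVect, limits and colimits are computed degree by degree. Testing a map
    against the inclusion of its kernel and the projection to its cokernel shows
    that monomorphisms are injective and epimorphisms surjective (mono_inj,
    epi_surj); bijective maps are invertible, hence all monomorphisms and
    epimorphisms are extremal, and image factorizations exist.

    A map out of a tensor product is a degreewise bilinear map obeying the
    Leibniz rule (bimap_hom), and two such maps are compared on pure tensors;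
    the coherence laws thus become computations with signs. The internal hom
    makes the structure closed, so N (x) - preserves all colimits. For limits, a
    tensor x in N (x) A is a combination of its slices (phi (x) id) x, where phi
    runs over the functionals on N (slice_elim). Since slices commute with maps
    in the variable A, membership in a kernel, an equalizer, a preimage or an
    arbitrary intersection can be tested on slices, which lie in A.

    The dual supplied by any closed structure pairs perfectly with the original
    complex (pair_inj, pair_repr), because it is isomorphic to the dual built
    from the internal hom. The dual of an injective map is surjective because
    functionals extend; alpha, theta and the transpose of theta are injective
    because functionals separate.

    The free monoid on V consists of formal expressions modulo equality in all
    monoids (free_universal). Dually, a monoid A has a finite dual, the largest
    subcomplex of its dual that the transpose of the multiplication sends into
    its own tensor square, a notion that makes sense as theta is injective
    (largest_comonoid, largest_universal); it exists since sums of such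
    subcomplexes are again such. By the Yoneda lemma every finite dual is this
    one up to isomorphism, and then kappa is the inclusion (kappa_mono). The
    same construction inside the dual of the free monoid on the dual of V,
    restricted to the functionals whose restriction to the dual of V comes from
    V, is the cofree comonoid on V (cofree_universal). *)

Set Implicit Arguments.
Unset Strict Implicit.
Unset Printing Implicit Defensive.

Import GRing.Theory.
Local Open Scope ring_scope.

(** * Linear algebra: extension of linear maps and separation *)
Section LinearExtension.
Variables (k : fieldType) (V W : lmodType k).

Lemma linear_fun_exists (f : V -> W) : linear f ->
  exists h : {linear V -> W}, forall v, h v = f v.
Proof.
move=> fP; pose m := GRing.isLinear.Build k V W *:%R f fP.
by exists (HB.pack f m : {linear V -> W}).
Qed.

(** Graphs of partial linear maps; maps are extended one vector at a time in
    this form. *)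
Definition linrel (G : V * W -> Prop) :=
  (forall a x y, G x -> G y -> G (a *: x.1 + y.1, a *: x.2 + y.2)) /\
  (forall w, G (0, w) -> w = 0).

Import classical_sets.

(** By Zorn's lemma there is a maximal partial linear map containing G; it is
    total because the value at a vector outside the domain can be chosen to
    be 0. *)
Lemma linear_extension (G : V * W -> Prop) : G (0, 0) -> linrel G ->
  exists h : {linear V -> W}, forall v w, G (v, w) -> h v = w.
Proof.
move=> G0 GP.
(* The empty set is admitted because the union of the empty chain is empty. *)
pose P (A : set (V * W)) := linrel A /\ ((exists p, A p) -> forall p, G p -> A p).
have [A [[[Alin A0] AG] Amax]] : exists A, P A /\ forall B, proper A B -> ~ P B.
  apply: Zorn_bigcup => F FP tot.
  split; last first.
    move=> [p [X FX Xp]] q Gq; exists X => //.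
    by apply: (FP _ FX).2 => //; exists p.
  split; last by move=> w [X FX]; exact: (FP _ FX).1.2.
  move=> a x y [X FX Xx] [Y FY Yy].
  have [XY|YX] := tot _ _ FX FY.
  - by exists Y => //; apply: (FP _ FY).1.1 => //; exact: XY.
  - by exists X => //; apply: (FP _ FX).1.1 => //; exact: YX.
have {}AG p : G p -> A p.
  apply: AG; apply: contrapT => A_empty; apply: (Amax G); last by split.
  split; first by move=> p' Ap; case: A_empty; exists p'.
  by move=> /(_ _ G0) A00; apply: A_empty; exists (0, 0).
have A00 := AG _ G0.
have Afun v w w' : A (v, w) -> A (v, w') -> w = w'.
  move=> Aw Aw'; apply/eqP; rewrite -subr_eq0; apply/eqP/A0.
  have := Alin (-1) _ _ Aw' Aw.
  by rewrite /= !scaleN1r addNr addrC.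
have Atot v : exists w, A (v, w).
  apply: contrapT => nv.
  (* the extension of A by the value 0 at v *)
pose B : set (V * W) := fun p => exists c x, A (x, p.2) /\ p.1 = x + c *: v.
  apply: (Amax B).
    split=> [[x w] Ax|BA]; first by exists 0, x; rewrite scale0r addr0.
    by apply: nv; exists 0; apply: BA; exists 1, 0; rewrite scale1r add0r.
  split; last first.
    by move=> _ [x w] /AG Ax; exists 0, x; rewrite scale0r addr0.
  split=> [a [x' w] [y' z] [c [x [/= Ax ->]]] [d [y [/= Ay ->]]]|w [c [x [Ax /= e]]]].
    exists (a * c + d), (a *: x + y); split; first exact: (Alin a _ _ Ax Ay).
    by rewrite /= scalerDr scalerDl scalerA addrACA.
  have [c0|c0] := eqVneq c 0.
    by apply: A0; move: e; rewrite c0 scale0r addr0 => ->.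
  case: nv; exists (- c^-1 *: w).
  have := Alin (- c^-1) _ _ Ax A00; rewrite /= !addr0.
  suff -> : - c^-1 *: x = v by [].
  move/esym/eqP: e; rewrite addr_eq0 => /eqP ->.
  by rewrite scalerN scaleNr opprK scalerA mulVf // scale1r.
pose f v := projT1 (cid (Atot v)).
have fA v : A (v, f v) by rewrite /f; case: cid.
have fP : linear f.
  by move=> a x y; apply: (Afun _ _ _ (fA _)); exact: (Alin a _ _ (fA x) (fA y)).
have [h hE] := linear_fun_exists fP.
by exists h => v w /AG Aw; rewrite hE; exact: Afun (fA v) Aw.
Qed.

End LinearExtension.

Section Separation.
Variable k : fieldType.

Definition subclosed (V : lmodType k) (S : V -> Prop) :=
  S 0 /\ forall a x y, S x -> S y -> S (a *: x + y).

Lemma extend_along_inj (U V W : lmodType k) (i : {linear U -> V})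
    (f : {linear U -> W}) : injective i ->
  exists h : {linear V -> W}, forall u, h (i u) = f u.
Proof.
move=> ii; pose G (p : V * W) := exists u, p = (i u, f u).
have [||h hP] := @linear_extension k V W G.
- by exists 0; rewrite !linear0.
- split=> [a [? ?] [? ?] [x [-> ->]] [y [-> ->]]|w [u []]].
    by exists (a *: x + y); rewrite !linearP.
  by rewrite -[0](linear0 i) => /ii <- ->; rewrite linear0.
- by exists h => u; apply: hP; exists u.
Qed.

(** The functional extends the partial map y + c x |-> c, for y in S. *)
Lemma separation (V : lmodType k) (S : V -> Prop) (x : V) :
  subclosed S -> ~ S x ->
  exists f : {linear V -> k^o}, (forall y, S y -> f y = 0) /\ f x = 1.
Proof.
move=> [S0 SP] nx.
pose G (p : V * k^o) := exists y, S y /\ p.1 = y + p.2 *: x.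
have [||h hP] := @linear_extension k V k^o G.
- by exists 0; rewrite scale0r addr0.
- split=> [a [? c] [? d] [y [/= Sy ->]] [z [/= Sz ->]]|c [y [Sy]]] /=.
    exists (a *: y + z); split; first exact: SP.
    by rewrite scalerDr scalerDl scalerA addrACA.
  move/esym/eqP; rewrite addr_eq0 => /eqP e; apply: contrapT => /eqP c0.
  apply: nx; have := SP (- c^-1) _ _ Sy S0.
  by rewrite addr0 e scalerN scaleNr opprK scalerA mulVf // scale1r.
- exists h; split=> [y Sy|]; first by apply: hP; exists y; rewrite scale0r addr0.
  by apply: hP; exists 0; rewrite scale1r add0r.
Qed.

Lemma separation0 (V : lmodType k) (x : V) :
  (forall f : {linear V -> k^o}, f x = 0) -> x = 0.
Proof.
move=> fx; apply: contrapT => nx.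
have [|f [_]] := @separation V (fun y => y = 0) x _ nx.
  by split=> // a _ _ -> ->; rewrite scaler0 addr0.
by rewrite fx => /esym/eqP; rewrite oner_eq0.
Qed.

End Separation.

(** * Subspaces, products and quotients of formal expressions *)
Section Subspace.
Variables (k : fieldType) (V : lmodType k) (S : V -> Prop).

Record subspace (SP : subclosed S) := Subspace {
  sub_val :> V;
  sub_prop : S sub_val }.
Arguments sub_val {SP} _.
Arguments sub_prop {SP} _.

Variable SP : subclosed S.
Local Notation T := (subspace SP).

HB.instance Definition _ := gen_eqMixin T.
HB.instance Definition _ := gen_choiceMixin T.

Lemma sub_ext (x y : T) : sub_val x = sub_val y -> x = y.
Proof.
case: x y => [x Sx] [y Sy] /= e; case: _ / e in Sy *.
by rewrite (Prop_irrelevance Sx Sy).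
Qed.

Definition sub_zero : T := Subspace SP SP.1.
Definition sub_comb a (x y : T) : T :=
  Subspace SP (SP.2 a _ _ (sub_prop x) (sub_prop y)).
Definition sub_add x y := sub_comb 1 x y.
Definition sub_scale a x := sub_comb a x sub_zero.
Definition sub_opp x := sub_scale (-1) x.

Lemma sub_addA : associative sub_add.
Proof. by move=> x y z; apply: sub_ext; rewrite /= !scale1r addrA. Qed.
Lemma sub_addC : commutative sub_add.
Proof. by move=> x y; apply: sub_ext; rewrite /= !scale1r addrC. Qed.
Lemma sub_add0 : left_id sub_zero sub_add.
Proof. by move=> x; apply: sub_ext; rewrite /= scale1r add0r. Qed.
Lemma sub_addN : left_inverse sub_zero sub_opp sub_add.
Proof. by move=> x; apply: sub_ext; rewrite /= scale1r addr0 scaleN1r addNr. Qed.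

HB.instance Definition _ :=
  GRing.isZmodule.Build T sub_addA sub_addC sub_add0 sub_addN.

Lemma sub_addE (x y : T) : sub_val (x + y) = sub_val x + sub_val y.
Proof. by rewrite /= scale1r. Qed.

Lemma sub_scaleA a b x : sub_scale a (sub_scale b x) = sub_scale (a * b) x.
Proof. by apply: sub_ext; rewrite /= !addr0 scalerA. Qed.
Lemma sub_scale1 : left_id 1 sub_scale.
Proof. by move=> x; apply: sub_ext; rewrite /= addr0 scale1r. Qed.
Lemma sub_scaleDr : right_distributive sub_scale +%R.
Proof.
by move=> a x y; apply: sub_ext; rewrite sub_addE /= !addr0 scale1r scalerDr.
Qed.
Lemma sub_scaleDl x : {morph sub_scale^~ x : a b / a + b}.
Proof.
by move=> a b; apply: sub_ext; rewrite sub_addE /= !addr0 scalerDl.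
Qed.

HB.instance Definition _ := GRing.Zmodule_isLmodule.Build k T
  sub_scaleA sub_scale1 sub_scaleDr sub_scaleDl.

Lemma sub_val_linear : linear (sub_val : T -> V).
Proof. by move=> a x y; rewrite sub_addE /= addr0. Qed.

HB.instance Definition _ :=
  GRing.isLinear.Build k T V *:%R (sub_val : T -> V) sub_val_linear.

Section Corestrict.
Variables (W : lmodType k) (f : {linear W -> V}) (fS : forall w, S (f w)).

Definition sub_lift (w : W) : T := Subspace SP (fS w).

Lemma sub_lift_linear : linear sub_lift.
Proof. by move=> a x y; apply: sub_ext; rewrite sub_val_linear /= linearP. Qed.

HB.instance Definition _ :=
  GRing.isLinear.Build k W T *:%R sub_lift sub_lift_linear.

End Corestrict.
End Subspace.

Section DependentProduct.
Variables (k : fieldType) (I : small) (V : I -> lmodType k).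

Record pi_space := PiSpace { pi_val :> forall i, V i }.

HB.instance Definition _ := gen_eqMixin pi_space.
HB.instance Definition _ := gen_choiceMixin pi_space.

Lemma pi_ext (x y : pi_space) : (forall i, x i = y i) -> x = y.
Proof.
case: x y => [x] [y] /= e; congr PiSpace; exact: functional_extensionality_dep.
Qed.

Definition pi_add (x y : pi_space) := PiSpace (fun i => x i + y i).
Definition pi_scale a (x : pi_space) := PiSpace (fun i => a *: x i).

Lemma pi_addA : associative pi_add.
Proof. by move=> x y z; apply: pi_ext => i; exact: addrA. Qed.
Lemma pi_addC : commutative pi_add.
Proof. by move=> x y; apply: pi_ext => i; exact: addrC. Qed.
Lemma pi_add0 : left_id (PiSpace (fun i => 0)) pi_add.
Proof. by move=> x; apply: pi_ext => i; exact: add0r. Qed.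
Lemma pi_addN : left_inverse (PiSpace (fun i => 0)) (pi_scale (-1)) pi_add.
Proof. by move=> x; apply: pi_ext => i; rewrite /= scaleN1r addNr. Qed.

HB.instance Definition _ :=
  GRing.isZmodule.Build pi_space pi_addA pi_addC pi_add0 pi_addN.

Lemma pi_scaleA a b x : pi_scale a (pi_scale b x) = pi_scale (a * b) x.
Proof. by apply: pi_ext => i; exact: scalerA. Qed.
Lemma pi_scale1 : left_id 1 pi_scale.
Proof. by move=> x; apply: pi_ext => i; exact: scale1r. Qed.
Lemma pi_scaleDr : right_distributive pi_scale +%R.
Proof. by move=> a x y; apply: pi_ext => i; exact: scalerDr. Qed.
Lemma pi_scaleDl x : {morph pi_scale^~ x : a b / a + b}.
Proof. by move=> a b; apply: pi_ext => i; exact: scalerDl. Qed.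

HB.instance Definition _ := GRing.Zmodule_isLmodule.Build k pi_space
  pi_scaleA pi_scale1 pi_scaleDr pi_scaleDl.

End DependentProduct.

(** A set of formal expressions together with a class of evaluations of them in
    vector spaces. Two expressions are identified when all evaluations agree;
    the identities of vector spaces then hold in the quotient because they hold
    after every evaluation. The class of models may be large: the quotient is as
    small as the set of expressions. Colimits, free algebras and quotients by
    subspaces are all obtained in this way. *)
Record interpretations (k : fieldType) (X : small) := Interpretations {
  itp_zero : X;
  itp_add : X -> X -> X;
  itp_scale : k -> X -> X;
  itp_model : Type;
  itp_space : itp_model -> lmodType k;
  itp_eval : forall m, X -> itp_space m;
  itp_eval0 : forall m, itp_eval m itp_zero = 0;
  itp_evalD : forall m x y,
    itp_eval m (itp_add x y) = itp_eval m x + itp_eval m y;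
  itp_evalZ : forall m a x, itp_eval m (itp_scale a x) = a *: itp_eval m x }.

Arguments itp_eval {k X} _ m x.
Arguments itp_space {k X} _ m.

Section ModelQuotient.
Local Open Scope quotient_scope.
Variables (k : fieldType) (X : small) (P : interpretations k X).

Definition itp_eq (x y : {classic X}) : bool :=
  `[< forall m, itp_eval P m x = itp_eval P m y >].

Lemma itp_eq_equiv : equiv_class_of itp_eq.
Proof.
split.
- by move=> x; apply/asboolP.
- by move=> x y; apply/asboolP/asboolP => e m; rewrite e.
- by move=> y x z /asboolP e1 /asboolP e2; apply/asboolP => m; rewrite e1 e2.
Qed.

Canonical itp_eq_equiv_rel := EquivRelPack itp_eq_equiv.

Definition model_quotient : Type := {eq_quot itp_eq}.
HB.instance Definition _ := Choice.on model_quotient.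
HB.instance Definition _ := EqQuotient.on model_quotient.

Definition mq_cls (x : X) : model_quotient := \pi_(model_quotient) (x : {classic X}).
Definition mq_rep (x : model_quotient) : X := repr x.

Lemma mq_repK x : mq_cls (mq_rep x) = x.
Proof. exact: reprK. Qed.

Lemma mq_clsP x y :
  mq_cls x = mq_cls y <-> forall m, itp_eval P m x = itp_eval P m y.
Proof.
split; first by move/eqquotP/asboolP.
by move=> e; apply/eqquotP/asboolP.
Qed.

Lemma mq_eval_rep m x : itp_eval P m (mq_rep (mq_cls x)) = itp_eval P m x.
Proof. by move: m; apply/mq_clsP; rewrite mq_repK. Qed.

Lemma mq_ext x y :
  (forall m, itp_eval P m (mq_rep x) = itp_eval P m (mq_rep y)) -> x = y.
Proof. by move/mq_clsP; rewrite !mq_repK. Qed.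

Definition mq_zero := mq_cls (itp_zero P).
Definition mq_add x y := mq_cls (itp_add P (mq_rep x) (mq_rep y)).
Definition mq_scale a x := mq_cls (itp_scale P a (mq_rep x)).
Definition mq_opp := mq_scale (-1).

Lemma mq_eval0 m : itp_eval P m (mq_rep mq_zero) = 0.
Proof. by rewrite mq_eval_rep itp_eval0. Qed.
Lemma mq_evalD m x y : itp_eval P m (mq_rep (mq_add x y))
  = itp_eval P m (mq_rep x) + itp_eval P m (mq_rep y).
Proof. by rewrite mq_eval_rep itp_evalD. Qed.
Lemma mq_evalZ m a x :
  itp_eval P m (mq_rep (mq_scale a x)) = a *: itp_eval P m (mq_rep x).
Proof. by rewrite mq_eval_rep itp_evalZ. Qed.

Let simp := (mq_evalD, mq_evalZ, mq_eval0).

Lemma mq_addA : associative mq_add.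
Proof. by move=> x y z; apply: mq_ext => m; rewrite !simp addrA. Qed.
Lemma mq_addC : commutative mq_add.
Proof. by move=> x y; apply: mq_ext => m; rewrite !simp addrC. Qed.
Lemma mq_add0 : left_id mq_zero mq_add.
Proof. by move=> x; apply: mq_ext => m; rewrite !simp add0r. Qed.
Lemma mq_addN : left_inverse mq_zero mq_opp mq_add.
Proof. by move=> x; apply: mq_ext => m; rewrite !simp scaleN1r addNr. Qed.

HB.instance Definition _ :=
  GRing.isZmodule.Build model_quotient mq_addA mq_addC mq_add0 mq_addN.

Lemma mq_scaleA a b x : mq_scale a (mq_scale b x) = mq_scale (a * b) x.
Proof. by apply: mq_ext => m; rewrite !simp scalerA. Qed.
Lemma mq_scale1 : left_id 1 mq_scale.
Proof. by move=> x; apply: mq_ext => m; rewrite !simp scale1r. Qed.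
Lemma mq_scaleDr : right_distributive mq_scale +%R.
Proof. by move=> a x y; apply: mq_ext => m; rewrite !simp scalerDr. Qed.
Lemma mq_scaleDl x : {morph mq_scale^~ x : a b / a + b}.
Proof. by move=> a b; apply: mq_ext => m; rewrite !simp scalerDl. Qed.

HB.instance Definition _ := GRing.Zmodule_isLmodule.Build k model_quotient
  mq_scaleA mq_scale1 mq_scaleDr mq_scaleDl.

Lemma mq_clsD x y : mq_cls (itp_add P x y) = mq_cls x + mq_cls y.
Proof. by apply: mq_ext => m; rewrite mq_evalD !mq_eval_rep itp_evalD. Qed.
Lemma mq_clsZ a x : mq_cls (itp_scale P a x) = a *: mq_cls x.
Proof. by apply: mq_ext => m; rewrite mq_evalZ !mq_eval_rep itp_evalZ. Qed.

Definition mq_eval m (x : model_quotient) := itp_eval P m (mq_rep x).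

Lemma mq_eval_linear m : linear (mq_eval m).
Proof. by move=> a x y; rewrite /mq_eval mq_evalD mq_evalZ. Qed.

HB.instance Definition _ m := GRing.isLinear.Build k model_quotient
  (itp_space P m) *:%R (mq_eval m) (mq_eval_linear m).

Lemma mq_eval_cls m x : mq_eval m (mq_cls x) = itp_eval P m x.
Proof. exact: mq_eval_rep. Qed.

Lemma mq_surj x : exists y, x = mq_cls y.
Proof. by exists (mq_rep x); rewrite mq_repK. Qed.

End ModelQuotient.

Section ModelQuotientMap.
Variables (k : fieldType) (X Y : small).
Variables (P : interpretations k X) (Q : interpretations k Y).
Variables (f : X -> Y).
Hypothesis fP : forall x y, (forall m, itp_eval P m x = itp_eval P m y) ->
  forall m, itp_eval Q m (f x) = itp_eval Q m (f y).
Hypothesis fD : forall x y m,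
  itp_eval Q m (f (itp_add P x y)) = itp_eval Q m (f x) + itp_eval Q m (f y).
Hypothesis fZ : forall a x m,
  itp_eval Q m (f (itp_scale P a x)) = a *: itp_eval Q m (f x).

Definition mq_map (x : model_quotient P) : model_quotient Q := mq_cls Q (f (mq_rep x)).

Lemma mq_map_cls x : mq_map (mq_cls P x) = mq_cls Q (f x).
Proof. by apply/mq_clsP; apply: fP; apply/mq_clsP; rewrite mq_repK. Qed.

Lemma mq_map_linear : linear mq_map.
Proof.
move=> a x y; case: (mq_surj x) (mq_surj y) => [x' ->] [y' ->].
rewrite -mq_clsZ -mq_clsD !mq_map_cls -mq_clsZ -mq_clsD.
by apply/mq_clsP => m; rewrite fD fZ !(itp_evalD, itp_evalZ).
Qed.

HB.instance Definition _ := GRing.isLinear.Build k (model_quotient P)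
  (model_quotient Q) *:%R mq_map mq_map_linear.

End ModelQuotientMap.

(** * Slices of tensors along linear functionals *)
Section UnbundledLinear.
Variables (k : fieldType) (U V : lmodType k) (f : U -> V) (fP : linear f).

Lemma lin0 : f 0 = 0.
Proof. by have [g gE] := linear_fun_exists fP; rewrite -gE linear0. Qed.
Lemma linD x y : f (x + y) = f x + f y.
Proof. by have [g gE] := linear_fun_exists fP; rewrite -!gE linearD. Qed.
Lemma linZ a x : f (a *: x) = a *: f x.
Proof. by have [g gE] := linear_fun_exists fP; rewrite -!gE linearZ. Qed.
Lemma linB x y : f (x - y) = f x - f y.
Proof. by have [g gE] := linear_fun_exists fP; rewrite -!gE linearB. Qed.
Lemma lin_sum I (r : seq I) (F : I -> U) :
  f (\sum_(i <- r) F i) = \sum_(i <- r) f (F i).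
Proof.
have [g gE] := linear_fun_exists fP; rewrite -gE linear_sum.
by apply: eq_bigr => i _.
Qed.

End UnbundledLinear.

Section TensorSlices.
Variable k : fieldType.
Implicit Types N A : lmodType k.

Lemma bilin_intro (U V W : lmodType k) (b : U -> V -> W) :
  (forall a u u' v, b (a *: u + u') v = a *: b u v + b u' v) ->
  (forall a u v v', b u (a *: v + v') = a *: b u v + b u v') ->
  is_bilinear b.
Proof. by move=> bl br; split=> [v a u u'|u a v v'] /=; [exact: bl|exact: br]. Qed.

(** The endomorphism of finite rank given by a sum of tensors f (x) v. *)
Definition finrank_map N (s : seq ({linear N -> k^o} * N)) (u : N) : N :=
  \sum_(p <- s) p.1 u *: p.2.

Lemma finrank_map_linear N s : linear (@finrank_map N s).
Proof.
move=> a x y; rewrite /finrank_map scaler_sumr -big_split; apply: eq_bigr => p _ /=.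
by rewrite linearP scalerDl scalerA.
Qed.

(** The vectors fixed by an endomorphism form a subspace. If u is not among them,
    a functional f vanishing on that subspace and equal to 1 at u allows one to
    correct the value at u without moving the vectors already fixed. *)
Lemma finite_projection N (us : seq N) :
  exists s, forall u, u \in us -> u = @finrank_map N s u.
Proof.
elim: us => [|u us [s sP]]; first by exists [::].
have [us_fix|u_move] := pselect (u = finrank_map s u).
  by exists s => v; rewrite inE => /orP[/eqP ->|/sP].
have [|f [f0 f1]] := @separation k N (fun v => v = finrank_map s v) u _ u_move.
  split=> [|a x y xP yP]; last by rewrite finrank_map_linear -xP -yP.
  by rewrite /finrank_map big1 // => p _; rewrite linear0 scale0r.
exists ((f, u - finrank_map s u) :: s) => v; rewrite /finrank_map big_cons -/(finrank_map s v) /= inE.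
case/orP => [/eqP ->|/sP vP]; first by rewrite f1 scale1r subrK.
by rewrite f0 // scale0r add0r.
Qed.

Definition tslice N A (f : {linear N -> k^o}) : tensor_space N A -> A :=
  tlift (fun u a => f u *: a).

Lemma tslice_bilinear N A (f : {linear N -> k^o}) :
  is_bilinear (fun u (a : A) => f u *: a).
Proof.
apply: bilin_intro => [a u u' v|a u v v'].
- by rewrite linearP scalerDl scalerA.
- by rewrite scalerDr !scalerA mulrC.
Qed.

Lemma tslice_linear N A (f : {linear N -> k^o}) : linear (@tslice N A f).
Proof. exact/tlift_linear/tslice_bilinear. Qed.

Lemma tslice_pure N A (f : {linear N -> k^o}) u (a : A) :
  tslice f (tpure u a) = f u *: a.
Proof. exact/tlift_pure/tslice_bilinear. Qed.

(** Every tensor is a combination of its own slices: apply an endomorphism of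
    finite rank that fixes the finitely many left factors of x. This replaces
    the choice of a basis of N. *)
Lemma tensor_slice_expansion N A (x : tensor_space N A) :
  exists s : seq ({linear N -> k^o} * N), x = \sum_(p <- s) tpure p.2 (tslice p.1 x).
Proof.
have [t xE] : exists t : seq (N * A), x = \sum_(q <- t) tpure q.1 q.2.
  elim/tensor_gen: x => [|u v|x y [s ->] [t ->]].
  - by exists [::]; rewrite big_nil.
  - by exists [:: (u, v)]; rewrite big_seq1.
  - by exists (s ++ t); rewrite big_cat.
have [s sP] := finite_projection [seq q.1 | q <- t].
exists s.
have tslice_sum p : tslice p x = \sum_(q <- t) p q.1 *: q.2.
  rewrite xE (lin_sum (tslice_linear p)).
  by apply: eq_bigr => q _; rewrite tslice_pure.
have tP := @tpure_bilinear k N A.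
under eq_bigr => p _ do rewrite tslice_sum (lin_sum (tP.2 p.2)).
rewrite exchange_big /= [LHS]xE; apply: eq_big_seq => q qt.
rewrite {1}(sP q.1) ?map_f // /finrank_map (lin_sum (tP.1 q.2)).
by apply: eq_bigr => p _; rewrite /= (bilinearZl tP) (bilinearZr tP).
Qed.

End TensorSlices.

(** * Maps of complexes and signs *)
Definition mk_lin (k : fieldType) (U V : lmodType k) (f : U -> V)
    (fP : linear f) : {linear U -> V} :=
  HB.pack f (GRing.isLinear.Build k U V *:%R f fP).

Section DgBasics.
Variable k : fieldType.
Implicit Types U V W : dgvect k.

Definition mk_dg U V (f : forall n, U n -> V n) (fP : forall n, linear (f n))
    (fd : forall n x, f (n - 1) (dg_d U n x) = dg_d V n (f n x)) :
  @mor (dgVect k) U V := @DgHom k U V (fun n => mk_lin (fP n)) fd.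

Lemma mor_ext U V (f g : @mor (dgVect k) U V) :
  (forall n (x : U n), dg_ap f x = dg_ap g x) -> f = g.
Proof. exact: dg_hom_ext. Qed.

Lemma dg_ap_lin U V (f : @mor (dgVect k) U V) n : linear (@dg_ap k U V f n).
Proof. exact: linearP. Qed.

Lemma dg_apP U V (f : @mor (dgVect k) U V) n a (x y : U n) :
  dg_ap f (a *: x + y) = a *: dg_ap f x + dg_ap f y.
Proof. exact: linearP. Qed.

Lemma dg_ap0 U V (f : @mor (dgVect k) U V) n : dg_ap f (0 : U n) = 0.
Proof. exact: linear0. Qed.

Lemma dg_apD U V (f : @mor (dgVect k) U V) n (x y : U n) :
  dg_ap f (x + y) = dg_ap f x + dg_ap f y.
Proof. exact: linearD. Qed.

Lemma dg_apB U V (f : @mor (dgVect k) U V) n (x y : U n) :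
  dg_ap f (x - y) = dg_ap f x - dg_ap f y.
Proof. exact: linearB. Qed.

Lemma dg_apZ U V (f : @mor (dgVect k) U V) n a (x : U n) :
  dg_ap f (a *: x) = a *: dg_ap f x.
Proof. exact: linearZ. Qed.

Lemma dg_ap_d U V (f : @mor (dgVect k) U V) n (x : U n) :
  dg_ap f (dg_d U n x) = dg_d V n (dg_ap f x).
Proof. exact: dg_comm. Qed.

Lemma dg_ap_comp U V W (g : @mor (dgVect k) V W) (f : @mor (dgVect k) U V) n
  (x : U n) : dg_ap (g \oc f) x = dg_ap g (dg_ap f x).
Proof. by []. Qed.

Lemma sgD (i j : int) : (-1 : k) ^ (i + j) = (-1) ^ i * (-1) ^ j.
Proof. by rewrite expfzDr // oppr_eq0 oner_neq0. Qed.

Lemma sgN (i : int) : (-1 : k) ^ (- i) = (-1) ^ i.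
Proof. by rewrite -exprz_inv invrN1. Qed.

Lemma sgB1 (i : int) : (-1 : k) ^ (i - 1) = - (-1) ^ i.
Proof. by rewrite sgD sgN expr1z mulrN1. Qed.

Lemma sgK (i : int) : (-1 : k) ^ i * (-1) ^ i = 1.
Proof. by rewrite -{2}sgN -sgD subrr expr0z. Qed.

End DgBasics.

(** * The symmetric monoidal structure *)
Section TensorLift.
Variables (k : fieldType) (U V : dgvect k).

Lemma dg_pure_irr (i j n : int) (e e' : i + j = n) (u : U i) (v : V j) :
  dg_pure e u v = dg_pure e' u v.
Proof. by rewrite (eq_irrelevance e e'). Qed.

Lemma dg_pureDl (i j n : int) (e : i + j = n) (u u' : U i) (v : V j) :
  dg_pure e (u + u') v = dg_pure e u v + dg_pure e u' v.
Proof. exact: bilinearDl (dg_pure_bilinear U V e) _ _ _. Qed.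

Lemma dg_pureDr (i j n : int) (e : i + j = n) (u : U i) (v v' : V j) :
  dg_pure e u (v + v') = dg_pure e u v + dg_pure e u v'.
Proof. exact: bilinearDr (dg_pure_bilinear U V e) _ _ _. Qed.

Lemma dg_pureZl (i j n : int) (e : i + j = n) a (u : U i) (v : V j) :
  dg_pure e (a *: u) v = a *: dg_pure e u v.
Proof. exact: bilinearZl (dg_pure_bilinear U V e) _ _ _. Qed.

Lemma dg_pureZr (i j n : int) (e : i + j = n) a (u : U i) (v : V j) :
  dg_pure e u (a *: v) = a *: dg_pure e u v.
Proof. exact: bilinearZr (dg_pure_bilinear U V e) _ _ _. Qed.

Section GradedLift.
Variables (n : int) (X : lmodType k).
Variable b : forall i j, i + j = n -> U i -> V j -> X.
Hypothesis bP : forall i j (e : i + j = n), is_bilinear (b e).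

Definition glift (x : dg_tens U V n) : X :=
  @ds_lift k (dg_tens_comp U V n) X (fun i => tlift (b (dg_deg_sub n i))) x.

Lemma glift_linear : linear glift.
Proof. by apply: ds_lift_linear => i; exact/tlift_linear. Qed.

Lemma glift_pure (i j : int) (e : i + j = n) u v : glift (dg_pure e u v) = b e u v.
Proof.
have lin l : linear (tlift (b (dg_deg_sub n l))) by exact/tlift_linear.
rewrite /glift /dg_pure (ds_lift_inj lin) tlift_pure //.
have [e' E] : exists e', dg_pure_deg e = e' by exists (dg_pure_deg e).
rewrite E; move: (dg_deg_sub n i); case: _ / e' {E} => e2.
by rewrite (eq_irrelevance e2 e).
Qed.

End GradedLift.

Lemma tens_ext n (X : lmodType k) (f g : dg_tens U V n -> X) :
  linear f -> linear g ->
  (forall i j (e : i + j = n) u v, f (dg_pure e u v) = g (dg_pure e u v)) ->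
  forall x, f x = g x.
Proof.
move=> fl gl fg; elim/dg_tens_gen => [|i j e u v|x y xE yE].
- by rewrite (lin0 fl) (lin0 gl).
- exact: fg.
- by rewrite (linD fl) (linD gl) xE yE.
Qed.

Lemma tens_mor_ext W (f g : @mor (dgVect k) (dg_tens U V) W) :
  (forall i j n (e : i + j = n) (u : U i) (v : V j),
     dg_ap f (dg_pure e u v) = dg_ap g (dg_pure e u v)) -> f = g.
Proof.
by move=> fg; apply: mor_ext => n x; apply: (tens_ext _ _ _ x); try exact: dg_ap_lin.
Qed.

Lemma dg_tens_d_pureE (i j n : int) (e : i + j = n) u v
    (el : i - 1 + j = n - 1) (er : i + (j - 1) = n - 1) :
  dg_d (dg_tens U V) n (dg_pure e u v)
    = dg_pure el (dg_d U i u) v + (-1 : k) ^ i *: dg_pure er u (dg_d V j v).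
Proof.
rewrite [LHS]dg_tens_dE /dg_tens_d_pure.
by rewrite (dg_pure_irr _ el) (dg_pure_irr _ er).
Qed.

(** A degreewise bilinear map obeying the Leibniz rule is a dg-map out of the
    tensor product. *)
Record bimap (W : dgvect k) := BiMap {
  bm_fun :> forall i j n, i + j = n -> U i -> V j -> W n;
  bm_bil : forall i j n (e : i + j = n), is_bilinear (bm_fun e);
  bm_d : forall i j n (e : i + j = n) u v,
    dg_d W n (bm_fun e u v)
      = bm_fun (dg_degl e) (dg_d U i u) v
        + (-1) ^ i *: bm_fun (dg_degr e) u (dg_d V j v) }.

Variable W : dgvect k.
Variable b : bimap W.

Lemma bimap_comm n (x : dg_tens U V n) :
  glift (fun i j e => b i j (n - 1) e) (dg_d (dg_tens U V) n x)
    = dg_d W n (glift (fun i j e => b i j n e) x).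
Proof.
have bl m : linear (glift (fun i j e => b i j m e)).
  by apply: glift_linear => i j e; exact: bm_bil.
apply: (tens_ext (f := fun x => glift _ (dg_d _ n x))
                 (g := fun x => dg_d W n (glift _ x))).
- by move=> a y z; rewrite linearP bl.
- by move=> a y z; rewrite bl linearP.
move=> i j e u v; rewrite glift_pure => [|? ? ?]; last exact: bm_bil.
rewrite bm_d [X in glift _ X]dg_tens_dE /dg_tens_d_pure (linD (bl _)) (linZ (bl _)).
by rewrite !glift_pure // => *; exact: bm_bil.
Qed.

Definition bimap_hom : @mor (dgVect k) (dg_tens U V) W :=
  mk_dg (fun n => glift_linear (fun i j e => bm_bil b e)) bimap_comm.

Lemma bimap_homE (i j n : int) (e : i + j = n) u v :
  dg_ap bimap_hom (dg_pure e u v) = b i j n e u v.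
Proof. by apply: glift_pure => *; exact: bm_bil. Qed.

End TensorLift.

Section TensorStructure.
Variable k : fieldType.
Implicit Types U V W : dgvect k.
Local Notation hom := (@mor (dgVect k)).

Section Map.
Variables (U U' V V' : dgvect k) (f : hom U U') (g : hom V V').

Lemma tens_map_bil i j n (e : i + j = n) :
  is_bilinear (fun (u : U i) (v : V j) => dg_pure e (dg_ap f u) (dg_ap g v)).
Proof.
apply: bilin_intro => [a u u' v|a u v v'].
- by rewrite dg_apP dg_pureDl dg_pureZl.
- by rewrite dg_apP dg_pureDr dg_pureZr.
Qed.

Lemma tens_map_d i j n (e : i + j = n) (u : U i) (v : V j) :
  dg_d (dg_tens U' V') n (dg_pure e (dg_ap f u) (dg_ap g v))
    = dg_pure (dg_degl e) (dg_ap f (dg_d U i u)) (dg_ap g v)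
      + (-1) ^ i *: dg_pure (dg_degr e) (dg_ap f u) (dg_ap g (dg_d V j v)).
Proof. by rewrite !dg_ap_d (dg_tens_d_pureE _ _ _ (dg_degl e) (dg_degr e)). Qed.

Definition tens_map : hom (dg_tens U V) (dg_tens U' V') :=
  bimap_hom (@BiMap _ _ _ (dg_tens U' V') _ tens_map_bil tens_map_d).

Lemma tens_mapE i j n (e : i + j = n) u v :
  dg_ap tens_map (dg_pure e u v) = dg_pure e (dg_ap f u) (dg_ap g v).
Proof. exact: bimap_homE. Qed.

End Map.

Section Swap.
Variables U V : dgvect k.

Lemma swap_deg (i j n : int) : i + j = n -> j + i = n.
Proof. by rewrite addrC. Qed.

Definition swap_fun i j n (e : i + j = n) (u : U i) (v : V j) : dg_tens V U n :=
  (-1) ^ (i * j) *: dg_pure (swap_deg e) v u.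

Lemma swap_bil i j n (e : i + j = n) : is_bilinear (swap_fun e).
Proof.
rewrite /swap_fun; apply: bilin_intro => [a u u' v|a u v v'].
- by rewrite dg_pureDr dg_pureZr scalerDr !scalerA mulrC.
- by rewrite dg_pureDl dg_pureZl scalerDr !scalerA mulrC.
Qed.

Lemma swap_d i j n (e : i + j = n) (u : U i) (v : V j) :
  dg_d (dg_tens V U) n (swap_fun e u v)
    = swap_fun (dg_degl e) (dg_d U i u) v
      + (-1) ^ i *: swap_fun (dg_degr e) u (dg_d V j v).
Proof.
rewrite linearZ /= (dg_tens_d_pureE _ _ _ (swap_deg (dg_degr e)) (swap_deg (dg_degl e))).
rewrite /swap_fun scalerDr [LHS]addrC !scalerA; congr (_ *: _ + _ *: _).
- by rewrite mulrBl mul1r sgD sgN.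
- by rewrite mulrBr mulr1 sgD sgN mulrCA sgK mulr1.
Qed.

Definition swap : hom (dg_tens U V) (dg_tens V U) :=
  bimap_hom (@BiMap _ _ _ (dg_tens V U) _ swap_bil swap_d).

Lemma swapE i j n (e : i + j = n) (e' : j + i = n) u v :
  dg_ap swap (dg_pure e u v) = (-1) ^ (i * j) *: dg_pure e' v u.
Proof. by rewrite bimap_homE /= /swap_fun (dg_pure_irr _ e'). Qed.

End Swap.

Lemma swapK U V : swap V U \oc swap U V = idm _.
Proof.
apply: tens_mor_ext => i j n e u v.
rewrite dg_ap_comp (swapE e (swap_deg e)) dg_apZ (swapE _ e).
by rewrite scalerA (mulrC j) sgK scale1r.
Qed.

Lemma swap_nat U U' V V' (f : hom U U') (g : hom V V') :
  swap U' V' \oc tens_map f g = tens_map g f \oc swap U V.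
Proof.
apply: tens_mor_ext => i j n e u v.
by rewrite !dg_ap_comp tens_mapE !(swapE _ (swap_deg e)) dg_apZ tens_mapE.
Qed.

(** The associator is lifted in two steps: for a fixed element w of W it is
    determined on the tensor product of U and V, and the resulting family of
    linear maps is bilinear in the pair formed with w. *)
Section Associator.
Variables U V W : dgvect k.

Section Inner.
Variables (m l n : int) (e : m + l = n) (w : W l).

Lemma assoc_deg (i j : int) : i + j = m -> i + (j + l) = n.
Proof. by move=> eij; rewrite addrA eij. Qed.

Definition assoc_fun i j (eij : i + j = m) (u : U i) (v : V j) :
    dg_tens U (dg_tens V W) n :=
  dg_pure (assoc_deg eij) u (dg_pure erefl v w : dg_tens V W (j + l)).

Lemma assoc_bil i j (eij : i + j = m) : is_bilinear (assoc_fun eij).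
Proof.
rewrite /assoc_fun; apply: bilin_intro => [a u u' v|a u v v'].
- by rewrite dg_pureDl dg_pureZl.
- by rewrite (dg_pureDl _ _ v') dg_pureZl dg_pureDr dg_pureZr.
Qed.

End Inner.

Lemma pure_assoc_irr (i j l n p p' : int) (h : j + l = p) (h' : j + l = p')
    (e : i + p = n) (e' : i + p' = n) (u : U i) (v : V j) (w : W l) :
  dg_pure e u (dg_pure h v w : dg_tens V W p)
    = dg_pure e' u (dg_pure h' v w : dg_tens V W p').
Proof. by case: _ / h in e *; case: _ / h' in e' *; exact: dg_pure_irr. Qed.

Lemma pure_assocl_irr (i j l n p p' : int) (h : i + j = p) (h' : i + j = p')
    (e : p + l = n) (e' : p' + l = n) (u : U i) (v : V j) (w : W l) :
  dg_pure e (dg_pure h u v : dg_tens U V p) w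
    = dg_pure e' (dg_pure h' u v : dg_tens U V p') w.
Proof. by case: _ / h in e *; case: _ / h' in e' *; exact: dg_pure_irr. Qed.

Definition assoc_lift (m l n : int) (e : m + l = n) (x : dg_tens U V m) (w : W l) :
  dg_tens U (dg_tens V W) n := glift (@assoc_fun m l n e w) x.

Lemma assoc_lift_pure m l n (e : m + l = n) i j (eij : i + j = m) p
    (ejl : j + l = p) (eip : i + p = n) (u : U i) (v : V j) (w : W l) :
  assoc_lift e (dg_pure eij u v) w
    = dg_pure eip u (dg_pure ejl v w : dg_tens V W p).
Proof.
rewrite /assoc_lift glift_pure => [|*]; last exact: assoc_bil.
exact: pure_assoc_irr.
Qed.

Lemma assoc_lift_linl m l n (e : m + l = n) w : linear (fun x => assoc_lift e x w).
Proof. by apply: glift_linear => *; exact: assoc_bil. Qed.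

Lemma assoc_lift_bil m l n (e : m + l = n) : is_bilinear (assoc_lift e).
Proof.
apply: bilin_intro => [a x x' w|a x w w']; first exact: assoc_lift_linl.
apply: (tens_ext (f := fun x => assoc_lift e x (a *: w + w'))
          (g := fun x => a *: assoc_lift e x w + assoc_lift e x w')).
- exact: assoc_lift_linl.
- move=> c y z; rewrite !assoc_lift_linl !scalerDr !scalerA (mulrC a c).
  by rewrite addrACA.
- move=> i j eij u v; have eip := assoc_deg e eij.
  rewrite !(assoc_lift_pure e eij (erefl _) eip).
  by rewrite (dg_pureDr (erefl _)) dg_pureZr dg_pureDr dg_pureZr.
Qed.

Lemma assoc_lift_d m l n (e : m + l = n) x w :
  dg_d (dg_tens U (dg_tens V W)) n (assoc_lift e x w)
    = assoc_lift (dg_degl e) (dg_d (dg_tens U V) m x) w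
      + (-1) ^ m *: assoc_lift (dg_degr e) x (dg_d W l w).
Proof.
apply: (tens_ext (f := fun x => dg_d (dg_tens U (dg_tens V W)) n (assoc_lift e x w))
  (g := fun x => assoc_lift (dg_degl e) (dg_d (dg_tens U V) m x) w
      + (-1) ^ m *: assoc_lift (dg_degr e) x (dg_d W l w))).
- by move=> a y z; rewrite assoc_lift_linl linearP.
- move=> a y z; rewrite linearP !assoc_lift_linl !scalerDr !scalerA.
  by rewrite (mulrC a) addrACA.
move=> i j eij u v; have eip := assoc_deg e eij.
rewrite (assoc_lift_pure e eij (erefl _) eip).
rewrite (dg_tens_d_pureE _ _ _ (dg_degl eip) (dg_degr eip)).
rewrite (dg_tens_d_pureE _ _ _ (dg_degl eij) (dg_degr eij)).
rewrite (dg_tens_d_pureE _ _ _ (dg_degl (erefl (j + l))) (dg_degr (erefl (j + l)))).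
rewrite (linD (assoc_lift_linl _ _)) (linZ (assoc_lift_linl _ _)).
rewrite (assoc_lift_pure _ (dg_degl eij) (erefl _) (dg_degl eip)).
rewrite (assoc_lift_pure _ (dg_degr eij) (dg_degl (erefl _)) (dg_degr eip)).
rewrite (assoc_lift_pure _ eij (dg_degr (erefl _)) (dg_degr eip)).
rewrite dg_pureDr dg_pureZr scalerDr scalerA addrA -sgD.
by congr (_ + _ ^ _ *: _).
Qed.

Definition assoc_map : hom (dg_tens (dg_tens U V) W) (dg_tens U (dg_tens V W)) :=
  bimap_hom (@BiMap _ (dg_tens U V) W (dg_tens U (dg_tens V W)) _
    assoc_lift_bil assoc_lift_d).

Lemma assoc_mapE i j l m p n (eij : i + j = m) (eml : m + l = n)
    (ejl : j + l = p) (eip : i + p = n) u v w :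
  dg_ap assoc_map (dg_pure eml (dg_pure eij u v : dg_tens U V m) w)
    = dg_pure eip u (dg_pure ejl v w : dg_tens V W p).
Proof. by rewrite bimap_homE; exact: assoc_lift_pure. Qed.

End Associator.

Lemma tens3_mor_ext U V W X (f g : hom (dg_tens (dg_tens U V) W) X) :
  (forall i j m l n (eij : i + j = m) (eml : m + l = n) (u : U i) (v : V j) (w : W l),
     dg_ap f (dg_pure eml (dg_pure eij u v : dg_tens U V m) w)
     = dg_ap g (dg_pure eml (dg_pure eij u v : dg_tens U V m) w)) -> f = g.
Proof.
move=> fg; apply: tens_mor_ext => m l n e x w.
apply: (tens_ext (f := fun x => dg_ap f (dg_pure e x w))
                 (g := fun x => dg_ap g (dg_pure e x w))) => //.
- by move=> a y z; rewrite (dg_pureDl e) dg_pureZl dg_apP.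
- by move=> a y z; rewrite (dg_pureDl e) dg_pureZl dg_apP.
Qed.

Lemma tens3r_mor_ext U V W X (f g : hom (dg_tens U (dg_tens V W)) X) :
  (forall i j m l n (eij : i + j = m) (eml : l + m = n) (u : U l) (v : V i) (w : W j),
     dg_ap f (dg_pure eml u (dg_pure eij v w : dg_tens V W m))
     = dg_ap g (dg_pure eml u (dg_pure eij v w : dg_tens V W m))) -> f = g.
Proof.
move=> fg; apply: tens_mor_ext => l m n e u x.
apply: (tens_ext (f := fun x => dg_ap f (dg_pure e u x))
                 (g := fun x => dg_ap g (dg_pure e u x))) => //.
- by move=> a y z; rewrite (dg_pureDr e) dg_pureZr dg_apP.
- by move=> a y z; rewrite (dg_pureDr e) dg_pureZr dg_apP.
Qed.

Lemma tens4_mor_ext U V W Z X (f g : hom (dg_tens (dg_tens (dg_tens U V) W) Z) X) :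
  (forall i j m l n t r (eij : i + j = m) (eml : m + l = n) (ent : n + t = r)
     (u : U i) (v : V j) (w : W l) (z : Z t),
     dg_ap f (dg_pure ent (dg_pure eml (dg_pure eij u v : dg_tens U V m) w
        : dg_tens (dg_tens U V) W n) z)
     = dg_ap g (dg_pure ent (dg_pure eml (dg_pure eij u v : dg_tens U V m) w
        : dg_tens (dg_tens U V) W n) z)) -> f = g.
Proof.
move=> fg; apply: tens3_mor_ext => m l n t r e e' x w z.
apply: (tens_ext
  (f := fun x => dg_ap f (dg_pure e' (dg_pure e x w : dg_tens (dg_tens U V) W n) z))
  (g := fun x => dg_ap g (dg_pure e' (dg_pure e x w : dg_tens (dg_tens U V) W n) z)))
  => //.
- by move=> a y y'; rewrite (dg_pureDl e) dg_pureZl (dg_pureDl e') dg_pureZl dg_apP.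
- by move=> a y y'; rewrite (dg_pureDl e) dg_pureZl (dg_pureDl e') dg_pureZl dg_apP.
Qed.

Section AssociatorInverse.
Variables U V W : dgvect k.

(** The inverse associator is the associator of the reversed factors, conjugated
    by symmetries. The signs cancel because any two factors are exchanged twice.
    Only its values on pure tensors are used, hence the sigma type. *)
Lemma associ_exists :
  {f : hom (dg_tens U (dg_tens V W)) (dg_tens (dg_tens U V) W) |
    forall i j l m p n (eij : i + j = m) (eml : m + l = n)
      (ejl : j + l = p) (eip : i + p = n) u v w,
    dg_ap f (dg_pure eip u (dg_pure ejl v w : dg_tens V W p))
      = dg_pure eml (dg_pure eij u v : dg_tens U V m) w}.
Proof.
exists (tens_map (swap V U) (idm (W : dgVect k)) \oc swap W (dg_tens V U)
  \oc assoc_map W V U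
  \oc tens_map (swap V W) (idm (U : dgVect k)) \oc swap U (dg_tens V W)).
move=> i j l m p n eij eml ejl eip u v w.
rewrite !dg_ap_comp (swapE _ (swap_deg eip)) dg_apZ tens_mapE.
rewrite (swapE _ (swap_deg ejl)) dg_pureZl !dg_apZ.
have elm : l + m = n by rewrite addrC.
rewrite (assoc_mapE _ _ (swap_deg eij) elm) (swapE _ eml) dg_apZ tens_mapE.
rewrite (swapE _ eij) dg_pureZl !scalerA -!sgD.
rewrite [X in (-1) ^ X](_ : _ = (i * j + i * l + j * l) + (i * j + i * l + j * l)).
  by rewrite sgD sgK scale1r.
by rewrite -eij -ejl; ring.
Qed.

Definition associ_map := sval associ_exists.
Definition associ_mapE := svalP associ_exists.

Lemma assocK : associ_map \oc assoc_map U V W = idm _.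
Proof.
apply: tens3_mor_ext => i j m l n eij eml u v w.
have eip : i + (j + l) = n by rewrite addrA eij.
by rewrite dg_ap_comp (assoc_mapE _ _ (erefl _) eip) (associ_mapE eij eml).
Qed.

Lemma associK : assoc_map U V W \oc associ_map = idm _.
Proof.
apply: tens3r_mor_ext => j l p i n ejl eip u v w.
have eml : (i + j) + l = n by rewrite -addrA ejl.
by rewrite dg_ap_comp (associ_mapE (erefl _) eml) (assoc_mapE _ _ ejl eip).
Qed.

End AssociatorInverse.

(** The unit object is concentrated in degree 0; its elements are read off by
    a functional defined in all degrees. *)
Definition uval (i : int) : dg_unit k i -> k^o :=
  match i with Posz 0 => id | _ => fun=> 0 end.

Definition uone : dg_unit k 0 := (1 : k^o).

Lemma uval_lin i : linear (@uval i).
Proof. by case: i => [[|i]|i] a x y //=; rewrite scaler0 addr0. Qed.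

Lemma uval_neq0 i (x : dg_unit k i) : i != 0 -> uval x = 0.
Proof. by case: i x => [[|i]|i]. Qed.

Lemma uval_d i (x : dg_unit k i) : uval (dg_d (dg_unit k) i x) = 0.
Proof. exact: lin0 (@uval_lin _). Qed.

Lemma uval_inj i (x y : dg_unit k i) : uval x = uval y -> x = y.
Proof.
by case: i x y => [[|i]|i] //= x y _; apply/rowP => -[].
Qed.

Lemma ds_fun_lin (W : int -> lmodType k) i j : linear (fun w : W i => ds_fun w j).
Proof.
move=> a x y; have [e|ne] := eqVneq i j; first by subst j; rewrite !ds_funii.
by rewrite !ds_fun_neq // scaler0 addr0.
Qed.

Lemma ds_fun_ap U V (f : hom U V) i j (u : U i) :
  dg_ap f (ds_fun u j) = ds_fun (dg_ap f u) j.
Proof.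
have [e|ne] := eqVneq i j; first by subst j; rewrite !ds_funii.
by rewrite !ds_fun_neq // dg_ap0.
Qed.

Lemma ds_fun_d U i j (u : U i) :
  dg_d U j (ds_fun u j) = ds_fun (dg_d U i u) (j - 1).
Proof.
have [e|ne] := eqVneq i j; first by subst j; rewrite !ds_funii.
by rewrite !ds_fun_neq ?linear0 // (inj_eq (addIr _)).
Qed.

Lemma unit_pureE V i j n (e : i + j = n) (a : dg_unit k i) (v : V j) (e0 : 0 + n = n):
  dg_pure e a v = dg_pure e0 uone (uval a *: ds_fun v n).
Proof.
have [i0|i0] := eqVneq i 0.
  subst i; have e' : j = n by rewrite -e add0r.
  subst j; rewrite ds_funii dg_pureZr -dg_pureZl (dg_pure_irr _ e0); congr dg_pure.
  by apply: uval_inj; rewrite (linZ (@uval_lin _)); apply: esym; exact: mulr1.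
rewrite uval_neq0 // scale0r dg_pure0r (_ : a = 0) ?dg_pure0l //.
by apply: uval_inj; rewrite !uval_neq0.
Qed.

Section Unitor.
Variables V : dgvect k.

Lemma lunit_bil i j n (e : i + j = n) :
  is_bilinear (fun (a : dg_unit k i) (v : V j) => uval a *: ds_fun v n).
Proof.
apply: bilin_intro => [a u u' v|a u v v'].
- by rewrite uval_lin scalerDl scalerA.
- by rewrite ds_fun_lin scalerDr !scalerA mulrC.
Qed.

Lemma lunit_d i j n (e : i + j = n) (a : dg_unit k i) (v : V j) :
  dg_d V n (uval a *: ds_fun v n) = uval (dg_d (dg_unit k) i a) *: ds_fun v (n - 1)
    + (-1) ^ i *: (uval a *: ds_fun (dg_d V j v) (n - 1)).
Proof.
rewrite uval_d scale0r add0r linearZ /= ds_fun_d.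
have [i0|i0] := eqVneq i 0; first by subst i; rewrite expr0z scale1r.
by rewrite uval_neq0 // !scale0r scaler0.
Qed.

Definition lunit_map : hom (dg_tens (dg_unit k) V) V :=
  bimap_hom (@BiMap k (dg_unit k) V V (fun i j n e a v => uval a *: ds_fun v n)
    lunit_bil lunit_d).

Lemma lunit_mapE i j n (e : i + j = n) a v :
  dg_ap lunit_map (dg_pure e a v) = uval a *: ds_fun v n.
Proof. exact: bimap_homE. Qed.

Lemma luniti_lin n : linear (fun v : V n => dg_pure (add0r n) uone v).
Proof. by move=> a u v; rewrite dg_pureDr dg_pureZr. Qed.

Lemma luniti_d n (v : V n) : dg_pure (add0r (n - 1)) uone (dg_d V n v)
  = dg_d (dg_tens (dg_unit k) V) n (dg_pure (add0r n) uone v).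
Proof.
rewrite (dg_tens_d_pureE _ _ _ (dg_degl (add0r n)) (dg_degr (add0r n))).
rewrite expr0z scale1r [dg_d _ 0 _](_ : _ = 0) ?dg_pure0l ?add0r //.
exact: dg_pure_irr.
Qed.

Definition luniti_map : hom V (dg_tens (dg_unit k) V) := 
  @mk_dg k V (dg_tens (dg_unit k) V) (fun n v => dg_pure (add0r n) uone v) luniti_lin luniti_d.

Lemma luniti_mapE n v e : dg_ap luniti_map v = dg_pure (e : 0 + n = n) uone v.
Proof. exact: dg_pure_irr. Qed.

Lemma lunitK : luniti_map \oc lunit_map = idm _.
Proof.
apply: tens_mor_ext => i j n e a v.
by rewrite dg_ap_comp lunit_mapE (luniti_mapE _ (add0r n)) -unit_pureE.
Qed.

Lemma lunitiK : lunit_map \oc luniti_map = idm _.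
Proof.
apply: mor_ext => n v.
by rewrite dg_ap_comp (luniti_mapE _ (add0r n)) lunit_mapE ds_funii scale1r.
Qed.

Lemma runit_exists : {f : hom (dg_tens V (dg_unit k)) V |
  f = lunit_map \oc swap _ _ & forall i j n (e : i + j = n) a v,
    dg_ap f (dg_pure e v a) = uval a *: ds_fun v n}.
Proof.
exists (lunit_map \oc swap _ _) => // i j n e a v.
rewrite dg_ap_comp (swapE _ (swap_deg e)) dg_apZ lunit_mapE.
have [j0|j0] := eqVneq j 0; first by subst j; rewrite mulr0 expr0z scale1r.
by rewrite uval_neq0 // scale0r scaler0.
Qed.

Lemma runiti_exists : {g : hom V (dg_tens V (dg_unit k)) |
  g = swap _ _ \oc luniti_map & forall n (v : V n) (e : n + 0 = n),
    dg_ap g v = dg_pure e v uone}.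
Proof.
exists (swap _ _ \oc luniti_map) => // n v e.
rewrite dg_ap_comp (luniti_mapE _ (add0r n)) (swapE _ e).
by rewrite mul0r expr0z scale1r.
Qed.

Definition runit_map := s2val runit_exists.
Definition runiti_map := s2val runiti_exists.
Definition runit_mapE := s2valP' runit_exists.
Definition runiti_mapE := s2valP' runiti_exists.

Lemma runitK : runiti_map \oc runit_map = idm _.
Proof. 
rewrite /runit_map /runiti_map (s2valP runiti_exists) (s2valP runit_exists).
by rewrite compmA -(compmA _ luniti_map) lunitK compm1 swapK.
 Qed.

Lemma runitiK : runit_map \oc runiti_map = idm _.
Proof. 
rewrite /runit_map /runiti_map (s2valP runiti_exists) (s2valP runit_exists).
by rewrite compmA -(compmA lunit_map) swapK compm1 lunitiK.
 Qed.

End Unitor.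

Lemma tens_map1 U V : tens_map (idm (U : dgVect k)) (idm (V : dgVect k)) = idm _.
Proof. by apply: tens_mor_ext => i j n e u v; rewrite tens_mapE. Qed.

Lemma tens_mapM U U' U'' V V' V'' (f' : hom U' U'') (f : hom U U')
    (g' : hom V' V'') (g : hom V V') :
  tens_map (f' \oc f) (g' \oc g) = tens_map f' g' \oc tens_map f g.
Proof. by apply: tens_mor_ext => i j n e u v; rewrite dg_ap_comp !tens_mapE. Qed.

Lemma assoc_nat U U' V V' W W' (f : hom U U') (g : hom V V') (h : hom W W') :
  assoc_map U' V' W' \oc tens_map (tens_map f g) h
    = tens_map f (tens_map g h) \oc assoc_map U V W.
Proof.
apply: tens3_mor_ext => i j m l n eij eml u v w.
have eip : i + (j + l) = n by rewrite addrA eij.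
by rewrite !dg_ap_comp (assoc_mapE _ _ (erefl _) eip) !tens_mapE
  (assoc_mapE _ _ (erefl _) eip).
Qed.

Lemma lunit_nat U V (f : hom U V) :
  lunit_map V \oc tens_map (idm (dg_unit k : dgVect k)) f = f \oc lunit_map U.
Proof.
apply: tens_mor_ext => i j n e u v.
by rewrite !dg_ap_comp tens_mapE !lunit_mapE dg_apZ ds_fun_ap.
Qed.

Lemma runit_nat U V (f : hom U V) :
  runit_map V \oc tens_map f (idm (dg_unit k : dgVect k)) = f \oc runit_map U.
Proof.
apply: tens_mor_ext => i j n e u v.
by rewrite [LHS]dg_ap_comp [RHS]dg_ap_comp tens_mapE !runit_mapE dg_apZ ds_fun_ap.
Qed.

Lemma pentagon U V W X :
  tens_map (idm (U : dgVect k)) (assoc_map V W X) \oc assoc_map U (dg_tens V W) X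
      \oc tens_map (assoc_map U V W) (idm (X : dgVect k))
    = assoc_map U V (dg_tens W X) \oc assoc_map (dg_tens U V) W X.
Proof.
apply: tens4_mor_ext => i j m l n t r eij eml ent u v w x.
have eip : i + (j + l) = n by rewrite addrA eij.
have e1 : i + (j + l + t) = r by rewrite addrA eip.
have e2 : m + (l + t) = r by rewrite addrA eml.
have e3 : j + (l + t) = j + l + t by rewrite addrA.
rewrite !dg_ap_comp !tens_mapE (assoc_mapE _ _ (erefl _) eip).
rewrite (assoc_mapE _ _ (erefl _) e1) tens_mapE (assoc_mapE _ _ (erefl _) e3).
by rewrite (assoc_mapE _ _ (erefl _) e2) (assoc_mapE _ _ e3 e1).
Qed.

Lemma triangle U V :
  tens_map (idm (U : dgVect k)) (lunit_map V) \oc assoc_map U (dg_unit k) V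
    = tens_map (runit_map U) (idm (V : dgVect k)).
Proof.
apply: tens3_mor_ext => i j m l n eij eml u a v.
have [j0|j0] := eqVneq j 0.
  subst j; have e1 : i = m by rewrite -eij addr0.
  case: _ / e1 in eij eml *; rewrite dg_ap_comp (assoc_mapE _ _ (add0r l) eml) !tens_mapE.
  by rewrite lunit_mapE runit_mapE !ds_funii dg_pureZl dg_pureZr.
have eip : i + (j + l) = n by rewrite addrA eij.
rewrite [LHS]dg_ap_comp (assoc_mapE _ _ (erefl _) eip) !tens_mapE.
by rewrite lunit_mapE runit_mapE uval_neq0 // !scale0r dg_pure0l dg_pure0r.
Qed.

Lemma hexagon1 U V W :
  assoc_map V W U \oc swap U (dg_tens V W) \oc assoc_map U V W
    = tens_map (idm (V : dgVect k)) (swap U W) \oc assoc_map V U W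
      \oc tens_map (swap U V) (idm (W : dgVect k)).
Proof.
apply: tens3_mor_ext => i j m l n eij eml u v w.
have eip : i + (j + l) = n by rewrite addrA eij.
have e1 : j + (i + l) = n by rewrite addrCA.
have e2 : j + (l + i) = n by rewrite (addrC l).
rewrite !dg_ap_comp (assoc_mapE _ _ (erefl _) eip) (swapE _ (swap_deg eip)).
rewrite dg_apZ (assoc_mapE _ _ (erefl _) e2) tens_mapE (swapE _ (swap_deg eij)).
rewrite dg_pureZl !dg_apZ (assoc_mapE _ _ (erefl _) e1) tens_mapE.
rewrite (swapE _ (addrC _ _)) dg_pureZr scalerA mulrDr sgD.
by rewrite (pure_assoc_irr _ (addrC _ _) _ e1).
Qed.

Lemma hexagon2 U V W :
  associ_map W U V \oc swap (dg_tens U V) W \oc associ_map U V W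
    = tens_map (swap U W) (idm (V : dgVect k)) \oc associ_map U W V
      \oc tens_map (idm (U : dgVect k)) (swap V W).
Proof.
apply: tens3r_mor_ext => j l p i n ejl eip u v w.
have eml : (i + j) + l = n by rewrite -addrA ejl.
have e1 : (i + l) + j = n by rewrite addrAC.
have e2 : (l + i) + j = n by rewrite (addrC l).
rewrite !dg_ap_comp (associ_mapE (erefl _) eml) (swapE _ (swap_deg eml)).
rewrite dg_apZ (associ_mapE (erefl _) e2) tens_mapE (swapE _ (swap_deg ejl)).
rewrite dg_pureZr !dg_apZ (associ_mapE (erefl _) e1) tens_mapE.
rewrite (swapE _ (addrC _ _)) dg_pureZl scalerA mulrDl sgD [X in X *: _]mulrC.
by rewrite (pure_assocl_irr _ (addrC _ _) _ e1).
Qed.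

Definition dg_mon_str : is_monoidal (C := dgVect k) (@dg_tens k) (dg_unit k) :=
  @IsMonoidal (dgVect k) (@dg_tens k) (dg_unit k)
    (fun A A' B B' f g => tens_map f g) assoc_map associ_map
    lunit_map luniti_map runit_map runiti_map tens_map1
    (fun A A' A'' B B' B'' f' f g' g => tens_mapM f' f g' g)
    assocK associK lunitK lunitiK runitK runitiK
    (fun A A' B B' D D' f g h => assoc_nat f g h)
    (fun A A' f => lunit_nat f) (fun A A' f => runit_nat f) pentagon triangle.

Definition dgM : monoidal := Monoidal dg_mon_str.

Definition dg_braid : is_braided dgM :=
  @IsBraided dgM swap (fun A B => swap B A) swapK (fun A B => swapK B A)
    (fun A A' B B' f g => swap_nat f g) hexagon1 hexagon2.

Lemma dg_koszul_dgM : @dg_koszul k dg_mon_str dg_braid.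
Proof.
split=> *; first exact: tens_mapE.
- exact: assoc_mapE.
- by rewrite [LHS]lunit_mapE ds_funii.
- by rewrite [LHS]runit_mapE ds_funii.
- exact: swapE.
Qed.

End TensorStructure.

(** * The internal hom *)
Section InternalHom.
Variable k : fieldType.
Implicit Types U V W : dgvect k.
Local Notation hom := (@mor (dgVect k)).

(** The differential, landing in any degree equal to n - 1. *)
Definition dgd U (n m : int) (e : n - 1 = m) (x : U n) : U m :=
  ecast m (U m) e (dg_d U n x).

Lemma dgd_lin U n m (e : n - 1 = m) : linear (@dgd U n m e).
Proof. by case: _ / e => a x y; exact: linearP. Qed.

Lemma dgdE U n (e : n - 1 = n - 1) (x : U n) : dgd e x = dg_d U n x.
Proof. by rewrite /dgd eq_axiomK. Qed.

Lemma dgd_ap U V (f : hom U V) n m (e : n - 1 = m) (x : U n) :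
  dg_ap f (dgd e x) = dgd e (dg_ap f x).
Proof. by case: _ / e; exact: dg_ap_d. Qed.

Lemma dgd_dgd U n m l (e : n - 1 = m) (e' : m - 1 = l) (x : U n) :
  dgd e' (dgd e x) = 0.
Proof. by case: _ / e' ; case: _ / e; exact: dg_dd. Qed.

Lemma dgd_pure U V i j n m (e : i + j = n) (h : n - 1 = m) (u : U i) (v : V j)
    (el : i - 1 + j = m) (er : i + (j - 1) = m) :
  dgd h (dg_pure e u v : dg_tens U V n)
    = dg_pure el (dg_d U i u) v + (-1) ^ i *: dg_pure er u (dg_d V j v).
Proof. by case: _ / h in el er *; rewrite dgdE; exact: dg_tens_d_pureE. Qed.

Section Hom.
Variables A B : dgvect k.

Section Degree.
Variable n : int.

(** A homogeneous map of degree n sends A_i to B_m whenever n + i = m. Quantifying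
    over such m, and not only over n + i, spares all changes of degree; the
    argument a is part of the index, so that the maps live in a product of
    copies of the B_m, of which the linear ones form a subspace. *)
Definition ih_index : small := {p : int * int & (((n + p.1)%R = p.2) * A p.1)%type}.

Definition ih_arg i m (e : n + i = m) (a : A i) : ih_index :=
  existT (fun p : int * int => (((n + p.1)%R = p.2) * A p.1)%type) (i, m) (e, a).

Definition ih_fam := pi_space (fun t : ih_index => B (projT1 t).2).

Definition ih_linear (f : ih_fam) := forall i m (e : n + i = m) c (a a' : A i),
  f (ih_arg e (c *: a + a')) = c *: f (ih_arg e a) + f (ih_arg e a').

Lemma ih_linear_sub : subclosed ih_linear.
Proof.
split=> [i m e c a a'|c f g fP gP i m e a u u'].
  by apply: esym; rewrite scaler0 add0r.
rewrite /= fP gP !scalerDr !scalerA (mulrC c); exact: addrACA.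
Qed.

Definition ih_sp : lmodType k := subspace ih_linear_sub.

Definition ihv (f : ih_sp) i m (e : n + i = m) (a : A i) : B m :=
  (sub_val f : ih_fam) (ih_arg e a).

Lemma ihv_lin (f : ih_sp) i m (e : n + i = m) : linear (ihv f e).
Proof. by move=> c a a'; exact: (sub_prop f). Qed.

Lemma ihv_comb c (f g : ih_sp) i m (e : n + i = m) a :
  ihv (c *: f + g) e a = c *: ihv f e a + ihv g e a.
Proof. by rewrite /ihv sub_val_linear. Qed.

Lemma ih_ext (f g : ih_sp) :
  (forall i m (e : n + i = m) a, ihv f e a = ihv g e a) -> f = g.
Proof.
by move=> fg; apply/sub_ext/pi_ext => -[[i m] [e a]]; exact: fg.
Qed.

Section Make.
Variable f : forall i m, n + i = m -> A i -> B m.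
Hypothesis fP : forall i m (e : n + i = m), linear (f e).

Definition ih_mk_fam : ih_fam :=
  PiSpace (fun t : ih_index => f (projT2 t).1 (projT2 t).2).

Lemma ih_mk_linear : ih_linear ih_mk_fam.
Proof. by move=> i m e c a a'; exact: fP. Qed.

Definition ih_mk : ih_sp := Subspace ih_linear_sub ih_mk_linear.

Lemma ih_mkE i m (e : n + i = m) a : ihv ih_mk e a = f e a.
Proof. by []. Qed.

End Make.

Lemma dgd_ihv (f : ih_sp) i m m' p (e : n + i = m) (e' : n + i = m')
    (h : m - 1 = p) (h' : m' - 1 = p) a :
  dgd h (ihv f e a) = dgd h' (ihv f e' a).
Proof.
case: _ / e in h *; case: _ / e' in h' *; by rewrite (eq_irrelevance h h').
Qed.

Lemma ihv_irr (f : ih_sp) i m (e e' : n + i = m) a : ihv f e a = ihv f e' a.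
Proof. by rewrite (eq_irrelevance e e'). Qed.

End Degree.

Lemma ih_deg1 (n i m : int) : n - 1 + i = m -> n + i = m + 1.
Proof. by move=> <-; rewrite addrAC subrK. Qed.

Lemma ih_deg2 (n i m : int) : n - 1 + i = m -> n + (i - 1) = m.
Proof. by move=> <-; rewrite addrA addrAC. Qed.

Lemma ih_deg3 (m : int) : m + 1 - 1 = m.
Proof. by rewrite addrK. Qed.

Section Differential.
Variables (n : int) (f : ih_sp n).

(** The differential of f is d f - (-1)^n f d. *)
Definition ih_d_fun i m (e : n - 1 + i = m) (a : A i) : B m :=
  dgd (ih_deg3 m) (ihv f (ih_deg1 e) a)
    - (-1) ^ n *: ihv f (ih_deg2 e) (dg_d A i a).

Lemma ih_d_fun_lin i m (e : n - 1 + i = m) : linear (ih_d_fun e).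
Proof.
move=> c a a'; rewrite /ih_d_fun ihv_lin dgd_lin linearP ihv_lin.
rewrite scalerDr opprD addrACA scalerBr !scalerA; congr (_ - _ *: _ + _).
exact: mulrC.
Qed.

Definition ih_d : ih_sp (n - 1) := ih_mk ih_d_fun_lin.

Lemma ih_dE i m p (e : n - 1 + i = m) (e1 : n + i = p) (h : p - 1 = m)
    (e2 : n + (i - 1) = m) a :
  ihv ih_d e a = dgd h (ihv f e1 a) - (-1) ^ n *: ihv f e2 (dg_d A i a).
Proof.
rewrite ih_mkE /ih_d_fun (dgd_ihv f _ e1 _ h); congr (_ - _ *: _).
exact: ihv_irr.
Qed.

End Differential.

Lemma ih_d_lin n : linear (@ih_d n).
Proof.
move=> c f g; apply: ih_ext => i m e a.
rewrite ihv_comb !(ih_dE _ e (ih_deg1 e) (ih_deg3 m) (ih_deg2 e)) !ihv_comb.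
rewrite dgd_lin scalerDr opprD addrACA scalerBr !scalerA; congr (_ - _ *: _ + _).
exact: mulrC.
Qed.

Lemma ih_dd n (f : ih_sp n) : mk_lin (@ih_d_lin (n - 1)) (mk_lin (@ih_d_lin n) f) = 0.
Proof.
apply: ih_ext => i m e a.
have e1 : n - 1 + i = m + 1 by rewrite -e; ring.
have e2 : n - 1 + (i - 1) = m by rewrite -e; ring.
have e3 : n + (i - 1) = m + 1 by rewrite -e; ring.
have e5 : n + (i - 1 - 1) = m by rewrite -e; ring.
rewrite [LHS](ih_dE _ e e1 (ih_deg3 m) e2).
rewrite [X in _ - _ *: X](ih_dE _ e2 e3 (ih_deg3 m) e5) dg_dd.
rewrite [X in dgd _ X](ih_dE _ e1 (ih_deg1 e1) (ih_deg3 _) e3).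
rewrite (lin0 (ihv_lin f e5)) scaler0 subr0 (linB (dgd_lin _)) (linZ (dgd_lin _)).
by rewrite dgd_dgd sub0r sgB1 scaleNr opprK addNr.
Qed.

Definition ih : dgvect k := @DgVect k ih_sp (fun n => mk_lin (@ih_d_lin n)) ih_dd.

Lemma dg_d_ihE n (f : ih n) i m p (e : n - 1 + i = m) (e1 : n + i = p) (h : p - 1 = m)
    (e2 : n + (i - 1) = m) a :
  ihv (dg_d ih n f) e a = dgd h (ihv f e1 a) - (-1) ^ n *: ihv f e2 (dg_d A i a).
Proof. exact: ih_dE. Qed.

End Hom.

Section HomMap.
Variables (A B B' : dgvect k) (g : hom B B').

Lemma ih_map_fun_lin n (f : ih A B n) i m (e : n + i = m) :
  linear (fun a => dg_ap g (ihv f e a)).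
Proof. by move=> c a a'; rewrite ihv_lin dg_apP. Qed.

Definition ih_map_fun n (f : ih A B n) : ih A B' n := ih_mk (ih_map_fun_lin f).

Lemma ih_map_lin n : linear (@ih_map_fun n).
Proof. by move=> c f f'; apply: ih_ext => i m e a; rewrite ihv_comb !ih_mkE ihv_comb dg_apP. Qed.

Lemma ih_map_d n (f : ih A B n) :
  ih_map_fun (dg_d (ih A B) n f) = dg_d (ih A B') n (ih_map_fun f).
Proof.
apply: ih_ext => i m e a; rewrite [LHS]ih_mkE.
rewrite !(dg_d_ihE _ e (ih_deg1 e) (ih_deg3 m) (ih_deg2 e)).
by rewrite dg_apB dg_apZ dgd_ap.
Qed.

Definition ih_map : hom (ih A B) (ih A B') := mk_dg ih_map_lin ih_map_d.

Lemma ih_mapE n (f : ih A B n) i m (e : n + i = m) a :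
  ihv (dg_ap ih_map f) e a = dg_ap g (ihv f e a).
Proof. by []. Qed.

End HomMap.

Lemma ih_map_id A B : ih_map A (idm (B : dgVect k)) = idm _.
Proof. by apply: mor_ext => n f; apply: ih_ext => i m e a; rewrite ih_mapE. Qed.

Lemma ih_map_comp A B B' B'' (g : hom B' B'') (f : hom B B') :
  ih_map A (g \oc f) = ih_map A g \oc ih_map A f.
Proof. by apply: mor_ext => n h; apply: ih_ext => i m e a; rewrite !ih_mapE. Qed.

Definition ih_functor (A : dgVect k) : functor (dgM k) (dgM k) :=
  @Functor (dgM k) (dgM k) (ih A) (ih_map A) (ih_map_id A) (@ih_map_comp A).

Section Curry.
Variables A X Y : dgvect k.

Section Phi.
Variable F : hom (dg_tens X A) Y.

Lemma ih_curry_val_lin n (x : X n) i m (e : n + i = m) :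
  linear (fun a : A i => dg_ap F (dg_pure e x a)).
Proof. by move=> c a a'; rewrite dg_pureDr dg_pureZr dg_apP. Qed.

Definition ih_curry_val n (x : X n) : ih A Y n := ih_mk (ih_curry_val_lin x).

Lemma ih_curry_lin n : linear (@ih_curry_val n).
Proof.
move=> c x x'; apply: ih_ext => i m e a.
by rewrite ihv_comb !ih_mkE dg_pureDl dg_pureZl dg_apP.
Qed.

Lemma ih_curry_d n (x : X n) :
  ih_curry_val (dg_d X n x) = dg_d (ih A Y) n (ih_curry_val x).
Proof.
apply: ih_ext => i m e a; rewrite ih_mkE.
rewrite (dg_d_ihE _ e (ih_deg1 e) (ih_deg3 m) (ih_deg2 e)) !ih_mkE -dgd_ap.
by rewrite (dgd_pure _ _ _ _ e (ih_deg2 e)) dg_apD dg_apZ addrK.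
Qed.

Definition ih_curry : hom X (ih A Y) := mk_dg ih_curry_lin ih_curry_d.

Lemma ih_curryE n (x : X n) i m (e : n + i = m) a :
  ihv (dg_ap ih_curry x) e a = dg_ap F (dg_pure e x a).
Proof. by []. Qed.

End Phi.

Section Psi.
Variable G : hom X (ih A Y).

Lemma ih_uncurry_bil i j n (e : i + j = n) :
  is_bilinear (fun (x : X i) (a : A j) => ihv (dg_ap G x) e a).
Proof.
by apply: bilin_intro => [c x x' a|c x a a']; [rewrite dg_apP ihv_comb|exact: ihv_lin].
Qed.

Lemma ih_uncurry_d i j n (e : i + j = n) (x : X i) (a : A j) :
  dg_d Y n (ihv (dg_ap G x) e a) = ihv (dg_ap G (dg_d X i x)) (dg_degl e) a
    + (-1) ^ i *: ihv (dg_ap G x) (dg_degr e) (dg_d A j a).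
Proof.
rewrite dg_ap_d (dg_d_ihE _ _ e (erefl _) (dg_degr e)) dgdE; exact/esym/subrK.
Qed.

Definition ih_uncurry : hom (dg_tens X A) Y :=
  bimap_hom (@BiMap _ X A Y (fun i j n e x a => ihv (dg_ap G x) e a)
    ih_uncurry_bil ih_uncurry_d).

Lemma ih_uncurryE i j n (e : i + j = n) x a :
  dg_ap ih_uncurry (dg_pure e x a) = ihv (dg_ap G x) e a.
Proof. exact: bimap_homE. Qed.

End Psi.

Lemma ih_curryK F : ih_uncurry (ih_curry F) = F.
Proof. by apply: tens_mor_ext => i j n e x a; rewrite ih_uncurryE. Qed.

Lemma ih_uncurryK G : ih_curry (ih_uncurry G) = G.
Proof.
apply: mor_ext => n x; apply: ih_ext => i m e a.
by rewrite ih_curryE ih_uncurryE.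
Qed.

End Curry.

Lemma ih_curry_nat A X X' Y Y' (f : hom X' X) (g : hom Y Y') (h : hom (dg_tens X A) Y) :
  ih_curry (g \oc h \oc tens_map f (idm (A : dgVect k)))
    = ih_map A g \oc ih_curry h \oc f.
Proof.
apply: mor_ext => n x; apply: ih_ext => i m e a.
by rewrite !dg_ap_comp ih_mapE !ih_curryE !dg_ap_comp tens_mapE.
Qed.

Definition ih_adjunction (A : dgM k) : adjunction (tensr A) (ih_functor A) :=
  @Adjunction _ _ (tensr A) (ih_functor A) (@ih_curry A) (@ih_uncurry A)
    (@ih_curryK A) (@ih_uncurryK A) (@ih_curry_nat A).

Definition dg_closed : closed_structure (dgM k) :=
  fun A => RightAdjoint (ih_adjunction A).

End InternalHom.

(** * Subcomplexes, quotients, monomorphisms and epimorphisms *)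
Section Subcomplexes.
Variable k : fieldType.
Implicit Types U V W : dgvect k.
Local Notation hom := (@mor (dgVect k)).

Record subcomplex U := SubComplex {
  sc_mem :> forall n, U n -> Prop;
  sc_closed : forall n, subclosed (@sc_mem n);
  sc_d : forall n (x : U n), sc_mem x -> sc_mem (dg_d U n x) }.

Lemma sc0 U (S : subcomplex U) n : S n 0.
Proof. exact: (sc_closed S n).1. Qed.

Lemma scP U (S : subcomplex U) n a (x y : U n) : S n x -> S n y -> S n (a *: x + y).
Proof. exact: (sc_closed S n).2. Qed.

Section SubObject.
Variables (U : dgvect k) (S : subcomplex U).

Lemma sub_dg_dS n (x : subspace (sc_closed S n)) : S (n - 1) (dg_d U n (sub_val x)).
Proof. by apply: sc_d; exact: sub_prop. Qed.

Lemma sub_dg_d_lin n :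
  linear (fun x : subspace (sc_closed S n) => Subspace (sc_closed S (n - 1)) (sub_dg_dS x)).
Proof.
move=> a x y; apply: sub_ext; rewrite [RHS]sub_val_linear.
exact: etrans (congr1 (dg_d U n) (sub_val_linear a x y)) (linearP (dg_d U n) a _ _).
Qed.

Lemma sub_dg_dd n (x : subspace (sc_closed S n)) :
  mk_lin (@sub_dg_d_lin (n - 1)) (mk_lin (@sub_dg_d_lin n) x) = 0.
Proof. by apply: sub_ext; exact: dg_dd. Qed.

Definition sub_dg : dgvect k :=
  @DgVect k (fun n => subspace (sc_closed S n)) (fun n => mk_lin (@sub_dg_d_lin n))
    sub_dg_dd.

Definition sub_incl : hom sub_dg U :=
  @mk_dg k sub_dg U (fun n x => sub_val x)
    (fun n => @sub_val_linear _ _ _ (sc_closed S n)) (fun n x => erefl).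

Lemma sub_incl_inj n (x y : sub_dg n) : dg_ap sub_incl x = dg_ap sub_incl y -> x = y.
Proof. exact: sub_ext. Qed.

Lemma sub_inclS n (x : sub_dg n) : S n (dg_ap sub_incl x).
Proof. exact: sub_prop. Qed.

Lemma sub_incl_surj n (x : U n) : S n x -> exists y : sub_dg n, dg_ap sub_incl y = x.
Proof. by move=> Sx; exists (Subspace (sc_closed S n) Sx). Qed.

End SubObject.

Lemma mono_lift U V W (m : hom U V) (f : hom W V) :
  (forall n (x : U n), dg_ap m x = 0 -> x = 0) ->
  (forall n (w : W n), exists x : U n, dg_ap m x = dg_ap f w) ->
  exists u : hom W U, m \oc u = f.
Proof.
move=> mi fm.
have {}mi n (x y : U n) : dg_ap m x = dg_ap m y -> x = y.
  by move=> e; apply/eqP; rewrite -subr_eq0; apply/eqP/mi; rewrite dg_apB e subrr.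
pose u n (w : W n) : U n := projT1 (cid (fm n w)).
have uE n w : dg_ap m (u n w) = dg_ap f w by rewrite /u; case: cid.
have ul n : linear (u n) by move=> a x y; apply: mi; rewrite dg_apP !uE dg_apP.
have ud n x : u (n - 1) (dg_d W n x) = dg_d U n (u n x).
  by apply: mi; rewrite uE !dg_ap_d uE.
by exists (@mk_dg k W U u ul ud); apply: mor_ext => n x; exact: uE.
Qed.

Lemma epi_desc U V W (e : hom U V) (f : hom U W) :
  (forall n (y : V n), exists x : U n, dg_ap e x = y) ->
  (forall n (x : U n), dg_ap e x = 0 -> dg_ap f x = 0) ->
  exists u : hom V W, u \oc e = f.
Proof.
move=> es ef.
have {}ef n (x y : U n) : dg_ap e x = dg_ap e y -> dg_ap f x = dg_ap f y.
  by move=> E; apply/eqP; rewrite -subr_eq0 -dg_apB; apply/eqP/ef; rewrite dg_apB E subrr.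
pose s n (y : V n) : U n := projT1 (cid (es n y)).
have sE n y : dg_ap e (s n y) = y by rewrite /s; case: cid.
pose u n (y : V n) := dg_ap f (s n y).
have ul n : linear (u n).
  by move=> a x y; rewrite /u -dg_apP; apply: ef; rewrite dg_apP !sE.
have ud n x : u (n - 1) (dg_d V n x) = dg_d W n (u n x).
  by rewrite /u -dg_ap_d; apply: ef; rewrite dg_ap_d !sE.
exists (@mk_dg k V W u ul ud); apply: mor_ext => n x.
by rewrite dg_ap_comp; apply: ef; exact: sE.
Qed.

Section KernelImage.
Variables (U V : dgvect k) (f : hom U V).

Program Definition ker_sc : subcomplex U :=
  @SubComplex U (fun n x => dg_ap f x = 0) _ _.
Next Obligation.
split=> [|a x y fx fy]; first exact: dg_ap0.
by rewrite dg_apP fx fy scaler0 addr0.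
Qed.
Next Obligation. by rewrite dg_ap_d H linear0. Qed.

Program Definition im_sc : subcomplex V :=
  @SubComplex V (fun n y => exists x, dg_ap f x = y) _ _.
Next Obligation.
split=> [|a _ _ [x <-] [y <-]]; first by exists 0; exact: dg_ap0.
by exists (a *: x + y); exact: dg_apP.
Qed.
Next Obligation. by exists (dg_d U n H); exact: dg_ap_d. Qed.

End KernelImage.

Definition zero_mor U V : hom U V :=
  @mk_dg k U V (fun n x => 0) (fun n a x y => esym (etrans (addr0 _) (scaler0 _ a)))
    (fun n x => esym (linear0 _)).

(** The inclusion of the kernel and the zero map have the same composite
    with f. *)
Lemma mono_inj U V (f : hom U V) :
  mono f -> forall n (x : U n), dg_ap f x = 0 -> x = 0.
Proof.
move=> fm n x fx.
have [|z <-] := @sub_incl_surj _ (ker_sc f) n x; first exact: fx.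
suff -> : sub_incl (ker_sc f) = zero_mor _ _ by [].
apply: fm; apply: mor_ext => m y.
by rewrite !dg_ap_comp dg_ap0 (sub_inclS y).
Qed.

Lemma inj_mono U V (f : hom U V) :
  (forall n (x : U n), dg_ap f x = 0 -> x = 0) -> mono f.
Proof.
move=> fi T g h e; apply: mor_ext => n x; apply/eqP; rewrite -subr_eq0; apply/eqP/fi.
by rewrite dg_apB -!dg_ap_comp e subrr.
Qed.

Section Quotient.
Variables (U : dgvect k) (S : subcomplex U).

(** The quotient by S identifies the elements that no functional vanishing on S
    tells apart; by separation these are the elements congruent modulo S. *)
Definition quot_itp n : interpretations k (U n) :=
  @Interpretations k (U n) 0 (fun x y => x + y) (fun a x => a *: x)
    {f : {linear U n -> k^o} | forall x, S n x -> f x = 0} (fun _ => k^o)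
    (fun f x => sval f x) (fun f => linear0 (sval f)) (fun f x y => linearD (sval f) x y)
    (fun f a x => linearZ_LR (sval f) a x).

Lemma quot_eqP n (x y : U n) :
  (forall m, itp_eval (quot_itp n) m x = itp_eval (quot_itp n) m y) <-> S n (x - y).
Proof.
split=> [e|Sxy [f fS] /=]; last first.
  by apply/eqP; rewrite -subr_eq0 -linearB; apply/eqP; exact: fS.
apply: contrapT => /(separation (sc_closed S n)) [f [fS f1]].
have /= := e (exist _ f fS) => fe.
by move: f1; rewrite linearB fe subrr => /esym/eqP; rewrite oner_eq0.
Qed.

Lemma quot_d_compat n x y :
  (forall m, itp_eval (quot_itp n) m x = itp_eval (quot_itp n) m y) ->
  forall m, itp_eval (quot_itp (n - 1)) m (dg_d U n x)
    = itp_eval (quot_itp (n - 1)) m (dg_d U n y).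
Proof. by move=> /quot_eqP Sxy; apply/quot_eqP; rewrite -linearB; exact: sc_d. Qed.

Definition quot_d n : {linear model_quotient (quot_itp n) -> model_quotient (quot_itp (n - 1))}.
apply: (mk_lin (f := mq_map (P := quot_itp n) (quot_itp (n - 1)) (dg_d U n))).
apply: mq_map_linear => [x y|x y [f fS]|a x [f fS]] /=; first exact: quot_d_compat.
- by rewrite !linearD.
- by rewrite !linearZ_LR.
Defined.

Lemma quot_dE n x : quot_d n (mq_cls (quot_itp n) x) = mq_cls (quot_itp (n - 1)) (dg_d U n x).
Proof. by apply: mq_map_cls => *; exact: quot_d_compat. Qed.

Lemma quot_dd n x : quot_d (n - 1) (quot_d n x) = 0.
Proof. by have [y ->] := mq_surj x; rewrite !quot_dE dg_dd. Qed.

Definition quot_dg : dgvect k := DgVect quot_dd.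

Lemma quot_proj_lin n : linear (mq_cls (quot_itp n)).
Proof. by move=> a x y; rewrite -mq_clsZ -mq_clsD. Qed.

Definition quot_proj : hom U quot_dg :=
  @mk_dg k U quot_dg (fun n => mq_cls (quot_itp n)) quot_proj_lin
    (fun n x => esym (quot_dE x)).

Lemma quot_proj_surj n (y : quot_dg n) : exists x, dg_ap quot_proj x = y.
Proof. by have [x ->] := mq_surj y; exists x. Qed.

Lemma quot_proj_ker n (x : U n) : dg_ap quot_proj x = 0 <-> S n x.
Proof.
have -> : (dg_ap quot_proj x = 0) = (mq_cls (quot_itp n) x = mq_cls (quot_itp n) 0) by [].
by rewrite mq_clsP quot_eqP subr0.
Qed.

End Quotient.

(** The projection to the cokernel and the zero map have the same composite
    with f. *)
Lemma epi_surj U V (f : hom U V) :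
  epi f -> forall n (y : V n), exists x : U n, dg_ap f x = y.
Proof.
move=> fe n y; apply/(@quot_proj_ker _ (im_sc f)).
suff -> : quot_proj (im_sc f) = zero_mor _ _ by [].
apply: fe; apply: mor_ext => m x; rewrite !dg_ap_comp.
by apply/quot_proj_ker; exists x.
Qed.

Lemma surj_epi U V (f : hom U V) :
  (forall n (y : V n), exists x : U n, dg_ap f x = y) -> epi f.
Proof.
move=> fs T g h e; apply: mor_ext => n y; have [x <-] := fs n y.
by rewrite -!dg_ap_comp e.
Qed.

Lemma bij_iso U V (f : hom U V) : mono f -> epi f -> iso f.
Proof.
move=> fm fe; have [|u fu] := mono_lift (f := idm (V : dgVect k)) (mono_inj fm).
  by move=> n y; have [x fx] := epi_surj fe y; exists x.
exists u; split=> //; apply: fm.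
by rewrite compmA fu comp1m compm1.
Qed.

Lemma iso_mono (C : category) (A B : C) (f : mor A B) : iso f -> mono f.
Proof. by move=> [g [gf _]] T h h' e; rewrite -[h]comp1m -[h']comp1m -gf -!compmA e. Qed.

Lemma comp_mono (C : category) (A B D : C) (g : mor B D) (f : mor A B) :
  mono g -> mono f -> mono (g \oc f).
Proof. by move=> gm fm T h h' e; apply: fm; apply: gm; rewrite !compmA. Qed.

Lemma mono_cancel (C : category) (A B D : C) (g : mor B D) (f : mor A B) :
  mono (g \oc f) -> mono f.
Proof. by move=> gfm T h h' e; apply: gfm; rewrite -!compmA e. Qed.

Lemma epi_cancel (C : category) (A B D : C) (g : mor B D) (f : mor A B) :
  epi (g \oc f) -> epi g.
Proof. by move=> gfm T h h' e; apply: gfm; rewrite !compmA e. Qed.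

(** If f = g e is mono then so is e; as bijective maps of complexes are
    isomorphisms, e is invertible as soon as it is epi. *)
Lemma all_mono_extremal U V (f : hom U V) : mono f -> extremal_mono (f : @mor (dgVect k) U V).
Proof.
move=> fm; split=> // D e g fE ee; apply: bij_iso => //.
by apply: (@mono_cancel _ _ _ _ g); rewrite -fE.
Qed.

Lemma all_epi_extremal U V (f : hom U V) : epi f -> extremal_epi (f : @mor (dgVect k) U V).
Proof.
move=> fe; split=> // D e g fE ee; apply: bij_iso => //.
by apply: (@epi_cancel _ _ _ _ _ e); rewrite -fE.
Qed.

Lemma epi_mono_factorization U V (f : hom U V) :
  exists (D : dgVect k) (e : hom U D) (m : hom D V), [/\ f = m \oc e, epi e & mono m].
Proof.
have mi : mono (sub_incl (im_sc f)).
  by apply: inj_mono => n x x0; apply: sub_incl_inj; rewrite dg_ap0.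
have [|e fE] := mono_lift (f := f) (mono_inj mi).
  by move=> n x; apply: sub_incl_surj; exists x.
exists (sub_dg (im_sc f) : dgVect k), e, (sub_incl (im_sc f)); split=> //.
apply: surj_epi => n y; have [x fx] := sub_inclS y; exists x.
by apply: sub_incl_inj; rewrite -dg_ap_comp fE.
Qed.

Lemma epi_mono_diagonal A B X Y (e : hom A B) (m : hom X Y) (f : hom A X) (g : hom B Y) :
  epi e -> mono m -> g \oc e = m \oc f ->
  exists! d : hom B X, d \oc e = f /\ m \oc d = g.
Proof.
move=> ee mm E; have [|d dE] := mono_lift (f := g) (mono_inj mm).
  move=> n b; have [a <-] := epi_surj ee b.
  by exists (dg_ap f a); rewrite -!dg_ap_comp E.
exists d; split=> [|d' [_ d'E]]; last by apply: mm; rewrite dE d'E.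
by split=> //; apply: mm; rewrite compmA dE E.
Qed.

End Subcomplexes.

(** * Limits and colimits *)
Section LimitsColimits.
Variable k : fieldType.
Local Notation hom := (@mor (dgVect k)).

Section Product.
Variables (I : small) (X : I -> dgvect k).

Definition pi_dg_d n (x : pi_space (fun i => X i n)) : pi_space (fun i => X i (n - 1)) :=
  PiSpace (fun i => dg_d (X i) n (x i)).

Lemma pi_dg_d_lin n : linear (@pi_dg_d n).
Proof. by move=> a x y; apply: pi_ext => i; exact: linearP. Qed.

Lemma pi_dg_dd n x : mk_lin (@pi_dg_d_lin (n - 1)) (mk_lin (@pi_dg_d_lin n) x) = 0.
Proof. by apply: pi_ext => i; exact: dg_dd. Qed.

Definition pi_dg : dgvect k :=
  @DgVect k (fun n => pi_space (fun i => X i n)) (fun n => mk_lin (@pi_dg_d_lin n)) pi_dg_dd.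

Definition pi_proj i : hom pi_dg (X i) :=
  @mk_dg k pi_dg (X i) (fun n x => x i) (fun n a x y => erefl) (fun n x => erefl).

Lemma pi_dg_ext n (x y : pi_dg n) :
  (forall i, dg_ap (pi_proj i) x = dg_ap (pi_proj i) y) -> x = y.
Proof. exact: pi_ext. Qed.

Definition pi_pair (T : dgvect k) (q : forall i, hom T (X i)) : hom T pi_dg.
apply: (@mk_dg k T pi_dg (fun n t => PiSpace (fun i => dg_ap (q i) t))).
- by move=> n a x y; apply: pi_dg_ext => i; exact: dg_apP.
- by move=> n x; apply: pi_dg_ext => i; exact: dg_ap_d.
Defined.

Lemma pi_pairE T (q : forall i, hom T (X i)) i : pi_proj i \oc pi_pair q = q i.
Proof. exact: mor_ext. Qed.

End Product.

(** Diagrams are indexed by a graph, so that the same statements serve covariant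
    and contravariant functors. *)
Section Diagram.
Variables (I : small) (X : I -> dgvect k) (E : I -> I -> Type).
Variable f : forall i j, E i j -> hom (X i) (X j).

Lemma dg_limit : exists (L : dgvect k) (p : forall i, hom L (X i)),
  (forall i j (u : E i j), f u \oc p i = p j) /\
  forall T (q : forall i, hom T (X i)), (forall i j (u : E i j), f u \oc q i = q j) ->
    exists! h : hom T L, forall i, p i \oc h = q i.
Proof.
pose mem n (x : pi_dg X n) := forall i j (u : E i j),
  dg_ap (f u) (dg_ap (pi_proj X i) x) = dg_ap (pi_proj X j) x.
have [S SE] : exists S : subcomplex (pi_dg X), forall n x, S n x <-> mem n x.
  have c n : subclosed (mem n).
    split=> [i j u|a x y xP yP i j u]; first by rewrite !dg_ap0.
    by rewrite !dg_apP xP yP.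
  have d n x : mem n x -> mem (n - 1) (dg_d (pi_dg X) n x).
    by move=> xP i j u; rewrite !dg_ap_d xP.
  by exists (SubComplex c d).
pose m := sub_incl S.
have mi n (x : sub_dg S n) : dg_ap m x = 0 -> x = 0.
  by move=> x0; apply: sub_incl_inj; rewrite dg_ap0.
exists (sub_dg S), (fun i => pi_proj X i \oc m); split.
  by move=> i j u; apply: mor_ext => n x; have /SE xP := sub_inclS x; exact: xP.
move=> T q qP; have [|h hE] := mono_lift (f := pi_pair q) mi.
  move=> n t; apply: sub_incl_surj; apply/SE => i j u.
  by rewrite -!(dg_ap_comp (pi_proj _ _)) !pi_pairE -(qP _ _ u).
exists h; split=> [i|h' h'P]; first by rewrite -compmA hE pi_pairE.
apply: (inj_mono mi); rewrite hE; apply: mor_ext => n t.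
by apply: pi_dg_ext => i; rewrite -!(dg_ap_comp (pi_proj _ _)) compmA h'P pi_pairE.
Qed.

End Diagram.

(** The graded form of formal expressions modulo evaluations: expressions carry
    a formal differential, and the evaluations are in complexes. *)
Record dg_terms := DgTerms {
  dt_car : int -> small;
  dt_zero : forall n, dt_car n;
  dt_add : forall n, dt_car n -> dt_car n -> dt_car n;
  dt_scale : forall n, k -> dt_car n -> dt_car n;
  dt_d : forall n, dt_car n -> dt_car (n - 1);
  dt_model : Type;
  dt_space : dt_model -> dgvect k;
  dt_eval : forall m n, dt_car n -> dt_space m n;
  dt_eval0 : forall m n, dt_eval m (dt_zero n) = 0;
  dt_evalD : forall m n (x y : dt_car n),
    dt_eval m (dt_add x y) = dt_eval m x + dt_eval m y;
  dt_evalZ : forall m n a (x : dt_car n), dt_eval m (dt_scale a x) = a *: dt_eval m x;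
  dt_evald : forall m n (x : dt_car n),
    dt_eval m (dt_d x) = dg_d (dt_space m) n (dt_eval m x) }.

Section TermQuotient.
Variable P : dg_terms.

Definition dt_itp n : interpretations k (dt_car P n) :=
  @Interpretations k (dt_car P n) (dt_zero P n) (@dt_add P n) (@dt_scale P n)
    (dt_model P) (fun m => dt_space m n) (fun m => @dt_eval P m n)
    (fun m => dt_eval0 m n) (fun m => @dt_evalD P m n) (fun m => @dt_evalZ P m n).

Lemma tq_d_compat n x y :
  (forall m, itp_eval (dt_itp n) m x = itp_eval (dt_itp n) m y) ->
  forall m, itp_eval (dt_itp (n - 1)) m (dt_d x) = itp_eval (dt_itp (n - 1)) m (dt_d y).
Proof. by move=> e m /=; rewrite !dt_evald; congr (dg_d _ _ _); exact: e. Qed.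

Lemma tq_d_lin n : linear (mq_map (P := dt_itp n) (dt_itp (n - 1)) (@dt_d P n)).
Proof.
apply: mq_map_linear => [x y|x y m|a x m] /=; first exact: tq_d_compat.
- by rewrite !dt_evald dt_evalD linearD.
- by rewrite !dt_evald dt_evalZ linearZ.
Qed.

Lemma tq_dE n x :
  mk_lin (@tq_d_lin n) (mq_cls (dt_itp n) x) = mq_cls (dt_itp (n - 1)) (dt_d x).
Proof. by apply: mq_map_cls => *; exact: tq_d_compat. Qed.

Lemma tq_dd n x : mk_lin (@tq_d_lin (n - 1)) (mk_lin (@tq_d_lin n) x) = 0.
Proof.
have [y ->] := mq_surj x; rewrite !tq_dE; apply/mq_clsP => m /=.
by rewrite !dt_evald dg_dd dt_eval0.
Qed.

Definition tq_dg : dgvect k :=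
  @DgVect k (fun n => model_quotient (dt_itp n)) (fun n => mk_lin (@tq_d_lin n)) tq_dd.

Definition tq_cls n (x : dt_car P n) : tq_dg n := mq_cls (dt_itp n) x.

Lemma tq_surj n (y : tq_dg n) : exists x, y = tq_cls x.
Proof. exact: mq_surj. Qed.

Lemma tq_clsP n (x y : dt_car P n) :
  tq_cls x = tq_cls y <-> forall m, dt_eval m x = dt_eval m y.
Proof. exact: mq_clsP. Qed.

Lemma tq_eval_d m n (x : tq_dg n) :
  mq_eval (P := dt_itp (n - 1)) m (dg_d tq_dg n x) = dg_d (dt_space m) n (mq_eval (P := dt_itp n) m x).
Proof.
have [y ->] := mq_surj x; rewrite [dg_d _ _ _]tq_dE.
by rewrite !mq_eval_cls /= dt_evald.
Qed.

Definition tq_eval (m : dt_model P) : hom tq_dg (dt_space m) :=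
  @mk_dg k tq_dg (dt_space m) (fun n => mq_eval (P := dt_itp n) m)
    (fun n => mq_eval_linear (P := dt_itp n) m) (@tq_eval_d m).

Lemma tq_evalE m n (x : dt_car P n) : dg_ap (tq_eval m) (tq_cls x) = dt_eval m x.
Proof. exact: (@mq_eval_cls _ _ (dt_itp n)). Qed.

Lemma tq_ext n (x y : tq_dg n) :
  (forall m, dg_ap (tq_eval m) x = dg_ap (tq_eval m) y) -> x = y.
Proof.
by have [x' ->] := tq_surj x; have [y' ->] := tq_surj y => e; apply/tq_clsP => m;
  rewrite -!tq_evalE.
Qed.

Lemma tq_cls0 n : tq_cls (dt_zero P n) = 0.
Proof. by []. Qed.
Lemma tq_clsD n (x y : dt_car P n) : tq_cls (dt_add x y) = tq_cls x + tq_cls y.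
Proof. exact: mq_clsD. Qed.
Lemma tq_clsZ n a (x : dt_car P n) : tq_cls (dt_scale a x) = a *: tq_cls x.
Proof. exact: mq_clsZ. Qed.
Lemma tq_clsd n (x : dt_car P n) : tq_cls (dt_d x) = dg_d tq_dg n (tq_cls x).
Proof. exact/esym/tq_dE. Qed.

End TermQuotient.

Section Colimit.
Variables (I : small) (X : I -> dgvect k) (E : I -> I -> Type).
Variable f : forall i j, E i j -> hom (X i) (X j).

Inductive cterm (n : int) : small :=
| ct_zero
| ct_add of cterm n & cterm n
| ct_scale of k & cterm n
| ct_in i of X i n.

Fixpoint ct_d n (t : cterm n) : cterm (n - 1) :=
  match t with
  | ct_zero => ct_zero _
  | ct_add s t => ct_add (ct_d s) (ct_d t)
  | ct_scale a t => ct_scale a (ct_d t)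
  | ct_in i x => ct_in (dg_d (X i) n x)
  end.

Record cocone := Cocone {
  cc_ob : dgvect k;
  cc_in : forall i, hom (X i) cc_ob;
  cc_comm : forall i j (u : E i j), cc_in j \oc f u = cc_in i }.

Fixpoint ct_eval (c : cocone) n (t : cterm n) : cc_ob c n :=
  match t with
  | ct_zero => 0
  | ct_add s t => ct_eval c s + ct_eval c t
  | ct_scale a t => a *: ct_eval c t
  | ct_in i x => dg_ap (cc_in c i) x
  end.

Lemma ct_eval_d c n (t : cterm n) : ct_eval c (ct_d t) = dg_d (cc_ob c) n (ct_eval c t).
Proof.
elim: t => [|s IHs t IHt|a t IH|i x] /=.
- by rewrite linear0.
- by rewrite IHs IHt linearD.
- by rewrite IH linearZ.
- exact: dg_ap_d.
Qed.

Definition colim_terms : dg_terms :=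
  @DgTerms cterm ct_zero ct_add ct_scale ct_d cocone cc_ob ct_eval
    (fun c n => erefl) (fun c n x y => erefl) (fun c n a x => erefl) ct_eval_d.

(** The colimit consists of the formal sums of elements of the X i, two of them
    being identified when they agree in every cocone; its universal property is
    then the evaluation in a cocone. *)
Lemma dg_colimit : exists (L : dgvect k) (p : forall i, hom (X i) L),
  (forall i j (u : E i j), p j \oc f u = p i) /\
  forall T (q : forall i, hom (X i) T), (forall i j (u : E i j), q j \oc f u = q i) ->
    exists! h : hom L T, forall i, h \oc p i = q i.
Proof.
pose P := colim_terms; pose L := tq_dg P.
have p_lin i n : linear (fun x : X i n => tq_cls (P := P) (ct_in x)).
  by move=> a x y; rewrite -tq_clsZ -tq_clsD; apply/tq_clsP => c; exact: dg_apP.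
have p_d i n (x : X i n) :
    tq_cls (P := P) (ct_in (dg_d (X i) n x)) = dg_d L n (tq_cls (P := P) (ct_in x)).
  by rewrite -tq_clsd.
pose p i : hom (X i) L := @mk_dg k (X i) L (fun n x => tq_cls (P := P) (ct_in x))
  (p_lin i) (p_d i).
exists L, p; split.
  move=> i j u; apply: mor_ext => n x; apply/tq_clsP => c /=.
  by rewrite -dg_ap_comp cc_comm.
move=> T q qP; pose c := Cocone qP; exists (tq_eval (P := P) c); split.
  by move=> i; apply: mor_ext => n x; exact: (tq_evalE (P := P) c).
move=> h hP; apply: mor_ext => n y; have [t ->] := tq_surj y.
rewrite [LHS](tq_evalE (P := P) c) /=; elim: t => [|s IHs t IHt|a t IH|i x] /=.
- by rewrite (tq_cls0 P) dg_ap0.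
- by rewrite (tq_clsD (P := P)) dg_apD -IHs -IHt.
- by rewrite (tq_clsZ (P := P)) dg_apZ -IH.
- by rewrite -(hP i).
Qed.

End Colimit.
End LimitsColimits.

(** * Exactness of the tensor product *)
Section Slices.
Variable k : fieldType.
Implicit Types N A B : dgvect k.
Local Notation hom := (@mor (dgVect k)).

Lemma ds_expand (W : int -> lmodType k) (x : direct_sum W) :
  x = \sum_(i <- ds_supp x) ds_inj (x i).
Proof.
have E : ds_lift (fun i => @ds_inj k W i) x = x.
  have l := ds_lift_linear (@ds_inj_linear k W).
  elim/ds_gen: x => [|i w|x y xE yE]; first exact: (lin0 l).
  - exact: (ds_lift_inj (@ds_inj_linear k W)).
  - by rewrite (linD l) xE yE.
by rewrite -[LHS]E.
Qed.

Definition dslice N A n i (f : {linear N i -> k^o}) (x : dg_tens N A n) : A (n - i) :=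
  tslice f ((x : direct_sum (dg_tens_comp N A n)) i).

Lemma dslice_lin N A n i (f : {linear N i -> k^o}) : linear (@dslice N A n i f).
Proof.
by move=> a x y; rewrite /dslice ds_addE ds_scaleE; exact: tslice_linear.
Qed.

Lemma ds_inj_pure N A n i (u : N i) (v : A (n - i)) :
  ds_inj (W := dg_tens_comp N A n) (tpure u v) = dg_pure (dg_deg_sub n i) u v.
Proof. by rewrite /dg_pure eq_axiomK. Qed.

Lemma dslice_pure N A n i (f : {linear N i -> k^o}) l j (e : l + j = n)
    (u : N l) (a : A j) :
  dslice f (dg_pure e u a) = f (ds_fun u i) *: ds_fun a (n - i).
Proof.
rewrite /dslice /dg_pure /=; have je := dg_pure_deg e; subst j.
rewrite eq_axiomK /=; have [li|li] := eqVneq l i.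
  by subst l; rewrite !ds_funii tslice_pure.
by rewrite (ds_fun_neq u li) (ds_fun_neq _ li) linear0 scale0r (lin0 (tslice_linear f)).
Qed.

(** Expanding each component of x by slices writes x as a sum of terms of the form
    u (x) a, where a is a slice of x. *)
Lemma slice_elim N A n (x : dg_tens N A n) (P : dg_tens N A n -> Prop) :
  P 0 -> (forall y z, P y -> P z -> P (y + z)) ->
  (forall i (u : N i) (f : {linear N i -> k^o}),
     P (dg_pure (dg_deg_sub n i) u (dslice f x))) -> P x.
Proof.
move=> P0 PD Px.
have PS (I : eqType) (r : seq I) (F : I -> dg_tens N A n) :
    (forall i, P (F i)) -> P (\sum_(i <- r) F i).
  by move=> PF; elim/big_ind: _.
rewrite [x]ds_expand; apply: PS => i.
have [s ->] := tensor_slice_expansion ((x : direct_sum (dg_tens_comp N A n)) i).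
rewrite (lin_sum (@ds_inj_linear k (dg_tens_comp N A n) i)).
elim/big_ind: _ => // p _.
by have := Px i p.2 p.1; rewrite -ds_inj_pure.
Qed.

Lemma slice_eq0 N A n (x : dg_tens N A n) :
  (forall i (f : {linear N i -> k^o}), dslice f x = 0) -> x = 0.
Proof.
move=> x0; apply: (slice_elim (P := fun y => y = 0)) => // [y z -> ->|i u f].
  exact: addr0.
by rewrite x0 dg_pure0r.
Qed.

Lemma dslice_map N A B (g : hom A B) n i (f : {linear N i -> k^o}) (x : dg_tens N A n) :
  dslice f (dg_ap (tens_map (idm (N : dgVect k)) g) x) = dg_ap g (dslice f x).
Proof.
apply: (tens_ext (f := fun x => dslice f (dg_ap _ x)) (g := fun x => dg_ap g (dslice f x))).
- by move=> a y z; rewrite dg_apP dslice_lin.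
- by move=> a y z; rewrite dslice_lin dg_apP.
by move=> l j e u v; rewrite tens_mapE !dslice_pure dg_apZ ds_fun_ap.
Qed.

Lemma tens_image N A B (g : hom B A) n (x : dg_tens N A n) :
  (forall i (f : {linear N i -> k^o}), exists b, dg_ap g b = dslice f x) ->
  exists y, dg_ap (tens_map (idm (N : dgVect k)) g) y = x.
Proof.
move=> gx; apply: (slice_elim (P := fun z => exists y, dg_ap _ y = z)).
- by exists 0; exact: dg_ap0.
- by move=> y z [y' <-] [z' <-]; exists (y' + z'); exact: dg_apD.
- move=> i u f; have [b <-] := gx i f.
  by exists (dg_pure (dg_deg_sub n i) u b); rewrite tens_mapE.
Qed.

Lemma mono_tensl N A B (g : hom A B) :
  mono g -> mono (tens_map (idm (N : dgVect k)) g).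
Proof.
move=> /mono_inj gi; apply: inj_mono => n x x0; apply: slice_eq0 => i f.
by apply: gi; rewrite -dslice_map x0 (lin0 (dslice_lin f)).
Qed.

Lemma swap_iso A B : iso (swap A B).
Proof. by exists (swap B A); rewrite !swapK. Qed.

Lemma tens_map_swap A A' B B' (f : hom A A') (g : hom B B') :
  tens_map f g = swap B' A' \oc tens_map g f \oc swap A B.
Proof. by rewrite -compmA -swap_nat compmA swapK comp1m. Qed.

Lemma mono_tensr N A B (g : hom A B) :
  mono g -> mono (tens_map g (idm (N : dgVect k))).
Proof.
move=> gm; rewrite tens_map_swap; apply: comp_mono; last exact/iso_mono/swap_iso.
by apply: comp_mono; [exact/iso_mono/swap_iso|exact: mono_tensl].
Qed.

Lemma mono_tens A A' B B' (f : hom A A') (g : hom B B') :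
  mono f -> mono g -> mono (tens_map f g).
Proof.
move=> fm gm; rewrite -[f]compm1 -[g]comp1m tens_mapM.
by apply: comp_mono; [exact: mono_tensr|exact: mono_tensl].
Qed.

Lemma epi_tens A A' B B' (f : hom A A') (g : hom B B') :
  epi f -> epi g -> epi (tens_map f g).
Proof.
move=> /epi_surj fs /epi_surj gs; apply: surj_epi => n y.
elim/dg_tens_gen: y => [|i j e u v|y z [y' <-] [z' <-]].
- by exists 0; exact: dg_ap0.
- have [u' <-] := fs _ u; have [v' <-] := gs _ v.
  by exists (dg_pure e u' v'); rewrite tens_mapE.
- by exists (y' + z'); exact: dg_apD.
Qed.

Lemma pullback_mono A B D P (f : hom A D) (m : hom B D) (p : hom P A) (q : hom P B) :
  mono m -> is_pullback (C := dgVect k) f m p q -> mono p.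
Proof.
move=> mm [fp H] T g h e; have [|u [_ uu]] := H T (p \oc g) (q \oc g).
  by rewrite !compmA fp.
rewrite -(uu g) // (uu h) //.
by split=> //; apply: mm; rewrite !compmA -!fp -!compmA e.
Qed.

(** The universal property is applied to the subcomplex of all the elements that
    the lemma is about, included in A. The next lemmas argue in the same way. *)
Lemma pullback_elt A B D P (f : hom A D) (m : hom B D) (p : hom P A) (q : hom P B) :
  mono m -> is_pullback (C := dgVect k) f m p q ->
  forall n (a : A n) (b : B n), dg_ap f a = dg_ap m b -> exists x, dg_ap p x = a.
Proof.
move=> mm [fp H] n a b fa.
pose mem n (a : A n) := exists b, dg_ap m b = dg_ap f a.
have c l : subclosed (@mem l).
  split=> [|d x y [x' xE] [y' yE]]; first by exists 0; rewrite !dg_ap0.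
  by exists (d *: x' + y'); rewrite !dg_apP xE yE.
have d l x : @mem l x -> mem (l - 1) (dg_d A l x).
  by move=> [b' bE]; exists (dg_d B l b'); rewrite !dg_ap_d bE.
pose S := SubComplex c d.
have [|t tE] := mono_lift (f := f \oc sub_incl S) (mono_inj mm).
  by move=> l x; exact: (sub_inclS x).
have [u [[uE _] _]] := H _ (sub_incl S) t (esym tE).
have [|y <-] := @sub_incl_surj _ _ S n a; first by exists b.
by exists (dg_ap u y); rewrite -dg_ap_comp uE.
Qed.

Lemma equalizer_mono A B E (f g : hom A B) (e : hom E A) :
  is_equalizer (C := dgVect k) f g e -> mono e.
Proof.
move=> [fg H] T h h' E'; have [|u [_ uu]] := H T (e \oc h).
  by rewrite !compmA fg.
by rewrite -(uu h) // (uu h').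
Qed.

Lemma equalizer_elt A B E (f g : hom A B) (e : hom E A) :
  is_equalizer (C := dgVect k) f g e ->
  forall n (a : A n), dg_ap f a = dg_ap g a -> exists x, dg_ap e x = a.
Proof.
move=> [fg H] n a fga.
pose mem n (a : A n) := dg_ap f a = dg_ap g a.
have c l : subclosed (@mem l).
  split=> [|d x y xE yE]; first by rewrite /mem !dg_ap0.
  by rewrite /mem !dg_apP xE yE.
have d l x : @mem l x -> mem (l - 1) (dg_d A l x).
  by rewrite /mem => xE; rewrite !dg_ap_d xE.
pose S := SubComplex c d.
have [|u [uE _]] := H _ (sub_incl S).
  by apply: mor_ext => l x; exact: (sub_inclS x).
have [|y <-] := @sub_incl_surj _ _ S n a; first exact: fga.
by exists (dg_ap u y); rewrite -dg_ap_comp uE.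
Qed.

Lemma intersection_mono A (L : Type) (S : L -> dgvect k) (m : forall l, hom (S l) A)
    D (d : hom D A) (p : forall l, hom D (S l)) : (forall l, mono (m l)) ->
  is_intersection (C := dgVect k) m d p -> mono d.
Proof.
move=> mm [pd H] T g h e; have [|u [_ uu]] := H T (d \oc g) (fun l => p l \oc g).
  by move=> l; rewrite compmA pd.
rewrite -(uu g) // (uu h) //; split=> // l.
by apply: (mm l); rewrite !compmA !pd.
Qed.

Lemma intersection_elt A (L : Type) (S : L -> dgvect k) (m : forall l, hom (S l) A)
    D (d : hom D A) (p : forall l, hom D (S l)) : (forall l, mono (m l)) ->
  is_intersection (C := dgVect k) m d p ->
  forall n (a : A n), (forall l, exists b, dg_ap (m l) b = a) -> exists x, dg_ap d x = a.
Proof.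
move=> mm [pd H] n a ma.
pose mem n (a : A n) := forall l, exists b, dg_ap (m l) b = a.
have c r : subclosed (@mem r).
  split=> [l|e x y xE yE l]; first by exists 0; rewrite dg_ap0.
  have [x' <-] := xE l; have [y' <-] := yE l.
  by exists (e *: x' + y'); rewrite dg_apP.
have dd r x : @mem r x -> mem (r - 1) (dg_d A r x).
  by move=> xE l; have [b <-] := xE l; exists (dg_d (S l) r b); rewrite dg_ap_d.
pose Q := SubComplex c dd.
have qE l : exists q : hom (sub_dg Q) (S l), m l \oc q = sub_incl Q.
  apply: mono_lift; first exact/mono_inj/mm.
  by move=> r x; exact: (sub_inclS x).
have [u [[uE _] _]] := H _ (sub_incl Q) (fun l => projT1 (cid (qE l)))
  (fun l => projT2 (cid (qE l))).
have [|y <-] := @sub_incl_surj _ _ Q n a; first exact: ma.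
by exists (dg_ap u y); rewrite -dg_ap_comp uE.
Qed.

Lemma product_elt (L : Type) (A : L -> dgvect k) P (p : forall l, hom P (A l)) :
  is_product (C := dgVect k) p ->
  forall n (x : P n), (forall l, dg_ap (p l) x = 0) -> x = 0.
Proof.
move=> H n x px.
pose mem n (x : P n) := forall l, dg_ap (p l) x = 0.
have c r : subclosed (@mem r).
  split=> [l|e y z yE zE l]; first by rewrite dg_ap0.
  by rewrite dg_apP yE zE scaler0 addr0.
have dd r y : @mem r y -> mem (r - 1) (dg_d P r y).
  by move=> yE l; rewrite dg_ap_d yE linear0.
pose Q := SubComplex c dd.
have [u [_ uu]] := H _ (fun l => zero_mor (sub_dg Q) (A l)).
have E : sub_incl Q = zero_mor (sub_dg Q) P.
  rewrite -(uu (sub_incl Q)) => [|l]; last first.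
    by apply: mor_ext => r y; exact: (sub_inclS y l).
  by apply: uu => l; apply: mor_ext => r y; exact: dg_ap0.
by have [|y <-] := @sub_incl_surj _ _ Q n x; [exact: px|rewrite E].
Qed.

(** Slices commute with N (x) f. Hence an equation between elements of N (x) A
    holds for the slices, where the limit in question can be used, and then
    for the elements themselves. *)
Section TensorPreserves.
Variable N : dgvect k.
Local Notation NT g := (tens_map (idm (N : dgVect k)) g).

Lemma tens_pullback A B D P (f : hom A D) (m : hom B D) (p : hom P A) (q : hom P B) :
  mono m -> is_pullback (C := dgVect k) f m p q ->
  is_pullback (C := dgVect k) (NT f) (NT m) (NT p) (NT q).
Proof.
move=> mm H; have pm := pullback_mono mm H; have elt := pullback_elt mm H.
have [fp _] := H; split=> [|T s t st]; first by rewrite -!tens_mapM fp.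
have [|u uE] := mono_lift (f := s) (mono_inj (mono_tensl (N := N) pm)).
  move=> n z; apply: tens_image => i f'.
  apply: (elt _ _ (dslice f' (dg_ap t z))).
  by rewrite -!dslice_map -!dg_ap_comp st.
exists u; split=> [|u' [u'E _]]; last by apply: (mono_tensl (N := N) pm); rewrite uE.
split=> //; apply: (mono_tensl (N := N) mm).
by rewrite -st -uE !compmA -!tens_mapM fp.
Qed.

Lemma tens_equalizer A B E (f g : hom A B) (e : hom E A) :
  is_equalizer (C := dgVect k) f g e -> is_equalizer (C := dgVect k) (NT f) (NT g) (NT e).
Proof.
move=> H; have em := equalizer_mono H; have elt := equalizer_elt H.
have [fg _] := H; split=> [|T t ft]; first by rewrite -!tens_mapM fg.
have [|u uE] := mono_lift (f := t) (mono_inj (mono_tensl (N := N) em)).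
  move=> n z; apply: tens_image => i f'; apply: elt.
  by rewrite -!dslice_map -!dg_ap_comp ft.
by exists u; split=> // u' u'E; apply: (mono_tensl (N := N) em); rewrite uE.
Qed.

Lemma tens_intersection A (L : Type) (S : L -> dgvect k) (m : forall l, hom (S l) A)
    D (d : hom D A) (p : forall l, hom D (S l)) : (forall l, mono (m l)) ->
  is_intersection (C := dgVect k) m d p ->
  is_intersection (C := dgVect k) (fun l => NT (m l)) (NT d) (fun l => NT (p l)).
Proof.
move=> mm H; have dm := intersection_mono mm H; have elt := intersection_elt mm H.
have [pd _] := H; split=> [l|T t q qt]; first by rewrite -tens_mapM pd comp1m.
have [|u uE] := mono_lift (f := t) (mono_inj (mono_tensl (N := N) dm)).
  move=> n z; apply: tens_image => i f'; apply: elt => l.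
  by exists (dslice f' (dg_ap (q l) z)); rewrite -dslice_map -dg_ap_comp qt.
exists u; split=> [|u' [u'E _]]; last by apply: (mono_tensl (N := N) dm); rewrite uE.
split=> // l; apply: (mono_tensl (N := N) (mm l)).
by rewrite qt -uE compmA -tens_mapM pd comp1m.
Qed.

Lemma tens_product_mono (L : Type) (A : L -> dgvect k) P (p : forall l, hom P (A l))
    Q (q : forall l, hom Q (dg_tens N (A l))) (can : hom (dg_tens N P) Q) :
  is_product (C := dgVect k) p -> (forall l, q l \oc can = NT (p l)) -> mono can.
Proof.
move=> /product_elt elt qE; apply: inj_mono => n z z0; apply: slice_eq0 => i f.
by apply: elt => l; rewrite -dslice_map -qE dg_ap_comp z0 dg_ap0 (lin0 (dslice_lin f)).
Qed.

(** Since N (x) - is a left adjoint, it preserves all colimits: a cocone under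
    the tensored diagram is transposed, factored and transposed back. *)
Definition lcurry A T (F : hom (dg_tens N A) T) : hom A (ih N T) :=
  ih_curry (F \oc swap A N).
Definition luncurry A T (G : hom A (ih N T)) : hom (dg_tens N A) T :=
  ih_uncurry G \oc swap N A.

Lemma lcurryK A T F : luncurry (@lcurry A T F) = F.
Proof. by rewrite /luncurry ih_curryK -compmA swapK compm1. Qed.

Lemma luncurryK A T G : lcurry (@luncurry A T G) = G.
Proof. by rewrite /lcurry -compmA swapK compm1 ih_uncurryK. Qed.

Lemma lcurry_nat A B T (F : hom (dg_tens N B) T) (g : hom A B) :
  lcurry (F \oc NT g) = lcurry F \oc g.
Proof.
rewrite /lcurry -compmA -swap_nat compmA.
by have := ih_curry_nat g (idm (T : dgVect k)) (F \oc swap B N);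
  rewrite ih_map_id !comp1m.
Qed.

Lemma luncurry_nat A B T (G : hom B (ih N T)) (g : hom A B) :
  luncurry (G \oc g) = luncurry G \oc NT g.
Proof. by rewrite -[LHS]lcurryK -[RHS]lcurryK lcurry_nat !luncurryK. Qed.

Lemma lcurry_inj A T (F F' : hom (dg_tens N A) T) : lcurry F = lcurry F' -> F = F'.
Proof. by move=> e; rewrite -[F]lcurryK e lcurryK. Qed.

Lemma tens_cointersection A (L : Type) (S : L -> dgvect k) (m : forall l, hom A (S l))
    D (d : hom A D) (p : forall l, hom (S l) D) :
  is_intersection (C := op (dgVect k)) m d p ->
  is_intersection (C := op (dgVect k)) (fun l => NT (m l)) (NT d) (fun l => NT (p l)).
Proof.
move=> [pd H]; split=> [l|T t q qt].
  by rewrite -[RHS](congr1 (fun h => NT h) (pd l)) -[idm _ in RHS]comp1m; exact/esym/tens_mapM.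
have [l|u [[ud up] uu]] := H (ih N T) (lcurry t) (fun l => lcurry (q l)).
  by rewrite -[LHS]lcurry_nat; congr lcurry; exact: qt.
exists (luncurry u); split.
  split=> [|l].
    by rewrite -[LHS]luncurry_nat -[RHS]lcurryK; congr luncurry.
  by rewrite -[LHS]luncurry_nat -[RHS]lcurryK; congr luncurry; exact: up.
move=> u' [u'd u'p]; rewrite -[RHS]lcurryK; congr luncurry; apply: uu; split=> [|l].
  by rewrite -[LHS]lcurry_nat; congr lcurry.
by rewrite -[LHS]lcurry_nat; congr lcurry; exact: u'p.
Qed.

Lemma tens_pushout A B D P (f : hom D A) (m : hom D B) (p : hom A P) (q : hom B P) :
  is_pullback (C := op (dgVect k)) f m p q ->
  is_pullback (C := op (dgVect k)) (NT f) (NT m) (NT p) (NT q).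
Proof.
move=> [fp H]; split=> [|T s t st].
  by rewrite -[LHS](tens_mapM _ _ p f) -[RHS](tens_mapM _ _ q m); congr tens_map.
have [|u [[up uq] uu]] := H (ih N T) (lcurry s) (lcurry t).
  by rewrite -[LHS]lcurry_nat -[RHS]lcurry_nat; congr lcurry.
exists (luncurry u); split.
  by split; rewrite -[LHS]luncurry_nat -[RHS]lcurryK; congr luncurry.
move=> u' [u'p u'q]; rewrite -[RHS]lcurryK; congr luncurry; apply: uu.
by split; rewrite -[LHS]lcurry_nat; congr lcurry.
Qed.

Lemma tens_coequalizer A B E (f g : hom B A) (e : hom A E) :
  is_equalizer (C := op (dgVect k)) f g e ->
  is_equalizer (C := op (dgVect k)) (NT f) (NT g) (NT e).
Proof.
move=> [fg H]; split=> [|T t ft].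
  by rewrite -[LHS](tens_mapM _ _ e f) -[RHS](tens_mapM _ _ e g); congr tens_map.
have [|u [ue uu]] := H (ih N T) (lcurry t).
  by rewrite -[LHS]lcurry_nat -[RHS]lcurry_nat; congr lcurry.
exists (luncurry u); split.
  by rewrite -[LHS]luncurry_nat -[RHS]lcurryK; congr luncurry.
move=> u' u'e; rewrite -[RHS]lcurryK; congr luncurry; apply: uu.
by rewrite -[LHS]lcurry_nat; congr lcurry.
Qed.

Lemma tens_coproduct_epi (L : Type) (A : L -> dgvect k) P (p : forall l, hom (A l) P)
    Q (q : forall l, hom (dg_tens N (A l)) Q) (can : hom Q (dg_tens N P)) :
  is_product (C := op (dgVect k)) p -> (forall l, can \oc q l = NT (p l)) -> epi can.
Proof.
move=> H qE T g h gh; apply: lcurry_inj.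
have [u [_ uu]] := H (ih N T) (fun l => lcurry (g \oc NT (p l))).
rewrite -(uu (lcurry g)) => [|l]; last exact/esym/lcurry_nat.
by apply: uu => l; rewrite -[LHS]lcurry_nat -qE !compmA gh.
Qed.

End TensorPreserves.
End Slices.

(** * Limits, factorizations, subobjects and exactness in dgVect and its opposite *)
Section ExactnessProperties.
Variable k : fieldType.
Local Notation M := (dgM k).

(** The two definitions list the factors of a composite in opposite orders, so
    that they are not convertible. *)
Lemma extremal_epi_op (C : category) (A B : C) (e : mor A B) :
  extremal_epi e -> @extremal_mono (op C) B A e.
Proof.
move=> [ee H]; split=> // D m f fE mm.
by have [v [vm mv]] := H D f m fE mm; exists v.
Qed.

Lemma dg_P1 : P1 M.
Proof.
move=> J D; have [L [p H]] := @dg_limit k (small_obj J) D (@mor J) (@fmap _ _ D).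
by exists L, p.
Qed.

Lemma dg_P1_op : P1 (op_mon M).
Proof.
move=> J D.
have [L [p [pc H]]] := @dg_colimit k (small_obj J) D
  (fun i j : small_obj J => @mor J j i) (fun i j u => fmap D u).
by exists L, p; split=> [i j u|T q qc]; [exact: pc|apply: H => i j u; exact: qc].
Qed.

Lemma dg_P2 : P2 M.
Proof.
move=> J D _.
have [L [p [pc H]]] := @dg_colimit k (small_obj J) D (@mor J) (@fmap _ _ D).
by exists L, p.
Qed.

Lemma dg_P2_op : P2 (op_mon M).
Proof.
move=> J D _.
have [L [p [pc H]]] := @dg_limit k (small_obj J) D
  (fun i j : small_obj J => @mor J j i) (fun i j u => fmap D u).
by exists L, p; split=> [i j u|T q qc]; [exact: pc|apply: H => i j u; exact: qc].
Qed.

Lemma dg_P3 : P3 M.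
Proof.
split=> [A B f|A B X Y e m f g ee [mm _]]; last exact: epi_mono_diagonal.
have [D [e [m [fE ee mm]]]] := epi_mono_factorization f.
by exists D, e, m; split=> //; exact: all_mono_extremal.
Qed.

Lemma dg_P3_op : P3 (op_mon M).
Proof.
split=> [A B f|A B X Y e m f g ee [mm _] E].
  have [D [e [m [fE ee mm]]]] := epi_mono_factorization (f : @mor (dgVect k) B A).
  by exists D, m, e; split=> //; apply: extremal_epi_op; exact: all_epi_extremal.
have [d [[d1 d2] du]] := epi_mono_diagonal (mm : @epi (dgVect k) _ _ m)
  (ee : @mono (dgVect k) _ _ e) (esym E).
by exists d; split=> // d' [d'1 d'2]; apply: du.
Qed.

Lemma dg_P4 : P4 M.
Proof.
move=> A; exists (subcomplex A), (fun S => sub_dg S), (fun S => sub_incl S).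
have mi S : mono (sub_incl S : @mor (dgVect k) _ A).
  by apply: inj_mono => n x x0; apply: sub_incl_inj; rewrite dg_ap0.
split=> // B f fm; exists (im_sc f).
have [|u uE] := mono_lift (f := f) (mono_inj (mi (im_sc f))).
  by move=> n x; apply: sub_incl_surj; exists x.
exists u; split=> //; apply: bij_iso.
  by apply: (@mono_cancel _ _ _ _ (sub_incl (im_sc f))); rewrite uE.
apply: surj_epi => n y; have [x fx] := sub_inclS y; exists x.
by apply: sub_incl_inj; rewrite -dg_ap_comp uE.
Qed.

Lemma dg_P4_op : P4 (op_mon M).
Proof.
move=> A; exists (subcomplex A), (fun S => quot_dg S), (fun S => quot_proj S).
have pe S : epi (quot_proj S : @mor (dgVect k) A _).
  by apply: surj_epi => n y; exact: quot_proj_surj.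
split=> // B f fm; exists (ker_sc f).
have [|n x /quot_proj_ker //|u uE] := @epi_desc k A (quot_dg (ker_sc f)) B (quot_proj _) f.
  exact: quot_proj_surj.
exists u; split=> //.
have [||v [vu uv]] := @bij_iso k (quot_dg (ker_sc f)) B u.
- apply: inj_mono => n y; have [x <-] := quot_proj_surj y.
  by rewrite -dg_ap_comp uE => fx; apply/quot_proj_ker.
- apply: (@epi_cancel (dgVect k) _ _ _ u (quot_proj (ker_sc f))); rewrite uE; exact: fm.
by exists v.
Qed.

Lemma dg_P5 : P5 M.
Proof. by move=> A B N f fm; split; [exact: mono_tensr|exact: mono_tensl]. Qed.

Lemma idm_epi (C : category) (A : C) : epi (idm A).
Proof. by move=> T g h; rewrite !compm1. Qed.

Lemma dg_P5_op : P5 (op_mon M).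
Proof.
move=> A B N f fm; split.
- by apply: (@epi_tens k B A N N); [exact: fm|exact: idm_epi].
- by apply: (@epi_tens k N N B A); [exact: idm_epi|exact: fm].
Qed.

Lemma dg_P5a : P5a M.
Proof. by move=> A B f [fm _]; apply: all_mono_extremal; exact: mono_tens. Qed.

Lemma dg_P5a_op : P5a (op_mon M).
Proof. by move=> A B f [fm _]; apply: extremal_epi_op; apply: all_epi_extremal; exact: epi_tens. Qed.

Lemma dg_P6 : P6 M.
Proof. by move=> N A L S m D d p mm; apply: tens_intersection => l; case: (mm l). Qed.

Lemma dg_P6_op : P6 (op_mon M).
Proof. by move=> N A L S m D d p mm; exact: tens_cointersection. Qed.

Lemma dg_P7 : P7 M.
Proof. by move=> N A B D f m P p q; exact: tens_pullback. Qed.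

Lemma dg_P7_op : P7 (op_mon M).
Proof. by move=> N A B D f m P p q _; exact: tens_pushout. Qed.

Lemma dg_P8 : P8 M.
Proof. by move=> L N A P p Q q can _ pP _; exact: tens_product_mono. Qed.

Lemma dg_P8_op : P8 (op_mon M).
Proof. by move=> L N A P p Q q can _ pP _ E; exact: (tens_coproduct_epi (p := p) (q := q)). Qed.

Lemma dg_P9 : P9 M.
Proof. by move=> N A B f g E e; exact: tens_equalizer. Qed.

Lemma dg_P9_op : P9 (op_mon M).
Proof. by move=> N A B f g E e; exact: tens_coequalizer. Qed.

End ExactnessProperties.

(** * The pairing of a complex with its dual *)
Section Pairing.
Variables (k : fieldType) (D : prerigid (dgM k)).
Local Notation hom := (@mor (dgVect k)).
Local Notation c := (dg_braid k).
Implicit Types A B : dgvect k.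

Definition star A : dgvect k := pr_dual D A.
Definition evd A : hom (dg_tens (star A) A) (dg_unit k) := ev D A.

(** The value of the evaluation at a pair of homogeneous elements; it vanishes
    unless their degrees are opposite. *)
Definition pair A i j (f : star A i) (a : A j) : k^o :=
  uval (dg_ap (evd A) (dg_pure (erefl (i + j)) f a)).

Lemma pairE A i j n (e : i + j = n) (f : star A i) (a : A j) :
  uval (dg_ap (evd A) (dg_pure e f a)) = pair f a.
Proof. by case: _ / e. Qed.

Lemma pairPl A i j x (f g : star A i) (a : A j) :
  pair (x *: f + g) a = x * pair f a + pair g a.
Proof. by rewrite /pair dg_pureDl dg_pureZl dg_apP uval_lin. Qed.

Lemma pairPr A i j x (f : star A i) (a b : A j) :
  pair f (x *: a + b) = x * pair f a + pair f b.
Proof. by rewrite /pair dg_pureDr dg_pureZr dg_apP uval_lin. Qed.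

Lemma pair_linl A i j (a : A j) : linear (fun f : star A i => pair f a).
Proof. by move=> x f g; exact: pairPl. Qed.

Lemma pair_linr A i j (f : star A i) : linear (fun a : A j => pair f a).
Proof. by move=> x f' g; exact: pairPr. Qed.

Lemma pairZl A i j x (f : star A i) (a : A j) : pair (x *: f) a = x * pair f a.
Proof. exact: linZ (pair_linl a) x f. Qed.

Lemma pairZr A i j x (f : star A i) (a : A j) : pair f (x *: a) = x * pair f a.
Proof. exact: linZ (pair_linr f) x a. Qed.

Lemma pair0l A i j (a : A j) : pair (0 : star A i) a = 0.
Proof. exact: lin0 (pair_linl a). Qed.

Lemma pair0r A i j (f : star A i) : pair f (0 : A j) = 0.
Proof. exact: lin0 (pair_linr f). Qed.

Lemma pair_deg A i j (f : star A i) (a : A j) : i + j != 0 -> pair f a = 0.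
Proof. exact: uval_neq0. Qed.

Lemma pair_curry A B (F : hom (dg_tens B A) (dg_unit k)) i j n (e : i + j = n)
    (b : B i) (a : A j) :
  pair (dg_ap (pr_curry D F) b : star A i) a = uval (dg_ap F (dg_pure e b a)).
Proof.
have /(congr1 (fun h : hom (dg_tens B A) (dg_unit k) => dg_ap h (dg_pure e b a))) :=
  @Defs.curryK _ D A B F.
by rewrite dg_ap_comp [in X in X -> _]tens_mapE => <-; rewrite pairE.
Qed.

Let D0 := closed_prerigid (@dg_closed k).

(** The dual given by an arbitrary pre-rigid structure is isomorphic, compatibly
    with evaluations, to the one given by the internal hom. Every property of
    the pairing can therefore be read off from the latter. *)
Definition dual_from A : hom (ih A (dg_unit k)) (star A) :=
  pr_curry D (ev D0 A : hom (dg_tens (ih A (dg_unit k)) A) (dg_unit k)).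
Definition dual_to A : hom (star A) (ih A (dg_unit k)) := pr_curry D0 (ev D A).

Lemma dual_toK A : dual_from A \oc dual_to A = idm _.
Proof.
rewrite -[LHS](@Defs.uncurryK _ D) -[RHS](@Defs.uncurryK _ D); congr (pr_curry D).
rewrite [RHS](_ : _ = ev D A); last by rewrite tensm1 compm1.
rewrite -[in LHS](comp1m (idm (A : dgM k))) tensmM compmA.
by rewrite [X in X \oc _](@Defs.curryK _ D) (@Defs.curryK _ D0).
Qed.

Lemma pair_from A i j (f : ih A (dg_unit k) i) (a : A j) :
  pair (dg_ap (dual_from A) f) a = uval (ihv f (erefl (i + j)) a).
Proof. by rewrite (pair_curry _ (erefl (i + j))) [in LHS]ih_uncurryE. Qed.

Lemma pair_inj A i (f : star A i) : (forall j (a : A j), pair f a = 0) -> f = 0.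
Proof.
move=> f0; have fE : f = dg_ap (dual_from A) (dg_ap (dual_to A) f).
  by rewrite -dg_ap_comp dual_toK.
suff to0 : dg_ap (dual_to A) f = 0 by rewrite fE to0 dg_ap0.
apply: ih_ext => j m e a; case: _ / e; apply: uval_inj.
by rewrite -pair_from -fE f0 (lin0 (@uval_lin k _)).
Qed.

Lemma pair_ext A i (f g : star A i) : (forall j (a : A j), pair f a = pair g a) -> f = g.
Proof.
move=> fg; apply/eqP; rewrite -subr_eq0; apply/eqP/pair_inj => j a.
by rewrite (linB (pair_linl a)) fg subrr.
Qed.

Definition uinj (m : int) : k^o -> dg_unit k m :=
  match m with Posz 0 => id | _ => fun=> 0 end.

Lemma uinj_lin m : linear (@uinj m).
Proof. by case: m => [[|m]|m] a x y //=; rewrite scaler0 addr0. Qed.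

Lemma uinjK m x : m = 0 -> uval (@uinj m x) = x.
Proof. by move=> ->. Qed.

(** Together with pair_inj, this says that the degree i part of the dual is the
    full linear dual of the degree -i part. *)
Lemma pair_repr A i j (phi : {linear A j -> k^o}) : i + j = 0 ->
  exists f : star A i, forall a : A j, pair f a = phi a.
Proof.
move=> ij; pose f0 i' m (e : i + i' = m) (a : A i') := uinj m (phi (ds_fun a j)).
have f0P i' m e : linear (@f0 i' m e).
  by move=> x a b; rewrite /f0 ds_fun_lin linearP uinj_lin.
exists (dg_ap (dual_from A) (ih_mk f0P : ih A (dg_unit k) i)) => a.
by rewrite pair_from ih_mkE /f0 uinjK // ds_funii.
Qed.

Lemma pair_nondeg A i (a : A i) : (forall j (f : star A j), pair f a = 0) -> a = 0.
Proof.
move=> a0; apply: separation0 => phi.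
have [|f <-] := pair_repr (i := - i) phi; first exact: addNr.
exact: a0.
Qed.

Lemma pair_dual A B (g : hom A B) i j (b : star B i) (a : A j) :
  pair (dg_ap (dualm D g) b : star A i) a = pair b (dg_ap g a).
Proof. by rewrite (pair_curry _ (erefl (i + j))) dg_ap_comp [in LHS]tens_mapE pairE. Qed.

Lemma uval_lunit i j n (e : i + j = n) (x : dg_unit k i) (y : dg_unit k j) :
  uval (dg_ap (@lunit_map k (dg_unit k)) (dg_pure e x y)) = uval x * uval y.
Proof.
rewrite lunit_mapE (linZ (@uval_lin k _)).
have [i0|i0] := eqVneq i 0; last by rewrite uval_neq0 // scale0r mul0r.
have e' : j = n by rewrite -e i0 add0r.
by case: _ / e'; rewrite ds_funii.
Qed.

Lemma middleE (W X Y Z : dgvect k) (i j i' j' n n' r p q : int)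
    (e : i + j = n) (e' : i' + j' = n')
    (er : n + n' = r) (ep : i + i' = p) (eq : j + j' = q)
    (es : p + q = r)
    (w : W i) (x : X j) (y : Y i') (z : Z j') :
  dg_ap (@middle (dgM k) W X Y Z (swap X Y)) 
      (dg_pure er (dg_pure e w x : dg_tens W X n) (dg_pure e' y z : dg_tens Y Z n'))
    = (-1) ^ (j * i') *:
      dg_pure es (dg_pure ep w y : dg_tens W Y p) (dg_pure eq x z : dg_tens X Z q).
Proof.
have e1 : i + (j + n') = r by rewrite addrA e.
have e2 : (j + i') + j' = j + n' by rewrite -addrA e'.
have e3 : i' + q = j + n' by rewrite -e' -eq; ring.
rewrite -[middle _ _ _]/(associ_map W Y (dg_tens X Z)
  \oc tens_map (idm (W : dgVect k)) (assoc_map Y X Z)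
  \oc tens_map (idm (W : dgVect k)) (tens_map (swap X Y) (idm (Z : dgVect k)))
  \oc tens_map (idm (W : dgVect k)) (associ_map X Y Z)
  \oc assoc_map W X (dg_tens Y Z)).
rewrite !dg_ap_comp (assoc_mapE e _ (erefl _) e1) tens_mapE (associ_mapE (erefl _) e2).
rewrite !tens_mapE (swapE _ (addrC _ _)) dg_pureZl dg_apZ dg_pureZr dg_apZ.
by rewrite (assoc_mapE _ _ eq e3) (associ_mapE ep es).
Qed.

Lemma theta_pair A B i j n i' j' n' (e : i + j = n) (e' : i' + j' = n')
    (f : star A i) (g : star B j) (a : A i') (b : B j') :
  pair (dg_ap (theta c D A B) (dg_pure e f g) : star (dg_tens A B) n) (dg_pure e' a b)
    = (-1) ^ (j * i') * (pair f a * pair g b).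
Proof.
have e4 : (i + i') + (j + j') = n + n' by rewrite -e -e'; ring.
rewrite (pair_curry _ (erefl (n + n'))) dg_ap_comp.
rewrite (middleE e e' _ (erefl _) (erefl _) e4) dg_apZ.
rewrite -[ev2 _ _ _]/(@lunit_map k (dg_unit k) \oc tens_map (evd A) (evd B)) dg_ap_comp.
by rewrite tens_mapE (linZ (@uval_lin k _)) uval_lunit.
Qed.

(** The symmetry is its own inverse. *)
Lemma theta_inv_eq A B : theta_inv c D A B = theta c D A B.
Proof. by []. Qed.

Lemma flat_pair A B (g : hom B (star A)) i j (a : A i) (b : B j) :
  pair (dg_ap (flat c (pr := D) g) a : star B i) b = (-1) ^ (i * j) * pair (dg_ap g b) a.
Proof.
rewrite (pair_curry _ (erefl (i + j))) !dg_ap_comp (swapE _ (addrC _ _)).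
by rewrite !dg_apZ tens_mapE (linZ (@uval_lin k _)) pairE.
Qed.

(** A functional on A extends along the injective map g to a functional on B. *)
Lemma dual_mono_epi A B (g : hom A B) : mono g -> epi (dualm D g : hom (star B) (star A)).
Proof.
move=> /mono_inj gi; apply: surj_epi => i f.
have gi' : injective (dg_fun g (- i)).
  move=> x y e; apply/eqP; rewrite -subr_eq0; apply/eqP/gi.
  rewrite dg_apB; by apply/eqP; rewrite subr_eq0; apply/eqP.
have [h hE] := extend_along_inj (mk_lin (pair_linr f (j := - i))) gi'.
have [f' f'E] := pair_repr h (subrr i); exists f'.
apply: pair_ext => j a; rewrite pair_dual.
have [ij|ij] := eqVneq (i + j) 0; last by rewrite !pair_deg.
have e : - i = j by rewrite -[LHS]addr0 -ij addKr.
by case: _ / e in a ij *; rewrite f'E; exact: hE.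
Qed.

Lemma alpha_mono A : mono (alpha c D A : hom A (star (star A))).
Proof.
apply: inj_mono => i a a0; apply: pair_nondeg => j f.
have := flat_pair (idm (star A : dgVect k)) a f; rewrite -/(alpha c D A) a0 pair0l.
by move/esym/eqP; rewrite mulf_eq0 expfz_eq0 oppr_eq0 oner_eq0 andbF => /eqP.
Qed.

Lemma sg_neq0 (n : int) : (-1 : k) ^ n != 0.
Proof. by rewrite expfz_eq0 oppr_eq0 oner_eq0 andbF. Qed.

(** Let x be in the kernel. For an element b of B, evaluating the right factor at b
    turns x into an element R x of the dual of A, which vanishes because up to
    sign its value at a is the value of theta x at a (x) b. The values at b of
    the slices of x are the images of R x, so the slices vanish. *)
Lemma theta_mono A B : mono (theta c D A B : hom (dg_tens (star A) (star B)) _).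
Proof.
apply: inj_mono => n x x0; apply: slice_eq0 => i phi.
apply: pair_inj => q b.
pose R_fun l j (_ : l + j = n) (f : star A l) (g : star B j) : star A i :=
  pair g b *: ds_fun f i.
have R_bil l j e : is_bilinear (@R_fun l j e).
  apply: bilin_intro => [a f f' g|a f g g']; rewrite /R_fun.
  - by rewrite ds_fun_lin scalerDr !scalerA mulrC.
  - by rewrite pairPl scalerDl scalerA.
pose R := glift R_fun.
have R_lin : linear R by exact: glift_linear.
have -> : pair (dslice phi x) b = phi (R x).
  apply: (tens_ext (f := fun x => pair (dslice phi x) b) (g := fun x => phi (R x))).
  - by move=> a y z; rewrite dslice_lin pairPl.
  - by move=> a y z; rewrite R_lin linearP.
  move=> l j e f g; rewrite dslice_pure /R glift_pure // pairZl linearZ /= mulrC.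
  have [li|li] := eqVneq l i; last by rewrite (ds_fun_neq f li) linear0 scaler0 mulr0.
  by subst l; have je := dg_pure_deg e; subst j; rewrite ds_funii.
suff -> : R x = 0 by rewrite linear0.
apply: pair_inj => p a.
have [ip|ip] := eqVneq (i + p) 0; last exact: pair_deg.
suff -> : pair (R x) a = (-1) ^ (q * p) *
    pair (dg_ap (theta c D A B) x : star (dg_tens A B) n) (dg_pure erefl a b).
  by rewrite x0 pair0l mulr0.
apply: (tens_ext (f := fun x => pair (R x) a) (g := fun x => _ * pair (dg_ap _ x) _)).
- by move=> t y z; rewrite R_lin pairPl.
- by move=> t y z; rewrite dg_apP pairPl mulrDr mulrCA.
move=> l j e f g; rewrite theta_pair /R glift_pure // pairZl.
have [jq|jq] := eqVneq (j + q) 0; last by rewrite (pair_deg g) // mul0r !mulr0.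
have [li|li] := eqVneq l i; last first.
  rewrite (ds_fun_neq f li) pair0l (pair_deg f) ?mul0r ?mulr0 //.
  by apply: contra li => /eqP lp; rewrite -(inj_eq (addIr p)) lp ip.
subst l; rewrite ds_funii mulrA -sgD -mulrDl (addrC q) jq mul0r expr0z mul1r.
exact: mulrC.
Qed.

(** If x is in the kernel, then (f (x) g) x = 0 for all f and g. Taking f to
    represent phi, this says that all functionals g vanish on the slice of x
    along phi. *)
Lemma flat_theta_mono A B :
  mono (flat c (pr := D) (theta_inv c D A B) : hom (dg_tens A B) (star (dg_tens (star A) (star B)))).
Proof.
apply: inj_mono => n x x0; apply: slice_eq0 => i phi.
apply: pair_nondeg => q g.
have [f fE] := pair_repr phi (addNr i).
have := flat_pair (theta_inv c D A B : hom _ (star (dg_tens A B)))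
  x (dg_pure (erefl (- i + q)) f g).
rewrite x0 pair0l => /esym/eqP; rewrite mulf_eq0 (negPf (sg_neq0 _)) /= => /eqP th0.
suff E : pair (dg_ap (theta c D A B) (dg_pure (erefl (- i + q)) f g) : star (dg_tens A B) _) x
    = (-1) ^ (q * i) * pair g (dslice phi x).
  move/esym/eqP: E; rewrite -theta_inv_eq th0 mulf_eq0 (negPf (sg_neq0 _)) /=.
  by move/eqP.
apply: (tens_ext (f := fun x => pair _ x) (g := fun x => _ * pair g (dslice phi x))).
- exact: pair_linr.
- by move=> t y z; rewrite dslice_lin pairPr mulrDr mulrCA.
move=> l j e a b; rewrite theta_pair dslice_pure pairZr.
have [li|li] := eqVneq l i; last first.
  rewrite (ds_fun_neq a li) linear0 mul0r (pair_deg f) ?mul0r ?mulr0 //.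
  by apply: contra li => /eqP lp; rewrite -(inj_eq (addrI (- i))) lp addNr.
by subst l; have je := dg_pure_deg e; subst j; rewrite !ds_funii -fE.
Qed.

End Pairing.

(** * Left adjoints from universal arrows *)
Section UniversalArrows.
Variables (C D : category) (G : functor D C).

Definition universal_arrow (X : C) (F : D) (eta : mor X (G F)) :=
  forall (Y : D) (f : mor X (G Y)), exists! g : mor F Y, fmap G g \oc eta = f.

Lemma left_adjoint_of_universal :
  (forall X, exists (F : D) (eta : mor X (G F)), universal_arrow eta) ->
  has_left_adjoint G.
Proof.
move=> H.
pose F X := projT1 (cid (H X)).
have HF X : exists eta : mor X (G (F X)), universal_arrow eta.
  by rewrite /F; case: cid.
pose eta X := projT1 (cid (HF X)).
have HU X : universal_arrow (eta X) by rewrite /eta; case: cid.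
pose lift X Y (f : mor X (G Y)) := projT1 (cid (HU X Y f)).
have liftE X Y (f : mor X (G Y)) : fmap G (lift X Y f) \oc eta X = f.
  by rewrite /lift; case: cid => g [].
have lift_uniq X Y (g g' : mor (F X) Y) :
    fmap G g \oc eta X = fmap G g' \oc eta X -> g = g'.
  by move=> e; have [h [_ hu]] := HU X Y (fmap G g' \oc eta X); rewrite -(hu g) // (hu g').
pose Fm X X' (f : mor X X') := lift X (F X') (eta X' \oc f).
have Fm1 X : Fm X X (idm X) = idm (F X).
  by apply: lift_uniq; rewrite liftE compm1 fmap1 comp1m.
have FmM X X' X'' (g : mor X' X'') (f : mor X X') : Fm _ _ (g \oc f) = Fm _ _ g \oc Fm _ _ f.
  by apply: lift_uniq; rewrite liftE fmapM -compmA liftE !compmA liftE.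
pose FF := Functor Fm1 FmM.
exists FF; split.
apply: (@Adjunction _ _ FF G (fun X Y h => fmap G h \oc eta X) lift).
- by move=> X Y f; apply: lift_uniq; rewrite liftE.
- exact: liftE.
- by move=> X X' Y Y' f g h /=; rewrite !fmapM -!compmA liftE.
Qed.

End UniversalArrows.

(** * Monoids in terms of elements *)
Section MonoidElements.
Variable k : fieldType.
Local Notation hom := (@mor (dgVect k)).

Definition amul (A : monoid_data (dgM k)) i j n (e : i + j = n)
    (a : (mcar A : dgvect k) i) (b : (mcar A : dgvect k) j) : (mcar A : dgvect k) n :=
  dg_ap (mmul A : hom (dg_tens (mcar A) (mcar A)) (mcar A)) (dg_pure e a b).

Definition aone (A : monoid_data (dgM k)) : (mcar A : dgvect k) 0 :=
  dg_ap (mone A : hom (dg_unit k) (mcar A)) (uone k).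

Lemma amul_bil (A : monoid_data (dgM k)) i j n (e : i + j = n) :
  is_bilinear (@amul A i j n e).
Proof.
apply: bilin_intro => [a u u' v|a u v v']; rewrite /amul.
- by rewrite dg_pureDl dg_pureZl dg_apP.
- by rewrite dg_pureDr dg_pureZr dg_apP.
Qed.

Lemma amul_d (A : monoid_data (dgM k)) i j n (e : i + j = n) a b :
  dg_d (mcar A) n (@amul A i j n e a b) = amul (dg_degl e) (dg_d (mcar A) i a) b
    + (-1) ^ i *: amul (dg_degr e) a (dg_d (mcar A) j b).
Proof.
by rewrite /amul -dg_ap_d (dg_tens_d_pureE _ _ _ (dg_degl e) (dg_degr e)) dg_apD dg_apZ.
Qed.

Lemma aone_d (A : monoid_data (dgM k)) : dg_d (mcar A) 0 (aone A) = 0.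
Proof.
rewrite /aone -dg_ap_d (_ : dg_d _ 0 _ = 0) ?dg_ap0 //.
Qed.

Lemma unit_mor_ext (X : dgvect k) (f g : hom (dg_unit k) X) :
  dg_ap f (uone k) = dg_ap g (uone k) -> f = g.
Proof.
move=> fg; apply: mor_ext => n x.
have [n0|n0] := eqVneq n 0; last first.
  rewrite (_ : x = 0) ?dg_ap0 //; apply: uval_inj.
  by rewrite !uval_neq0.
subst n; rewrite (_ : x = (x : k) *: uone k) ?dg_apZ ?fg //.
by apply: uval_inj; rewrite (linZ (@uval_lin k _)); apply: esym; exact: mulr1.
Qed.

Lemma unit_hom_exists (X : dgvect k) (x : X 0) : dg_d X 0 x = 0 ->
  exists f : hom (dg_unit k) X, dg_ap f (uone k) = x.
Proof.
move=> dx; pose f n (a : dg_unit k n) : X n := uval a *: ds_fun x n.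
have fl n : linear (f n).
  by move=> c a b; rewrite /f uval_lin scalerDl scalerA.
have fd n (a : dg_unit k n) : f (n - 1) (dg_d (dg_unit k) n a) = dg_d X n (f n a).
  rewrite /f uval_d scale0r linearZ /= ds_fun_d dx.
  by rewrite (lin0 (@ds_fun_lin _ _ _ _)) scaler0.
by exists (@mk_dg k (dg_unit k) X f fl fd); rewrite -[LHS]/(1 *: ds_fun x 0) scale1r ds_funii.
Qed.

Section Laws.
Variable A : monoid (dgM k).

Lemma amulA i j l m p n (eij : i + j = m) (eml : m + l = n) (ejl : j + l = p)
    (eip : i + p = n) (a : (mcar A : dgvect k) i) (b : (mcar A : dgvect k) j)
    (d : (mcar A : dgvect k) l) :
  amul eml (amul eij a b) d = amul eip a (amul ejl b d).
Proof.
have := congr1 (fun h : hom (dg_tens (dg_tens (mcar A) (mcar A)) (mcar A)) (mcar A) =>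
  dg_ap h (dg_pure eml (dg_pure eij a b : dg_tens _ _ m) d)) (mmulA A).
rewrite !dg_ap_comp [in X in X -> _]tens_mapE.
rewrite [X in _ = dg_ap _ (dg_ap _ X) -> _](assoc_mapE _ _ ejl eip).
by rewrite [X in _ = dg_ap _ X -> _]tens_mapE.
Qed.

Lemma amul1l n (e : 0 + n = n) (a : (mcar A : dgvect k) n) : amul e (aone A) a = a.
Proof.
have := congr1 (fun h : hom (dg_tens (dg_unit k) (mcar A)) (mcar A) =>
  dg_ap h (dg_pure e (uone k) a)) (mmul1m A).
rewrite dg_ap_comp [in X in X -> _]tens_mapE => E; apply: (etrans E).
by rewrite [LHS]lunit_mapE ds_funii scale1r.
Qed.

Lemma amul1r n (e : n + 0 = n) (a : (mcar A : dgvect k) n) : amul e a (aone A) = a.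
Proof.
have := congr1 (fun h : hom (dg_tens (mcar A) (dg_unit k)) (mcar A) =>
  dg_ap h (dg_pure e a (uone k))) (mmulm1 A).
rewrite dg_ap_comp [in X in X -> _]tens_mapE => E; apply: (etrans E).
by rewrite [LHS]runit_mapE ds_funii scale1r.
Qed.

End Laws.

Lemma mhom_amul (A B : monoid_data (dgM k)) (f : monoid_hom A B) i j n (e : i + j = n) a b :
  dg_ap (mhom f : hom (mcar A) (mcar B)) (@amul A i j n e a b)
    = amul e (dg_ap (mhom f : hom (mcar A) (mcar B)) a) (dg_ap (mhom f : hom (mcar A) (mcar B)) b).
Proof.
have := congr1 (fun h : hom (dg_tens (mcar A) (mcar A)) (mcar B) =>
  dg_ap h (dg_pure e a b)) (mhomM f).
by rewrite !dg_ap_comp [in X in X -> _]tens_mapE.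
Qed.

Lemma mhom_aone (A B : monoid_data (dgM k)) (f : monoid_hom A B) :
  dg_ap (mhom f : hom (mcar A) (mcar B)) (aone A) = aone B.
Proof.
by have := congr1 (fun h : hom (dg_unit k) (mcar B) => dg_ap h (uone k)) (mhom1 f).
Qed.

Lemma mk_monoid_hom (A B : monoid_data (dgM k)) (f : hom (mcar A) (mcar B)) :
  (forall i j n (e : i + j = n) a b,
     dg_ap f (@amul A i j n e a b) = amul e (dg_ap f a) (dg_ap f b)) ->
  dg_ap f (aone A) = aone B -> exists g : monoid_hom A B, mhom g = f.
Proof.
move=> fM f1.
have hM : (f : @mor (dgM k) _ _) \oc mmul A = mmul B \oc ((f : @mor (dgM k) _ _) \otm f).
  apply: (@tens_mor_ext k (mcar A) (mcar A) (mcar B)) => i j n e a b.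
  by rewrite !dg_ap_comp [in RHS]tens_mapE; exact: fM.
have h1 : (f : @mor (dgM k) _ _) \oc mone A = mone B.
  by apply: (@unit_mor_ext (mcar B)); exact: f1.
by exists (MonoidHom hM h1).
Qed.

End MonoidElements.

(** * Free monoids *)

(** The free monoid on V is made of the formal expressions in elements of V, two
    of them being identified when they take the same value for every map from V
    to a monoid. All the laws hold because they hold in every monoid, and the
    universal property is evaluation. *)
Section FreeMonoid.
Variables (k : fieldType) (V : dgvect k).
Local Notation hom := (@mor (dgVect k)).

Inductive fterm : int -> small :=
| ft_zero n : fterm n
| ft_add n of fterm n & fterm n : fterm n
| ft_scale n of k & fterm n : fterm n
| ft_d n of fterm n : fterm (n - 1)
| ft_one : fterm 0
| ft_mul i j n of i + j = n & fterm i & fterm j : fterm n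
| ft_var n of V n : fterm n.

Record fmodel := FModel {
  fm_mon : monoid (dgM k);
  fm_var : hom V (mcar fm_mon) }.

Definition fm_car (m : fmodel) : dgvect k := mcar (fm_mon m).

Fixpoint ft_eval (m : fmodel) n (t : fterm n) : fm_car m n :=
  match t with
  | ft_zero _ => 0
  | ft_add _ s t => ft_eval m s + ft_eval m t
  | ft_scale _ a t => a *: ft_eval m t
  | ft_d n t => dg_d (fm_car m) n (ft_eval m t)
  | ft_one => aone (fm_mon m)
  | ft_mul _ _ _ e s t => @amul k (fm_mon m) _ _ _ e (ft_eval m s) (ft_eval m t)
  | ft_var _ v => dg_ap (fm_var m) v
  end.

Definition free_terms : dg_terms k :=
  @DgTerms k fterm ft_zero ft_add ft_scale ft_d fmodel fm_car ft_eval
    (fun m n => erefl) (fun m n x y => erefl) (fun m n a x => erefl) (fun m n x => erefl).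

Definition free_dg : dgvect k := tq_dg free_terms.

Local Notation cls := (@tq_cls k free_terms).
Local Notation evm := (@tq_eval k free_terms).

Definition frep n (x : free_dg n) : fterm n := projT1 (cid (tq_surj x)).
Lemma frepK n (x : free_dg n) : cls (frep x) = x.
Proof. by rewrite /frep; case: cid. Qed.

Lemma eval_frep m n (x : free_dg n) : ft_eval m (frep x) = dg_ap (evm m) x.
Proof. by rewrite -{2}[x]frepK [RHS]tq_evalE. Qed.

Definition free_mul_fun i j n (e : i + j = n) (x : free_dg i) (y : free_dg j) : free_dg n :=
  cls (ft_mul e (frep x) (frep y)).

Lemma free_mul_eval m i j n (e : i + j = n) x y :
  dg_ap (evm m) (free_mul_fun e x y)
    = @amul k (fm_mon m) _ _ _ e (dg_ap (evm m) x) (dg_ap (evm m) y).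
Proof. by rewrite [LHS]tq_evalE /= !eval_frep. Qed.

Lemma free_mul_cls i j n (e : i + j = n) s t :
  free_mul_fun e (cls s) (cls t) = cls (ft_mul e s t).
Proof. by apply: tq_ext => m; rewrite free_mul_eval !tq_evalE. Qed.

Lemma free_mul_bil i j n (e : i + j = n) : is_bilinear (free_mul_fun e).
Proof.
apply: bilin_intro => [a u u' v|a u v v']; apply: tq_ext => m;
  rewrite dg_apP !free_mul_eval dg_apP.
- by rewrite (bilinearDl (amul_bil _ e)) (bilinearZl (amul_bil _ e)).
- by rewrite (bilinearDr (amul_bil _ e)) (bilinearZr (amul_bil _ e)).
Qed.

Lemma free_mul_d i j n (e : i + j = n) x y :
  dg_d free_dg n (free_mul_fun e x y) = free_mul_fun (dg_degl e) (dg_d free_dg i x) y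
    + (-1) ^ i *: free_mul_fun (dg_degr e) x (dg_d free_dg j y).
Proof.
apply: tq_ext => m.
by rewrite dg_ap_d dg_apD dg_apZ !free_mul_eval amul_d !dg_ap_d.
Qed.

Definition free_mul : hom (dg_tens free_dg free_dg) free_dg :=
  bimap_hom (BiMap free_mul_bil free_mul_d).

Lemma free_mulE i j n (e : i + j = n) x y :
  dg_ap free_mul (dg_pure e x y) = free_mul_fun e x y.
Proof. exact: bimap_homE. Qed.

Lemma free_one_d : dg_d free_dg 0 (cls ft_one) = 0.
Proof.
apply: tq_ext => m; rewrite dg_ap_d tq_evalE dg_ap0; exact: aone_d.
Qed.

Definition free_one : hom (dg_unit k) free_dg := projT1 (cid (unit_hom_exists free_one_d)).
Lemma free_oneE : dg_ap free_one (uone k) = cls ft_one.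
Proof. by rewrite /free_one; case: cid. Qed.

Definition free_data : monoid_data (dgM k) := @MonoidData (dgM k) free_dg free_mul free_one.

Lemma free_amul i j n (e : i + j = n) x y : @amul k free_data i j n e x y = free_mul_fun e x y.
Proof. exact: free_mulE. Qed.

Lemma free_mulA : mmul free_data \oc (mmul free_data \otm idm _)
  = mmul free_data \oc (idm _ \otm mmul free_data) \oc assoc _ _ _.
Proof.
apply: (@tens3_mor_ext k free_dg free_dg free_dg free_dg) => i j m l n eij eml x y z.
have eip : i + (j + l) = n by rewrite addrA eij.
rewrite !dg_ap_comp [X in dg_ap _ X = _]tens_mapE.
rewrite [X in _ = dg_ap _ (dg_ap _ X)](assoc_mapE _ _ (erefl _) eip).
rewrite [X in _ = dg_ap _ X]tens_mapE !free_mulE.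
by apply: tq_ext => f; rewrite !free_mul_eval; exact: amulA.
Qed.

Lemma free_mul1m : mmul free_data \oc (mone free_data \otm idm _) = @lunit (dgM k) free_dg.
Proof.
rewrite -[RHS]/(@lunit_map k free_dg); apply: tens_mor_ext => i j n e a x.
have e0 := add0r n; rewrite (unit_pureE e a x e0) dg_ap_comp lunit_mapE scale1r.
rewrite ds_funii [X in dg_ap _ X]tens_mapE free_oneE free_mulE.
apply: tq_ext => m; rewrite free_mul_eval tq_evalE; exact: amul1l.
Qed.

Lemma free_mulm1 : mmul free_data \oc (idm _ \otm mone free_data) = @runit (dgM k) free_dg.
Proof.
rewrite -[RHS]/(@runit_map k free_dg); apply: tens_mor_ext => i j n e x a.
rewrite runit_mapE dg_ap_comp [X in dg_ap _ X]tens_mapE.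
have [j0|j0] := eqVneq j 0; last first.
  rewrite uval_neq0 // scale0r (_ : a = 0) ?dg_ap0 ?dg_pure0r ?dg_ap0 //.
  by apply: uval_inj; rewrite !uval_neq0.
subst j; have ein : i = n by rewrite -e addr0.
subst i; rewrite ds_funii (_ : a = (a : k) *: uone k); last first.
  by apply: uval_inj; rewrite (linZ (@uval_lin k _)); apply: esym; exact: mulr1.
rewrite dg_apZ free_oneE dg_pureZr dg_apZ free_mulE (linZ (@uval_lin k _)).
rewrite [X in _ = X *: _]mulr1; congr (_ *: _).
apply: tq_ext => m; rewrite free_mul_eval tq_evalE; exact: amul1r.
Qed.

Definition free_monoid : monoid (dgM k) :=
  @Defs.Monoid (dgM k) free_data free_mulA free_mul1m free_mulm1.

Lemma free_var_lin n : linear (fun v : V n => cls (ft_var v)).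
Proof.
move=> a u v; rewrite -tq_clsZ -tq_clsD; apply/tq_clsP => m; exact: dg_apP.
Qed.

Lemma free_var_d n (v : V n) :
  cls (ft_var (dg_d V n v)) = dg_d free_dg n (cls (ft_var v)).
Proof. by rewrite -tq_clsd; apply/tq_clsP => m; exact: dg_ap_d. Qed.

Definition free_var : hom V free_dg :=
  @mk_dg k V free_dg (fun n v => cls (ft_var v)) free_var_lin free_var_d.

Lemma free_lift_hom (m : fmodel) : exists g : monoid_hom free_monoid (fm_mon m), mhom g = evm m.
Proof.
apply: (@mk_monoid_hom k free_monoid (fm_mon m)) => [i j n e a b|].
  by rewrite free_amul free_mul_eval.
by rewrite /aone free_oneE tq_evalE.
Qed.

Lemma free_universal :
  @universal_arrow _ _ (Mon_forget (dgM k)) V free_monoid free_var.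
Proof.
move=> B f; pose m := FModel f.
have [g gE] := free_lift_hom m; exists g; split.
  apply: mor_ext => n v; rewrite -[fmap _ _]/(mhom g) gE.
  exact: (@tq_evalE k free_terms m).
move=> h hf; apply: monoid_hom_ext; rewrite gE.
apply: (@mor_ext k free_dg (mcar B)) => n x; rewrite -[x]frepK [LHS](@tq_evalE k free_terms m).
pose h' : hom free_dg (mcar B) := mhom h.
rewrite -[RHS]/(dg_ap h' _).
elim: (frep x) => {n x} [n|n s IHs t IHt|n a t IH|n t IH||i j n e s IHs t IHt|n v] /=.
- by rewrite tq_cls0 dg_ap0.
- by rewrite tq_clsD dg_apD -IHs -IHt.
- by rewrite tq_clsZ dg_apZ -IH.
- by rewrite tq_clsd dg_ap_d -IH.
- by rewrite -free_oneE; exact/esym/(mhom_aone h).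
- by rewrite -free_mul_cls -free_amul [RHS](mhom_amul h) -IHs -IHt.
- by rewrite -hf.
Qed.

End FreeMonoid.

Lemma dg_P10 (k : fieldType) : P10 (dgM k).
Proof.
apply: left_adjoint_of_universal => V.
by exists (free_monoid V), (free_var V); exact: free_universal.
Qed.

(** * Duality, theta and transposition *)
Section DualCalculus.
Variables (k : fieldType) (D : prerigid (dgM k)).
Local Notation M := (dgM k).
Local Notation c := (dg_braid k).
Local Notation "A ^*" := (star D A : M).
Local Notation I := (unit_ob M).
Implicit Types A B E X Y : M.

Lemma dual_ext X A (f g : @mor M X A^*) :
  (forall i j (x : (X : dgvect k) i) (a : (A : dgvect k) j),
     pair (dg_ap f x) a = pair (dg_ap g x) a) -> f = g.
Proof.
move=> fg; apply: (@mor_ext k X A^*) => i x; apply: pair_ext => j a; exact: fg.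
Qed.

Lemma star_tens_ext A B n (f g : star D (A \ox B) n) :
  (forall p q j (e : p + q = j) (a : (A : dgvect k) p) (b : (B : dgvect k) q),
     pair f (dg_pure e a b : dg_tens A B j) = pair g (dg_pure e a b : dg_tens A B j)) ->
  f = g.
Proof.
move=> fg; apply: pair_ext => j y; apply: (tens_ext (f := pair f) (g := pair g)) => //.
- exact: pair_linr.
- exact: pair_linr.
Qed.

Lemma star_tens3_ext A B E n (f g : star D ((A \ox B) \ox E) n) :
  (forall p q r m j (e : p + q = m) (e' : m + r = j) (a : (A : dgvect k) p)
     (b : (B : dgvect k) q) (d : (E : dgvect k) r),
     pair f (dg_pure e' (dg_pure e a b : dg_tens A B m) d : dg_tens (dg_tens A B) E j)
     = pair g (dg_pure e' (dg_pure e a b : dg_tens A B m) d : dg_tens (dg_tens A B) E j)) ->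
  f = g.
Proof.
move=> fg; apply: star_tens_ext => m r j e' y d.
apply: (tens_ext (f := fun y => pair f (dg_pure e' y d : (dg_tens (dg_tens A B) E) j))
  (g := fun y => pair g (dg_pure e' y d : (dg_tens (dg_tens A B) E) j))) => //.
- by move=> t z z'; rewrite dg_pureDl dg_pureZl pairPr.
- by move=> t z z'; rewrite dg_pureDl dg_pureZl pairPr.
Qed.

Local Notation dual f := (dualm D f).
Local Notation th A B := (theta c D A B).
Local Notation flatD g := (flat c (pr := D) g).

Lemma dual_comp A B E (g : @mor M B E) (f : @mor M A B) : dual (g \oc f) = dual f \oc dual g.
Proof. by apply: dual_ext => i j x a; rewrite dg_ap_comp !pair_dual. Qed.

Lemma dual_id A : dual (idm A) = idm A^*.
Proof. by apply: dual_ext => i j x a; rewrite pair_dual. Qed.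

(** The next lemmas give the naturality, associativity and unit constraints of the
    lax monoidal functor formed by the dual, theta and iotam. *)
Lemma theta_nat A A' B B' (f : @mor M A A') (g : @mor M B B') :
  th A B \oc (dual f \otm dual g) = dual (f \otm g) \oc th A' B'.
Proof.
apply: (@tens_mor_ext k A'^* B'^* (A \ox B)^*) => i j n e x y.
apply: star_tens_ext => p q m e' a b; rewrite !dg_ap_comp pair_dual.
rewrite [X in dg_ap _ X]tens_mapE (tens_mapE f g) !theta_pair.
by rewrite !pair_dual.
Qed.

Lemma theta_assoc A B E :
  th (A \ox B) E \oc (th A B \otm idm E^*)
    = dual (assoc A B E) \oc th A (B \ox E) \oc (idm A^* \otm th B E) \oc assoc A^* B^* E^*.
Proof.
apply: (@tens3_mor_ext k A^* B^* E^* ((A \ox B) \ox E)^*) => i j m l n eij eml f g h.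
apply: star_tens3_ext => p q r m' n' e e' a b d.
have eip : i + (j + l) = n by rewrite addrA eij.
have e3 : p + (q + r) = n' by rewrite addrA e.
rewrite !dg_ap_comp tens_mapE theta_pair theta_pair pair_dual.
rewrite (assoc_mapE _ _ (erefl _) eip) (assoc_mapE _ _ (erefl _) e3) tens_mapE.
rewrite !theta_pair -e !mulrDr !mulrDl !sgD; ring.
Qed.

Lemma iotam_pair i j (x : dg_unit k i) (y : dg_unit k j) :
  pair (dg_ap (iotam D) x) y = uval x * uval y.
Proof. by rewrite (pair_curry _ _ (erefl (i + j))); exact: uval_lunit. Qed.

Lemma pair_ds_fun A i j n m (f : star D A i) (a : (A : dgvect k) j) : i = n -> j = m ->
  pair (ds_fun (W := star D A) f n) (ds_fun a m) = pair f a.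
Proof. by move=> <- <-; rewrite !ds_funii. Qed.

Lemma theta_unitl A :
  th I A \oc (iotam D \otm idm A^*) = dual (lunit A) \oc lunit A^*.
Proof.
apply: (@tens_mor_ext k (dg_unit k) A^* (I \ox A)^*) => i j n e x f.
apply: star_tens_ext => p q m e' y a.
rewrite !dg_ap_comp tens_mapE theta_pair pair_dual iotam_pair.
rewrite (lunit_mapE e) (lunit_mapE e') pairZl pairZr.
have [i0|i0] := eqVneq i 0; last by rewrite (uval_neq0 x) // !(mul0r, mulr0).
have [p0|p0] := eqVneq p 0; last by rewrite (uval_neq0 y) // !(mul0r, mulr0).
rewrite pair_ds_fun.
- by rewrite (_ : j * p = 0) ?p0 ?mulr0 // expr0z mul1r [RHS]mulrA.
- by rewrite -e i0 add0r.
- by rewrite -e' p0 add0r.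
Qed.

Lemma theta_unitr A :
  th A I \oc (idm A^* \otm iotam D) = dual (runit A) \oc runit A^*.
Proof.
apply: (@tens_mor_ext k A^* (dg_unit k) (A \ox I)^*) => i j n e f x.
apply: star_tens_ext => p q m e' a y.
rewrite !dg_ap_comp tens_mapE theta_pair pair_dual iotam_pair.
rewrite (runit_mapE e) (runit_mapE e') pairZl pairZr.
have [i0|i0] := eqVneq j 0; last by rewrite (uval_neq0 x) // !(mul0r, mulr0).
have [p0|p0] := eqVneq q 0; last by rewrite (uval_neq0 y) // !(mul0r, mulr0).
rewrite pair_ds_fun.
- by rewrite (_ : j * p = 0) ?i0 ?mul0r // expr0z mul1r [LHS]mulrC [RHS]mulrA.
- by rewrite -e i0 addr0.
- by rewrite -e' p0 addr0.
Qed.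

Lemma iotam_mono : mono (iotam D).
Proof.
apply: (@inj_mono k (dg_unit k) I^*) => n x x0; apply: uval_inj.
by rewrite -[LHS]mulr1 -[X in _ * X]/(uval (uone k)) -iotam_pair x0 pair0l
  (lin0 (@uval_lin k _)).
Qed.

(** Evaluation of functionals at the element u; it is the transpose of u up to
    the identification of the unit with its dual. *)
Definition eval_at A (u : @mor M I A) : @mor M A^* I :=
  ev D A \oc (idm A^* \otm u) \oc runiti A^*.

Lemma eval_atE A (u : @mor M I A) : iotam D \oc eval_at u = dual u.
Proof.
apply: dual_ext => i j f y; rewrite dg_ap_comp iotam_pair pair_dual.
have [j0|j0] := eqVneq j 0; last first.
  rewrite (uval_neq0 y) // mulr0 (_ : y = 0) ?dg_ap0 ?pair0r //.
  by apply: uval_inj; rewrite !uval_neq0.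
subst j; rewrite {2}(_ : y = (y : k) *: uone k); last first.
  by apply: uval_inj; rewrite (linZ (@uval_lin k _)); apply: esym; exact: mulr1.
rewrite dg_apZ pairZr mulrC; congr (_ * _).
by rewrite /eval_at !dg_ap_comp (runiti_mapE _ (addr0 i)) tens_mapE pairE.
Qed.

Lemma flat_nat_dom A B B' (g : @mor M B A^*) (f : @mor M B' B) :
  flatD (g \oc f) = dual f \oc flatD g.
Proof. by apply: dual_ext => i j a b; rewrite dg_ap_comp pair_dual !flat_pair. Qed.

Lemma flat_nat_cod A A' B (g : @mor M B A^*) (f : @mor M A' A) :
  flatD (dual f \oc g) = flatD g \oc f.
Proof. by apply: dual_ext => i j a b; rewrite dg_ap_comp !flat_pair dg_ap_comp pair_dual. Qed.

Lemma flatK A B (g : @mor M B A^*) : flatD (flatD g) = g.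
Proof.
by apply: dual_ext => i j a b; rewrite !flat_pair mulrA (mulrC j) sgK mul1r.
Qed.

(** Transposition is compatible with theta; the sign produced by exchanging
    y (x) z with a (x) b as a whole differs from the one produced factor by
    factor, and the two signs hidden in theta make up for the difference. *)
Lemma flat_theta A B Y Z (f : @mor M A Y^*) (g : @mor M B Z^*) :
  flatD (th Y Z \oc (f \otm g)) = th A B \oc (flatD f \otm flatD g).
Proof.
apply: (@tens_mor_ext k Y Z (A \ox B)^*) => i j n e y z.
apply: star_tens_ext => p q m e' a b.
rewrite flat_pair !dg_ap_comp !tens_mapE !theta_pair !flat_pair -e -e'.
rewrite !mulrDr !mulrDl !sgD (mulrC q i) (mulrC j p).
have := sgK k (i * q); move: (_ ^ (i * q)) (_ ^ (i * p)) (_ ^ (p * j)) (_ ^ (j * q)).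
move: (pair _ y : k) (pair _ z : k) => u v s s1 s2 s3 ss; rewrite -[RHS]mul1r -ss.
by rewrite /=; ring.
Qed.

Lemma flat_iotam : flatD (iotam D) = iotam D.
Proof.
apply: dual_ext => i j x y; rewrite flat_pair !iotam_pair.
have [i0|i0] := eqVneq i 0; last by rewrite (uval_neq0 x) // !(mul0r, mulr0).
by rewrite (_ : i * j = 0) ?i0 ?mul0r // expr0z mul1r mulrC.
Qed.

(** * Comonoids and the dual monoid *)

Section Comonoid.
Variable Y : Comon M.
Local Notation C := (ccar Y).
Local Notation Delta := (comul Y : @mor M C (C \ox C)).
Local Notation eps := (counit Y : @mor M C I).

Lemma comulA : (Delta \otm idm C) \oc Delta
  = associ C C C \oc ((idm C \otm Delta) \oc Delta).
Proof. exact: (mmulA Y). Qed.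

Lemma comul1m : (eps \otm idm C) \oc Delta = luniti C.
Proof. exact: (mmul1m Y). Qed.

Lemma comulm1 : (idm C \otm eps) \oc Delta = runiti C.
Proof. exact: (mmulm1 Y). Qed.

Local Notation mu := (dual Delta \oc th C C).
Local Notation eta := (dual eps \oc iotam D).

Lemma dual_monoidA : mu \oc (mu \otm idm C^*)
  = mu \oc (idm C^* \otm mu) \oc assoc C^* C^* C^*.
Proof.
have tensl (f : @mor M (C \ox C)^* C^*) (g : @mor M (C^* \ox C^*) (C \ox C)^*) :
    (f \oc g) \otm idm C^* = (f \otm idm C^*) \oc (g \otm idm C^*).
  by rewrite -tensmM comp1m.
have tensr (f : @mor M (C \ox C)^* C^*) (g : @mor M (C^* \ox C^*) (C \ox C)^*) :
    idm C^* \otm (f \oc g) = (idm C^* \otm f) \oc (idm C^* \otm g).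
  by rewrite -tensmM comp1m.
rewrite tensl tensr -dual_id -!compmA.
rewrite [X in _ \oc X = _]compmA theta_nat.
rewrite [in RHS](compmA (th C C)) theta_nat -!compmA dual_id theta_assoc.
rewrite !compmA -!dual_comp comulA; congr (dual _ \oc _ \oc _ \oc _).
by rewrite compmA [assoc _ _ _ \oc _]mon_associK comp1m.
Qed.

Lemma dual_monoid1m : mu \oc (eta \otm idm C^*) = lunit C^*.
Proof.
have -> : eta \otm idm C^* = (dual eps \otm dual (idm C)) \oc (iotam D \otm idm C^*).
  by rewrite -tensmM dual_id comp1m.
rewrite -!compmA (compmA (th C C)) theta_nat -!compmA theta_unitl !compmA -!dual_comp.
by rewrite comul1m [lunit C \oc _]mon_lunitiK dual_id comp1m.
Qed.

Lemma dual_monoidm1 : mu \oc (idm C^* \otm eta) = runit C^*.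
Proof.
have -> : idm C^* \otm eta = (dual (idm C) \otm dual eps) \oc (idm C^* \otm iotam D).
  by rewrite -tensmM dual_id comp1m.
rewrite -!compmA (compmA (th C C)) theta_nat -!compmA theta_unitr !compmA -!dual_comp.
by rewrite comulm1 [runit C \oc _]mon_runitiK dual_id comp1m.
Qed.

Definition full_dual_monoid : monoid M :=
  @Defs.Monoid M (dual_monoid c D Y) dual_monoidA dual_monoid1m dual_monoidm1.

(** The condition on a morphism from Y to the dual of A under which its transpose
    is a morphism of monoids from A to the dual of Y. It does not refer to a
    comultiplication on the dual of A, which need not exist. *)
Definition coalgebraic (A : monoid_data M) (g : @mor M C (mcar A)^*) :=
  dual (mmul A) \oc g = th (mcar A) (mcar A) \oc (g \otm g) \oc Delta /\
  dual (mone A) \oc g = iotam D \oc eps.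

Lemma hom_coalgebraic (A : monoid_data M) (f : monoid_hom A (dual_monoid c D Y)) :
  coalgebraic (flatD (mhom f)).
Proof.
split; first by rewrite -flat_nat_dom (mhomM f) /= -compmA flat_nat_cod flat_theta.
by rewrite -flat_nat_dom (mhom1 f) /= flat_nat_cod flat_iotam.
Qed.

Lemma coalgebraic_hom (A : monoid_data M) (g : @mor M C (mcar A)^*) :
  coalgebraic g -> exists f : monoid_hom A (dual_monoid c D Y), mhom f = flatD g.
Proof.
move=> [gM g1].
have fM : flatD g \oc mmul A = mmul (dual_monoid c D Y) \oc (flatD g \otm flatD g).
  by rewrite -[LHS]flatK flat_nat_dom flatK gM flat_nat_dom flat_theta compmA.
have f1 : flatD g \oc mone A = mone (dual_monoid c D Y).
  by rewrite -[LHS]flatK flat_nat_dom flatK g1 flat_nat_dom flat_iotam.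
by exists (@MonoidHom M A (dual_monoid c D Y) (flatD g) fM f1).
Qed.

End Comonoid.

(** * The largest comonoid inside the dual of a monoid *)

Section LargestComonoid.
Variables (A : monoid M) (K : @subcomplex k (star D (mcar A))).
Local Notation Ao := (mcar A).
Local Notation incl S := (sub_incl S : @mor M (sub_dg S) Ao^*).

(** X (x) X seen as a family of functionals on A (x) A. *)
Definition theta_sq X (i : @mor M X Ao^*) : @mor M (X \ox X) (Ao \ox Ao)^* :=
  th Ao Ao \oc (i \otm i).

(** The subcomplexes of K on which the transpose of the multiplication is a
    comultiplication. *)
Definition comul_stable (S : @subcomplex k (star D Ao)) :=
  (forall n f, S n f -> K n f) /\
  forall n f, S n f -> exists z, dg_ap (theta_sq (incl S)) z = dg_ap (dual (mmul A)) f.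

Lemma incl_mono (S : @subcomplex k (star D Ao)) : mono (incl S).
Proof.
by apply: (@inj_mono k (sub_dg S) Ao^*) => n x x0; apply: sub_incl_inj; rewrite dg_ap0.
Qed.

Lemma theta_sq_mono X (i : @mor M X Ao^*) : mono i -> mono (theta_sq i).
Proof.
move=> im; apply: comp_mono; first exact: (@theta_mono k D Ao Ao).
exact: (@mono_tens k X Ao^* X Ao^*).
Qed.

Lemma theta_sq_comp X X' (i : @mor M X Ao^*) (u : @mor M X' X) :
  theta_sq (i \oc u) = theta_sq i \oc (u \otm u).
Proof. by rewrite /theta_sq tensmM compmA. Qed.

Lemma theta_sq_le (S S' : @subcomplex k (star D Ao)) n (z : dg_tens (sub_dg S) (sub_dg S) n) :
  (forall n f, S n f -> S' n f) ->
  exists z', dg_ap (theta_sq (incl S')) z' = dg_ap (theta_sq (incl S)) z.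
Proof.
move=> SS'.
have [u uE] : exists u : @mor M (sub_dg S) (sub_dg S'), incl S' \oc u = incl S.
  apply: (mono_lift (mono_inj (@incl_mono S'))) => m x.
  exact/sub_incl_surj/SS'/sub_inclS.
exists (dg_ap (tens_map u u) z).
have -> : theta_sq (incl S) = theta_sq (incl S') \oc (u \otm u) by rewrite -theta_sq_comp uE.
by [].
Qed.

Lemma comul_stable_add (S S' : @subcomplex k (star D Ao)) : comul_stable S -> comul_stable S' ->
  exists T, [/\ comul_stable T, forall n f, S n f -> T n f & forall n f, S' n f -> T n f].
Proof.
move=> [SK Sm] [S'K S'm].
pose mem n (f : star D Ao n) := exists g h, [/\ S n g, S' n h & f = g + h].
have cl n : subclosed (@mem n).
  split=> [|a _ _ [g [h [Sg Sh ->]]] [g' [h' [Sg' Sh' ->]]]].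
    by exists 0, 0; rewrite addr0; split=> //; exact: sc0.
  exists (a *: g + g'), (a *: h + h'); split; try exact: scP.
  by rewrite scalerDr addrACA.
have dd n f : mem n f -> mem (n - 1) (dg_d (star D Ao) n f).
  move=> [g [h [Sg Sh ->]]]; exists (dg_d (star D Ao) n g), (dg_d (star D Ao) n h).
  by split; [exact: sc_d|exact: sc_d|rewrite linearD].
pose T := SubComplex cl dd.
have ST n f : S n f -> T n f by move=> Sf; exists f, 0; rewrite addr0; split=> //; exact: sc0.
have S'T n f : S' n f -> T n f by move=> Sf; exists 0, f; rewrite add0r; split=> //; exact: sc0.
exists T; split=> //; split=> n _ [g [h [Sg Sh ->]]].
  by have := scP 1 (SK _ _ Sg) (S'K _ _ Sh); rewrite scale1r.
have [y yE] := Sm _ _ Sg; have [y' y'E] := S'm _ _ Sh.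
have [z zE] := theta_sq_le y ST; have [z' z'E] := theta_sq_le y' S'T.
by exists (z + z'); rewrite [LHS]dg_apD zE z'E yE y'E; apply: esym; exact: dg_apD.
Qed.

(** Since sums of stable subcomplexes are stable, the union of all of them is a
    subcomplex, and it is the largest one. *)
Definition largest_mem n (f : star D Ao n) := exists S, comul_stable S /\ S n f.

Lemma largest_closed n : subclosed (@largest_mem n).
Proof.
split=> [|a f g [S [Sc Sf]] [S' [S'c S'g]]].
  have c0 m : subclosed (fun x : star D Ao m => x = 0).
    by split=> // a _ _ -> ->; rewrite scaler0 addr0.
  have d0 m (x : star D Ao m) : x = 0 -> dg_d (star D Ao) m x = 0.
    by move=> ->; rewrite linear0.
  exists (SubComplex c0 d0); split=> //; split=> m f /= ->; first exact: sc0.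
  by exists 0; rewrite !dg_ap0.
have [T [Tc ST S'T]] := comul_stable_add Sc S'c.
by exists T; split=> //; apply: scP; [exact: ST|exact: S'T].
Qed.

Lemma largest_d n (f : star D Ao n) : largest_mem f -> largest_mem (dg_d (star D Ao) n f).
Proof. by move=> [S [Sc Sf]]; exists S; split=> //; exact: sc_d. Qed.

Definition largest := SubComplex largest_closed largest_d.

Lemma largest_stable : comul_stable largest.
Proof.
split=> n f [S [Sc Sf]]; first exact: Sc.1 Sf.
have [z zE] := Sc.2 _ _ Sf.
have [|z' z'E] := @theta_sq_le S largest n z; first by move=> m g Sg; exists S.
by exists z'; rewrite z'E.
Qed.

Local Notation C := (sub_dg largest : M).
Local Notation j := (incl largest).

Lemma largest_comul :
  exists Delta : @mor M C (C \ox C), theta_sq j \oc Delta = dual (mmul A) \oc j.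
Proof.
apply: (@mono_lift k (dg_tens C C) (star D (Ao \ox Ao)) C (theta_sq j)).
  exact/(@mono_inj k _ _ (theta_sq j))/theta_sq_mono/incl_mono.
move=> n f; apply: largest_stable.2; exact: sub_inclS.
Qed.

Definition largest_delta := projT1 (cid largest_comul).
Lemma largest_deltaE : theta_sq j \oc largest_delta = dual (mmul A) \oc j.
Proof. by rewrite /largest_delta; case: cid. Qed.
Lemma largest_counit : exists eps : @mor M C I, iotam D \oc eps = dual (mone A) \oc j.
Proof. by exists (eval_at (mone A) \oc j); rewrite compmA eval_atE. Qed.

Definition largest_eps := projT1 (cid largest_counit).
Lemma largest_epsE : iotam D \oc largest_eps = dual (mone A) \oc j.
Proof. by rewrite /largest_eps; case: cid. Qed.

Local Notation Dl := largest_delta.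
Local Notation el := largest_eps.

Definition largest_data : monoid_data (op_mon M) := @MonoidData (op_mon M) C Dl el.

(** After embedding in the dual of A (x) A (x) A, both sides are the transpose of
    the two-fold multiplication. *)
Lemma largest_comulA : (Dl \otm idm C) \oc Dl = associ C C C \oc ((idm C \otm Dl) \oc Dl).
Proof.
have jm := @incl_mono largest.
have T3 : mono (th (Ao \ox Ao) Ao \oc (theta_sq j \otm j)).
  apply: comp_mono; first exact: (@theta_mono k D (Ao \ox Ao) Ao).
  by apply: (@mono_tens k _ _ _ _ (theta_sq j) j) => //; exact: theta_sq_mono.
apply: T3.
rewrite compmA -(compmA (th _ _)) -tensmM largest_deltaE compm1.
have -> : (dual (mmul A) \oc j) \otm j = (dual (mmul A) \otm dual (idm Ao)) \oc (j \otm j).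
  by rewrite -tensmM dual_id comp1m.
have E1 : th (Ao \ox Ao) Ao \oc (theta_sq j \otm j) \oc associ C C C
    = dual (assoc Ao Ao Ao) \oc th Ao (Ao \ox Ao) \oc (j \otm theta_sq j).
  have -> : theta_sq j \otm j = (th Ao Ao \otm idm Ao^*) \oc ((j \otm j) \otm j).
    by rewrite -tensmM comp1m.
  rewrite compmA theta_assoc -!compmA [assoc _ _ _ \oc _]compmA.
  rewrite [assoc _ _ _ \oc _](mon_assoc_nat (mon_str M)) -compmA.
  rewrite [_ \oc associ C C C](mon_associK (mon_str M)) compm1.
  congr (_ \oc (_ \oc _)); by rewrite -[LHS]tensmM comp1m.
rewrite [RHS]compmA E1 -!compmA [(j \otm theta_sq j) \oc _]compmA -tensmM largest_deltaE compm1.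
have -> : j \otm (dual (mmul A) \oc j) = (dual (idm Ao) \otm dual (mmul A)) \oc (j \otm j).
  by rewrite -tensmM dual_id comp1m.
rewrite -!compmA [th (Ao \ox Ao) Ao \oc _]compmA [th Ao (Ao \ox Ao) \oc _]compmA.
rewrite !theta_nat -!compmA [th Ao Ao \oc _]compmA -/(theta_sq j) largest_deltaE.
by rewrite !compmA -!dual_comp mmulA !compmA.
Qed.

Lemma dual_iso_mono X Y (f : @mor M X Y) (g : @mor M Y X) : f \oc g = idm Y ->
  mono (dual f).
Proof.
move=> fg; apply: (@mono_cancel _ _ _ _ (dual g)).
by rewrite -dual_comp fg dual_id => T u v; rewrite !comp1m.
Qed.

Lemma largest_comul1m : (el \otm idm C) \oc Dl = luniti C.
Proof.
suff E : lunit C \oc ((el \otm idm C) \oc Dl) = idm C.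
  by rewrite -[LHS]comp1m -[idm _ in LHS](mon_lunitK (mon_str M)) -compmA E compm1.
apply: (@incl_mono largest).
apply: (@dual_iso_mono _ _ (lunit Ao) (luniti Ao)); first exact: (mon_lunitiK (mon_str M)).
have := mon_lunit_nat (mon_str M) j; rewrite -/(tensm _ _) => nat.
rewrite compm1 [j \oc _]compmA -[j \oc lunit C]nat -!compmA [dual _ \oc _]compmA.
rewrite -theta_unitl -!compmA [(_ \otm j) \oc _]compmA -tensmM comp1m compm1.
rewrite [(iotam D \otm _) \oc _]compmA -tensmM comp1m largest_epsE.
have -> : (dual (mone A) \oc j) \otm j = (dual (mone A) \otm dual (idm Ao)) \oc (j \otm j).
  by rewrite -tensmM dual_id comp1m.
rewrite -compmA [th _ _ \oc _]compmA theta_nat -compmA [th _ _ \oc _]compmA -/(theta_sq j).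
by rewrite largest_deltaE compmA -dual_comp mmul1m.
Qed.

Lemma largest_comulm1 : (idm C \otm el) \oc Dl = runiti C.
Proof.
suff E : runit C \oc ((idm C \otm el) \oc Dl) = idm C.
  by rewrite -[LHS]comp1m -[idm _ in LHS](mon_runitK (mon_str M)) -compmA E compm1.
apply: (@incl_mono largest).
apply: (@dual_iso_mono _ _ (runit Ao) (runiti Ao)); first exact: (mon_runitiK (mon_str M)).
have := mon_runit_nat (mon_str M) j; rewrite -/(tensm _ _) => nat.
rewrite compm1 [j \oc _]compmA -[j \oc runit C]nat -!compmA [dual _ \oc _]compmA.
rewrite -theta_unitr -!compmA [(j \otm _) \oc _]compmA -tensmM comp1m compm1.
rewrite [(_ \otm iotam D) \oc _]compmA -tensmM comp1m largest_epsE.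
have -> : j \otm (dual (mone A) \oc j) = (dual (idm Ao) \otm dual (mone A)) \oc (j \otm j).
  by rewrite -tensmM dual_id comp1m.
rewrite -compmA [th _ _ \oc _]compmA theta_nat -compmA [th _ _ \oc _]compmA -/(theta_sq j).
by rewrite largest_deltaE compmA -dual_comp mmulm1.
Qed.

Definition largest_comonoid : Comon M :=
  @Defs.Monoid (op_mon M) largest_data largest_comulA largest_comul1m largest_comulm1.

Definition largest_incl : @mor M (ccar largest_comonoid) Ao^* := j.

Lemma largest_incl_coalgebraic (Y : Comon M) (h : mor Y largest_comonoid) :
  @coalgebraic Y A (largest_incl \oc comhom h).
Proof.
split.
  rewrite compmA -[dual _ \oc _]largest_deltaE -[RHS]/(theta_sq (j \oc comhom h) \oc comul Y).
  by rewrite theta_sq_comp -!compmA; congr (_ \oc (_ \oc _)); exact: (mhomM h).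
rewrite compmA -[dual _ \oc _]largest_epsE -!compmA; congr (_ \oc _); exact: (mhom1 h).
Qed.

(** The image of a coalgebraic map is a stable subcomplex, hence contained in the
    largest one. *)
Lemma largest_universal (Y : Comon M) (g : @mor M (ccar Y) Ao^*) :
  @coalgebraic Y A g ->
  (forall n (y : (ccar Y : dgvect k) n), K n (dg_ap g y)) ->
  exists h : mor Y largest_comonoid, largest_incl \oc comhom h = g.
Proof.
move=> [gM g1] gK.
pose S := im_sc g.
have [g' g'E] : exists g' : @mor M (ccar Y) (sub_dg S), incl S \oc g' = g.
  apply: (mono_lift (mono_inj (@incl_mono S))) => n y.
  by apply: sub_incl_surj; exists y.
have Sc : comul_stable S.
  split=> n _ [y <-]; first exact: gK.
  exists (dg_ap ((g' \otm g') \oc comul Y) y).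
  rewrite -!dg_ap_comp compmA -theta_sq_comp g'E.
  by rewrite [dual _ \oc g]gM.
have [h hE] : exists h : @mor M (ccar Y) C, j \oc h = g.
  apply: (mono_lift (mono_inj (@incl_mono largest))) => n y.
  by apply: sub_incl_surj; exists S; split=> //; exists y.
have hM : Dl \oc h = (h \otm h) \oc comul Y.
  apply: (theta_sq_mono (@incl_mono largest)).
  by rewrite !compmA largest_deltaE -theta_sq_comp -compmA hE gM.
have h1 : el \oc h = counit Y.
  by apply: iotam_mono; rewrite compmA largest_epsE -compmA hE g1.
by exists (@MonoidHom (op_mon M) largest_data Y h hM h1).
Qed.

End LargestComonoid.

Lemma comon_hom_ext (A : monoid M) K (Y : Comon M) (h h' : mor Y (@largest_comonoid A K)) :
  largest_incl K \oc comhom h = largest_incl K \oc comhom h' -> h = h'.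
Proof. by move=> e; apply: monoid_hom_ext; apply: (@incl_mono A (@largest A K)). Qed.

(** * The finite dual *)

Definition full_sc (U : dgvect k) : subcomplex U :=
  @SubComplex k U (fun n x => True)
    (fun n => conj Logic.I (fun a x y _ _ => Logic.I)) (fun n x _ => Logic.I).

Definition fdual (A : monoid M) : Comon M := largest_comonoid (full_sc (star D (mcar A))).
Definition fdual_incl (A : monoid M) : @mor M (ccar (fdual A)) (mcar A)^* :=
  largest_incl (full_sc (star D (mcar A))).

Lemma fdual_lift (A : monoid M) (Y : Comon M) (g : @mor M (ccar Y) (mcar A)^*) :
  coalgebraic (A := A) g -> exists h : mor Y (fdual A), fdual_incl A \oc comhom h = g.
Proof. by move=> gc; exact: largest_universal. Qed.

Lemma fdual_hom_ext (A : monoid M) (Y : Comon M) (h h' : mor Y (fdual A)) :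
  fdual_incl A \oc comhom h = fdual_incl A \oc comhom h' -> h = h'.
Proof. exact: comon_hom_ext. Qed.

Lemma coalgebraic_dual (A B : monoid M) (Y : Comon M) (g : @mor M (ccar Y) (mcar A)^*)
    (f : monoid_hom B A) : coalgebraic (A := A) g -> coalgebraic (A := B) (dual (mhom f) \oc g).
Proof.
move=> [gM g1]; split.
  rewrite compmA -dual_comp mhomM dual_comp -compmA gM tensmM !compmA.
  by congr (_ \oc _ \oc _); exact/esym/theta_nat.
by rewrite compmA -dual_comp mhom1.
Qed.

Lemma fdual_map_exists (A B : monoid M) (f : monoid_hom B A) :
  exists h : mor (fdual A) (fdual B),
    fdual_incl B \oc comhom h = dual (mhom f) \oc fdual_incl A.
Proof.
apply: fdual_lift; apply: coalgebraic_dual.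
by have := largest_incl_coalgebraic (idm (fdual A)); rewrite compm1.
Qed.

Definition fdual_map (A B : monoid M) (f : monoid_hom B A) :=
  projT1 (cid (fdual_map_exists f)).

Lemma fdual_mapE (A B : monoid M) (f : monoid_hom B A) :
  fdual_incl B \oc comhom (fdual_map f) = dual (mhom f) \oc fdual_incl A.
Proof. by rewrite /fdual_map; case: cid. Qed.

Lemma fdual_map1 (A : monoid M) : fdual_map (monoid_id A) = idm (fdual A).
Proof. by apply: fdual_hom_ext; rewrite fdual_mapE dual_id comp1m compm1. Qed.

Lemma fdual_mapM (A B E : monoid M) (g : monoid_hom E B) (f : monoid_hom B A) :
  fdual_map (monoid_comp f g) = fdual_map g \oc fdual_map f.
Proof.
apply: fdual_hom_ext; rewrite fdual_mapE /= dual_comp -compmA -fdual_mapE compmA.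
by rewrite -fdual_mapE -compmA.
Qed.

Definition fdual_functor : functor (op (Mon M)) (Comon M) :=
  @Functor (op (Mon M)) (Comon M) fdual
    (fun (A B : monoid M) f => fdual_map f) fdual_map1
    (fun (A B E : monoid M) g f => fdual_mapM g f).

Definition fdual_bij (A : Mon M) (Y : Comon M) (h : mor Y (fdual A)) :
  monoid_hom A (dual_monoid c D Y) :=
  projT1 (cid (coalgebraic_hom (largest_incl_coalgebraic h))).

Lemma fdual_bijE (A : Mon M) (Y : Comon M) (h : mor Y (fdual A)) :
  mhom (fdual_bij h) = flatD (fdual_incl A \oc comhom h).
Proof. by rewrite /fdual_bij; case: cid. Qed.

Lemma fdual_bij_inv (A : Mon M) (Y : Comon M) (f : monoid_hom A (dual_monoid c D Y)) :
  exists h : mor Y (fdual A), fdual_bij h = f.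
Proof.
have [h hE] := fdual_lift (hom_coalgebraic f); exists h.
by apply: monoid_hom_ext; rewrite fdual_bijE hE flatK.
Qed.

Lemma fdual_bij_inj (A : Mon M) (Y : Comon M) : injective (@fdual_bij A Y).
Proof.
move=> h h' /(congr1 (fun f : monoid_hom A (dual_monoid c D Y) => flatD (mhom f))).
rewrite !fdual_bijE !flatK.
exact: fdual_hom_ext.
Qed.

Lemma fdual_bijective (A : Mon M) (Y : Comon M) : bijective (@fdual_bij A Y).
Proof.
exists (fun f => projT1 (cid (fdual_bij_inv f))) => [h|f].
  by apply: fdual_bij_inj; case: cid.
by case: cid.
Qed.

Lemma fdual_natl (A A' : Mon M) (Y : Comon M) (a : mor A' A) (h : mor Y (fdual A)) :
  mhom (fdual_bij (fmap fdual_functor (a : @mor (op (Mon M)) A A') \oc h))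
    = mhom (fdual_bij h) \oc mhom a.
Proof.
rewrite !fdual_bijE -flat_nat_cod; congr (flatD _).
by rewrite [RHS]compmA -fdual_mapE -compmA.
Qed.

Lemma fdual_natr (A : Mon M) (Y Y' : Comon M) (g : mor Y' Y) (h : mor Y (fdual A)) :
  mhom (fdual_bij (h \oc g)) = dual (comhom g) \oc mhom (fdual_bij h).
Proof. by rewrite !fdual_bijE -flat_nat_dom -compmA. Qed.

Definition dg_finite_dual : finite_dual c D :=
  @FiniteDual M c D fdual_functor fdual_bij fdual_bijective fdual_natl fdual_natr.

(** By the Yoneda lemma F A is isomorphic to the comonoid fdual A, and the
    isomorphism carries kappa to the inclusion into the dual of A. *)
Lemma kappa_mono (F : finite_dual c D) (A : Mon M) : mono (kappa F A).
Proof.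
have kE : kappa F A = flatD (fd_eta F A) by [].
have [h hE] := fdual_bij_inv (fd_bij (idm (F A))).
have [h' h'E] : exists h' : mor (fdual A) (F A), fd_bij h' = fdual_bij (idm (fdual A)).
  have [g _ gK] := @fd_bijective _ _ _ F A (fdual A).
  by exists (g (fdual_bij (idm (fdual A)))); rewrite gK.
have -> : kappa F A = fdual_incl A \oc comhom h.
  by rewrite kE /fd_eta -hE fdual_bijE flatK.
apply: comp_mono; first exact: incl_mono.
have [g gK _] := @fd_bijective _ _ _ F A (F A).
suff hh : h' \oc h = idm (F A).
  apply: (@mono_cancel _ _ _ _ (comhom h')).
  have -> : comhom h' \oc comhom h = idm (ccar (F A)) by rewrite -[RHS]/(comhom (idm (F A))) -hh.
  by move=> T u v; rewrite !comp1m.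
apply: (can_inj gK); apply: monoid_hom_ext; rewrite fd_natr h'E -fdual_natr.
by rewrite comp1m hE.
Qed.

End DualCalculus.

(** * Cofree comonoids *)

Section Cofree.
Variables (k : fieldType).
Local Notation M := (dgM k).
Local Notation c := (dg_braid k).
Local Notation D := (closed_prerigid (@dg_closed k)).
Local Notation "A ^*" := (star D A : M).
Local Notation dual f := (dualm D f).
Local Notation flatD g := (flat c (pr := D) g).

(** Let T be the free monoid on the dual of V. A morphism of comonoids from Y to the
    finite dual of T amounts to a morphism of monoids from T to the dual of Y,
    hence to a map from the dual of V to the dual of Y, hence to a map from Y to
    the bidual of V. The maps that come from V, embedded in its bidual by alpha,
    are those with image in the largest comonoid all of whose elements restrict,
    along the dual of V -> T, to elements of V. *)
Lemma cofree_universal (V : M) : exists (F : Mon (op_mon M))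
    (eta : @mor (op_mon M) V (Mon_forget (op_mon M) F)),
  @universal_arrow _ _ (Mon_forget (op_mon M)) V F eta.
Proof.
pose T : monoid M := free_monoid V^*.
pose v : @mor M V^* (mcar T) := free_var V^*.
pose al : @mor M V V^*^* := alpha c D V.
have alm : mono al by exact: alpha_mono.
pose mem n (f : star D (mcar T) n) := exists x : (V : dgvect k) n, dg_ap al x = dg_ap (dual v) f.
have cl n : subclosed (@mem n).
  split=> [|a f g [x xE] [y yE]]; first by exists 0; rewrite !dg_ap0.
  by exists (a *: x + y); rewrite !dg_apP xE yE.
have dd n f : mem n f -> mem (n - 1) (dg_d (star D (mcar T)) n f).
  by move=> [x xE]; exists (dg_d (V : dgvect k) n x); rewrite !dg_ap_d xE.
pose K := SubComplex cl dd.
pose C := largest_comonoid K; pose i := largest_incl K.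
have [p pE] : exists p : @mor M (ccar C) V, al \oc p = dual v \oc i.
  apply: (mono_lift (mono_inj alm)) => n x.
  exact: ((largest_stable K).1 _ _ (sub_inclS x)).
exists C, p => Y f0; pose f : @mor M (ccar Y) V := f0; rewrite -/f.
have fE : al \oc f = flatD (dual f) by rewrite -[dual f]compm1 flat_nat_cod.
have [g [gv gu]] := free_universal (dual f : @mor (dgVect k) V^* (mcar (full_dual_monoid D Y))).
have {}gv : mhom g \oc v = dual f by exact: gv.
have gE : dual v \oc flatD (mhom g : @mor M (mcar T) (ccar Y)^*) = al \oc f.
  by rewrite -flat_nat_dom fE; congr (flatD _); exact: gv.
have [|h hE] := largest_universal (K := K)
    (hom_coalgebraic (g : monoid_hom T (dual_monoid c D Y))).
  by move=> n y; exists (dg_ap f y); rewrite -!dg_ap_comp gE.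
exists h; split.
  by apply: alm; rewrite -[LHS]/(al \oc (p \oc comhom h)) compmA pE -compmA [i \oc _]hE.
move=> h' h'f; apply: comon_hom_ext; rewrite hE.
pose h1 : @mor (Comon M) Y C := h'; rewrite -/h1.
have [g' g'E] := coalgebraic_hom (largest_incl_coalgebraic h1).
have -> : g = g'.
  apply: gu; rewrite -[LHS]/(mhom g' \oc v) g'E -flat_nat_cod compmA -pE -compmA.
  by rewrite [p \oc _](h'f : p \oc comhom h1 = f) fE flatK.
by rewrite g'E flatK.
Qed.

Lemma dg_P10_op : P10 (op_mon M).
Proof. exact/left_adjoint_of_universal/cofree_universal. Qed.

End Cofree.

Theorem theorem5p23 (k : fieldType) :
  exists (S : is_monoidal (C := dgVect k) (@dg_tens k) (dg_unit k))
         (c : is_braided (Monoidal S)),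
    let M := Monoidal S in
    [/\ dg_koszul c, symmetric_braiding c & inhabited (closed_structure M)] /\
    (all_properties M /\ all_properties (op_mon M)) /\
    ((forall (A B : M) (f : mor A B), mono f -> extremal_mono f) /\
     (forall (A B : M) (f : mor A B), epi f -> extremal_epi f)) /\
    (forall cl : closed_structure M,
      let D := closed_prerigid cl in
      [/\ (forall (A B : M) (f : mor A B), mono f -> epi (dualm D f)),
          (forall U V : M,
             [/\ mono (alpha c D U),
                 mono (theta c D U V) &
                 mono (flat c (theta_inv c D U V))])
        & inhabited (finite_dual c D) /\
          forall (F : finite_dual c D) (A : Mon M), mono (kappa F A)]).
Proof.
exists (dg_mon_str k), (dg_braid k); cbv zeta; split.
  split; first exact: dg_koszul_dgM.
  - by move=> A B; exact: swapK.
  - by split; exact: dg_closed.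
split; first split.
- split; first by split; [exact: dg_P1|exact: dg_P2|exact: dg_P3|exact: dg_P4|exact: dg_P5].
  split; last exact: dg_P10.
  by split; [exact: dg_P5a|exact: dg_P6|exact: dg_P7|exact: dg_P8|exact: dg_P9].
- split.
    by split; [exact: dg_P1_op|exact: dg_P2_op|exact: dg_P3_op|exact: dg_P4_op|exact: dg_P5_op].
  split; last exact: dg_P10_op.
  by split; [exact: dg_P5a_op|exact: dg_P6_op|exact: dg_P7_op|exact: dg_P8_op|exact: dg_P9_op].
split; first by split=> A B f; [exact: all_mono_extremal|exact: all_epi_extremal].
move=> cl; split.
- by move=> A B f fm; exact: dual_mono_epi.
- by move=> U V; split; [exact: alpha_mono|exact: theta_mono|exact: flat_theta_mono].
- by split; [split; exact: dg_finite_dual|move=> F A; exact: kappa_mono].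
Qed.
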